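(* Let $G\subset \mathrm{Homeo}_+(\mathbb S^1)$ be a finitely generated, virtually free group (possibly virtually cyclic). Then $G$ is free-by-finite cyclic: there exist $m\in\mathbb N$ and a free subgroup $F\subset G$ of index $m$ such that $G$ fits into a short exact sequence $$1\to F\to G\to \mathbb Z_m\to 0.$$ Conversely, any finitely generated finite cyclic extension of a free group (i.e. any finitely generated group $G$ fitting into a short exact sequence $1\to F\to G\to\mathbb Z_m\to 0$ with $F$ free and $m\in\mathbb N$) can be realized as a locally discrete group of real-analytic circle diffeomorphisms, i.e. is isomorphic to a locally discrete subgroup of $\mathrm{Diff}^\omega_+(\mathbb S^1)$.
   Context: $\mathrm{Homeo}_+(\mathbb S^1)$ and $\mathrm{Diff}^\omega_+(\mathbb S^1)$ are the groups of orientation-preserving homeomorphisms, respectively real-analytic diffeomorphisms, of the circle; $\mathbb Z_m=\mathbb Z/m\mathbb Z$. A group is virtually free if it contains a free subgroup of finite index. Local discreteness. Let $G\subset\mathrm{Diff}^\omega_+(\mathbb S^1)$ and let $\Lambda\subset\mathbb S^1$ be a minimal invariant compact set for $G$ (the whole circle, a Cantor set, or a finite orbit). $G$ is ($C^1$) locally discrete if for every interval $I$ intersecting $\Lambda$, the restriction of the identity to $I$ is isolated in $\{g|_I: g\in G\}\subset C^1(I;\mathbb S^1)$ for the $C^1$ topology. (When $G$ has finite orbits, this does not depend on the choice of $\Lambda$.) *)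

(* Defs.v *)
From HB Require Import structures.
From mathcomp Require Import all_boot all_order all_algebra all_fingroup.
From mathcomp Require Import all_classical all_reals all_analysis.

Set Implicit Arguments.
Unset Strict Implicit.
Unset Printing Implicit Defensive.

Import Order.TTheory GRing.Theory Num.Theory.
Import numFieldNormedType.Exports.

Local Open Scope classical_set_scope.
Local Open Scope ring_scope.
Local Open Scope quotient_scope.

Section Groups.
Local Open Scope group_scope.
Implicit Types gT fT hT qT : groupType.

Definition subgroup gT (H : set gT) : Prop :=
  H 1 /\ forall x y, H x -> H y -> H (x * y^-1).

Definition generated gT (A : set gT) : set gT := smallest (@subgroup gT) A.

Definition finitely_generated gT (G : set gT) : Prop :=
  exists s : seq gT, G = generated [set` s].

(* A letter (x, true) stands for x^-1, and (x, false) for x. *)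
Definition letter_value gT (l : gT * bool) : gT := if l.2 then l.1^-1 else l.1.

Definition word_value gT (w : seq (gT * bool)) : gT :=
  \prod_(l <- w) letter_value l.

Definition reduced_word gT (w : seq (gT * bool)) : bool :=
  sorted (fun k l => ~~ ((k.1 == l.1) && (k.2 != l.2))) w.

Definition free_basis gT (F B : set gT) : Prop :=
  F = generated B /\
  forall w : seq (gT * bool), w <> [::] -> (forall l, l \in w -> B l.1) ->
    reduced_word w -> word_value w <> 1.

Definition free_group gT (F : set gT) : Prop := exists B, free_basis F B.

Definition has_index gT (G F : set gT) (n : nat) : Prop :=
  exists t : 'I_n -> gT, (forall i, G (t i)) /\
    forall g, G g -> exists! i, F ((t i)^-1 * g).

Definition virtually_free gT (G : set gT) : Prop :=
  exists F : set gT, [/\ F `<=` G, free_group F & exists n, has_index G F n].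

Definition hom_on gT hT (G : set gT) (f : gT -> hT) : Prop :=
  forall x y, G x -> G y -> f (x * y) = f x * f y.

Definition isomorphic gT hT (G : set gT) (H : set hT) : Prop :=
  exists f : gT -> hT, hom_on G f /\ set_bij G H f.

(* 1 -> F -> G -> qT -> 1, where only the values of i on F and of p on G
   matter. *)
Definition short_exact fT gT qT (F : set fT) (G : set gT)
    (i : fT -> gT) (p : gT -> qT) : Prop :=
  [/\ hom_on F i, set_inj F i, hom_on G p, p @` G = [set: qT]
    & i @` F = [set x | G x /\ p x = 1]].

End Groups.

(* For 0 < m, the additive group Z/mZ. *)
Notation Zmod m := 'I_(m.-1.+1).

Section Circle.
Variable R : realType.

Definition eqmodZ (x y : R) : bool := x - y \is a Num.int.

Lemma eqmodZ_equiv : equiv_class_of eqmodZ.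
Proof.
split=> [x|x y|y x z]; rewrite /eqmodZ.
- by rewrite subrr rpred0.
- by rewrite -(opprB y x) rpredN.
- by move=> xy yz; rewrite -(subrKA y) rpredD.
Qed.

Canonical eqmodZ_equivRel := EquivRelPack eqmodZ_equiv.

Definition circle : Type := quotient_topology {eq_quot eqmodZ}.

HB.instance Definition _ := Topological.on circle.
HB.instance Definition _ := Quotient.on circle.

Definition circle_proj (t : R) : circle := \pi_circle t.

Lemma circle_projP (t s : R) :
  (circle_proj t = circle_proj s) <-> (t - s \is a Num.int).
Proof.
split; first by move/(@eqquotP _ eqmodZ_equivRel {eq_quot eqmodZ} t s).
by move=> ts; apply/(@eqquotP _ eqmodZ_equivRel {eq_quot eqmodZ} t s).
Qed.

Lemma circle_proj_surj (z : circle) : exists t, circle_proj t = z.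
Proof. by exists (generic_quotient.repr z); exact: reprK. Qed.

Definition is_lift (f : circle -> circle) (F : R -> R) : Prop :=
  forall t, f (circle_proj t) = circle_proj (F t).

Definition homeomorphism (f : circle -> circle) : Prop :=
  exists g : circle -> circle,
    [/\ cancel f g, cancel g f, continuous f & continuous g].

Definition orientation_preserving (f : circle -> circle) : Prop :=
  exists F : R -> R, [/\ is_lift f F, continuous F & {homo F : x y / x < y}].

Lemma homeomorphism_id : homeomorphism id.
Proof. by exists id; split=> // x; exact: cvg_id. Qed.

Lemma homeomorphism_comp f g :
  homeomorphism f -> homeomorphism g -> homeomorphism (f \o g).
Proof.
move=> [f' [fK f'K cf cf']] [g' [gK g'K cg cg']].
exists (g' \o f'); split.
- by move=> x /=; rewrite fK gK.
- by move=> x /=; rewrite g'K f'K.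
- by move=> x; apply: continuous_comp; [exact: cg|exact: cf].
- by move=> x; apply: continuous_comp; [exact: cf'|exact: cg'].
Qed.

Lemma orientation_preserving_id : orientation_preserving id.
Proof. by exists id; split=> // x; exact: cvg_id. Qed.

Lemma orientation_preserving_comp f g : orientation_preserving f ->
  orientation_preserving g -> orientation_preserving (f \o g).
Proof.
move=> [F [fF cF iF]] [G [gG cG iG]]; exists (F \o G); split.
- by move=> t /=; rewrite gG fF.
- by move=> x; apply: continuous_comp; [exact: cG|exact: cF].
- by move=> x y xy; apply/iF/iG.
Qed.

Lemma increasing_lift_surj f F : is_lift f F -> continuous F ->
  {homo F : x y / x < y} -> forall y, exists x, F x = y.
Proof.
move=> fF cF iF y.
have step a : F a + 1 <= F (a + 1).
  have : F (a + 1) - F a \is a Num.int.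
    apply/circle_projP; rewrite -!fF; congr f; apply/circle_projP.
    by rewrite addrAC subrr add0r rpred1.
  have : 0 < F (a + 1) - F a by rewrite subr_gt0 iF// ltrDl.
  move=> /[swap] /intrP[k kE]; rewrite kE ltr0z gtz0_ge1 -(ler1z R) -kE.
  by rewrite lerBrDl.
have up (n : nat) : F 0 + n%:R <= F n%:R.
  elim: n => [|n IH]; first by rewrite addr0.
  by rewrite -natr1 addrA (le_trans _ (step _))// lerD2r.
have dn (n : nat) : F (- n%:R) <= F 0 - n%:R.
  elim: n => [|n IH]; first by rewrite oppr0 addr0.
  rewrite -natr1 opprD addrA lerBrDr (le_trans (step _))//.
  by rewrite subrK.
pose n := Num.bound `|y - F 0|.
have yn : `|y - F 0| <= n%:R.
  by rewrite ltW// archi_boundP.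
have [|||x _ <-] := @IVT R F (- n%:R) n%:R y; last by exists x.
- by rewrite ge0_cp.
- exact: continuous_subspaceT.
- move: yn; rewrite ler_norml => /andP[yn1 yn2].
  rewrite ge_min le_max; apply/andP; split; apply/orP; [left|right].
    by rewrite (le_trans (dn n))// -lerBrDl.
  by rewrite (le_trans _ (up n))// -lerBlDl.
Qed.

Lemma orientation_preserving_inv f g : cancel f g -> cancel g f ->
  orientation_preserving f -> orientation_preserving g.
Proof.
move=> fK gK [F [fF cF iF]].
have leF : {mono F : a b / a <= b} by exact: le_mono.
have ltF : {mono F : a b / a < b} by exact: leW_mono.
have /choice[G GK] := increasing_lift_surj fF cF iF.
have FK : cancel F G by move=> x; apply: (inc_inj leF); rewrite GK.
exists G; split.
- by move=> t; rewrite -{1}(GK t) -fF fK.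
- move=> t; apply/cvgrPdist_lt => e e0.
  have t1 : F (G t - e) < t by rewrite -{2}(GK t) ltF ltrBlDr ltrDl.
  have t2 : t < F (G t + e) by rewrite -{1}(GK t) ltF ltrDl.
  near=> s; rewrite distrC ltr_distl -ltF -(ltF (G s)) !GK.
  apply/andP; split; near: s; [exact: lt_nbhsr|exact: lt_nbhsl].
- by move=> x y xy; rewrite -ltF !GK.
Unshelve. all: by end_near. Qed.

Record homeo_plus := HomeoPlus {
  homeo_plus_fun :> circle -> circle;
  homeo_plus_homeo : homeomorphism homeo_plus_fun;
  homeo_plus_orient : orientation_preserving homeo_plus_fun }.

HB.instance Definition _ := gen_eqMixin homeo_plus.
HB.instance Definition _ := gen_choiceMixin homeo_plus.

Lemma homeo_plus_ext (f g : homeo_plus) : f =1 g -> f = g.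
Proof.
case: f g => [f hf of_] [g hg og] /= /funext fg.
by move: hf of_; rewrite fg => hf of_; congr HomeoPlus; exact: Prop_irrelevance.
Qed.

Definition homeo_plus_one : homeo_plus :=
  HomeoPlus homeomorphism_id orientation_preserving_id.

Definition homeo_plus_mul (f g : homeo_plus) : homeo_plus :=
  HomeoPlus (homeomorphism_comp (homeo_plus_homeo f) (homeo_plus_homeo g))
    (orientation_preserving_comp (homeo_plus_orient f) (homeo_plus_orient g)).

Lemma homeo_plus_inv_ex (f : homeo_plus) :
  exists g : homeo_plus, cancel f g /\ cancel g f.
Proof.
have [g [fK gK cf cg]] := homeo_plus_homeo f.
have hg : homeomorphism g by exists f.
have og := orientation_preserving_inv fK gK (homeo_plus_orient f).
by exists (HomeoPlus hg og).
Qed.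

Definition homeo_plus_inv (f : homeo_plus) : homeo_plus :=
  projT1 (cid (homeo_plus_inv_ex f)).

Lemma homeo_plus_invK (f : homeo_plus) : cancel f (homeo_plus_inv f).
Proof. by have [] := projT2 (cid (homeo_plus_inv_ex f)). Qed.

Lemma homeo_plus_invKV (f : homeo_plus) : cancel (homeo_plus_inv f) f.
Proof. by have [] := projT2 (cid (homeo_plus_inv_ex f)). Qed.

Lemma homeo_plus_mulA : associative homeo_plus_mul.
Proof. by move=> f g h; exact: homeo_plus_ext. Qed.

Lemma homeo_plus_mul1 : left_id homeo_plus_one homeo_plus_mul.
Proof. by move=> f; exact: homeo_plus_ext. Qed.

Lemma homeo_plus_mulr1 : right_id homeo_plus_one homeo_plus_mul.
Proof. by move=> f; exact: homeo_plus_ext. Qed.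

Lemma homeo_plus_mulV : left_inverse homeo_plus_one homeo_plus_inv homeo_plus_mul.
Proof. by move=> f; apply: homeo_plus_ext; exact: homeo_plus_invK. Qed.

Lemma homeo_plus_mulrV : right_inverse homeo_plus_one homeo_plus_inv homeo_plus_mul.
Proof. by move=> f; apply: homeo_plus_ext; exact: homeo_plus_invKV. Qed.

HB.instance Definition _ := isGroup.Build homeo_plus homeo_plus_mulA
  homeo_plus_mul1 homeo_plus_mulr1 homeo_plus_mulV homeo_plus_mulrV.

Definition real_analytic (F : R -> R) : Prop :=
  forall x, exists (a : nat -> R) (r : R), 0 < r /\
    forall h, `|h| < r -> pseries a h @ \oo --> F (x + h).

Definition circle_analytic (f : circle -> circle) : Prop :=
  exists F : R -> R, is_lift f F /\ real_analytic F.

(* Diff^omega_+(S^1) as a subset of Homeo_+(S^1); the inverse must be analytic too. *)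
Definition analytic_diffeo : set homeo_plus :=
  [set f : homeo_plus | circle_analytic f /\ circle_analytic (f^-1)%g].

Definition invariant_set (G : set homeo_plus) (L : set circle) : Prop :=
  forall g, G g -> g @` L `<=` L.

Definition minimal_invariant_compact (G : set homeo_plus) (L : set circle) :
    Prop :=
  [/\ L !=set0, compact L, invariant_set G L
    & forall K : set circle, K !=set0 -> compact K -> invariant_set G K ->
        K `<=` L -> K = L].

(* J is a set of reals and I := circle_proj @` J is the corresponding subset of
   the circle.  For J an interval, g is at C^1-distance less than e from the
   identity on I when some lift of g is so on J. *)
Definition C1_close_to_id (J : set R) (e : R) (g : circle -> circle) : Prop :=
  exists F : R -> R, [/\ is_lift g F, continuous F
    & forall t, J t -> `|F t - t| < e /\ `|derive1 F t - 1| < e].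

Definition id_isolated_on (G : set homeo_plus) (J : set R) : Prop :=
  exists e : R, 0 < e /\ forall g, G g -> C1_close_to_id J e g ->
    forall t, J t -> g (circle_proj t) = circle_proj t.

(* The intervals of the circle are the images of the intervals of the line,
   of any type (open, closed or half-open) but not reduced to a point. *)
Definition locally_discrete (G : set homeo_plus) : Prop :=
  forall L, minimal_invariant_compact G L ->
  forall J : set R, is_interval J -> (exists a b, [/\ J a, J b & a < b]) ->
    circle_proj @` J `&` L !=set0 -> id_isolated_on G J.

End Circle.

(* Main.v *)
From HB Require Import structures.
Require Import Defs.
From mathcomp Require Import all_boot all_order all_algebra all_fingroup.
From mathcomp Require Import all_classical all_reals all_analysis.
From mathcomp Require Import zify ring lra.
From mathcomp Require Import finmap.

(** Both halves of the theorem rest on a tree.  A finitely generated group with a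
    free subgroup [F] of finite index acts on a tree whose oriented edges are
    subsets of the group, with finite boundary in a Cayley graph
    ([virtually_free_cut_tree]).  To find these subsets, consider the axes of the
    nontrivial elements of [F] and their translates.  Among the subsets that
    separate the two ends of such a line, take those with the smallest boundary,
    and among these the ones that are crossed by the fewest bonds, a bond being a
    subset with a boundary of bounded size that is connected and has a connected
    complement.  Sizes of boundaries and numbers of crossings are submodular, so
    any two of the chosen subsets are nested ([opt_nested]).  As only finitely
    many of them separate two given points, they are the half trees of a tree, in
    which every nontrivial element of [F] is a translation.  A subgroup that fixes
    no vertex and inverts no edge is free ([free_action_free]).

    For a group [G] of circle homeomorphisms, consider the group of all lifts of
    its elements to the line.  It is a central extension of [G] by the integers.
    Over the free group [F] it splits, which gives a retraction onto the
    integers, and the transfer extends it to a homomorphism on all lifts that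
    multiplies the integers by the index of [F] ([exists_transfer]).  Reducing this
    homomorphism, one gets a homomorphism from [G] onto a finite cyclic group
    whose kernel embeds in the group of lifts ([cyclic_quotient]).  Increasing
    homeomorphisms of the line have no torsion, so the kernel is torsion free; it
    acts freely on the tree, since its elements have powers in [F], and is free.

    Conversely, let [p] be a homomorphism from [G] onto the integers modulo [m],
    with free kernel.  A half turn is the real analytic map of the circle given by
    [t -> - l / t] in projective coordinates, or a lift of it to a finite cover;
    when [l] is small, it contracts the complement of a neighbourhood of a finite
    set into this neighbourhood.  Assign to each oriented edge [C] of the tree a
    half turn [flip C], about a finite subset of a fixed grid, in such a way that
    an element [g] of the group permutes the half turns through the rotation by
    [p g / m], and that distinct edges with the same origin, as well as opposite
    edges, get disjoint sets ([center_disjoint]); here one uses that the kernel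
    acts freely.  Let crossing the edge [C] mean applying [flip C] after the
    inverse of the half turn of the opposite edge.  The graph being a tree, this
    defines a transport from any vertex to any other one, and the rotation by
    [p g / m] followed by the transport from [v] to [g v] is a homomorphism in
    [g] ([exists_lifted_action]).

    The half turns along a path without backtracking play ping-pong: they contract
    any interval that avoids the neighbourhood of the last edge, exponentially in
    the length of the path ([path_contract]).  Hence the homomorphism is
    injective.  Moreover every interval has a subinterval that all but finitely
    many elements shrink to less than half its length ([exists_shrinking]): if
    the interval is too small to see this directly, it is first expanded by
    crossing edges backwards.  An element whose derivative is close to 1 does not
    shrink any interval by half, so the group is locally discrete on every
    interval. *)

Set Implicit Arguments.
Unset Strict Implicit.
Unset Printing Implicit Defensive.

Import Order.TTheory GRing.Theory Num.Theory.
Import numFieldNormedType.Exports.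

Local Open Scope classical_set_scope.

(** * Words and free bases *)

Section Words.
Local Open Scope group_scope.
Variable gT : groupType.
Implicit Types (x y : gT) (l : gT * bool) (w : seq (gT * bool)) (B F : set gT).

Definition inv_letter l : gT * bool := (l.1, ~~ l.2).
Definition word_over B w : Prop := forall l, l \in w -> B l.1.

Lemma inv_letterK : involutive inv_letter.
Proof. by case=> x b; rewrite /inv_letter /= negbK. Qed.

Lemma letter_valueV l : letter_value (inv_letter l) = (letter_value l)^-1.
Proof. by case: l => x [] /=; rewrite /letter_value /= ?invgK. Qed.

Lemma word_value_cons l w : word_value (l :: w) = letter_value l * word_value w.
Proof. by rewrite /word_value big_cons. Qed.

Lemma word_value_nil : word_value [::] = 1 :> gT.
Proof. by rewrite /word_value big_nil. Qed.

Lemma word_value_cat w w' :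
  word_value (w ++ w') = word_value w * word_value w'.
Proof. by rewrite /word_value big_cat. Qed.

Definition inv_word w := rev (map inv_letter w).

Lemma word_valueV w : word_value (inv_word w) = (word_value w)^-1.
Proof.
elim: w => [|l w IH]; first by rewrite /inv_word /= word_value_nil invg1.
rewrite /inv_word /= rev_cons -cats1 word_value_cat [X in X * _]IH.
by rewrite !word_value_cons word_value_nil mulg1 letter_valueV invgM.
Qed.

Lemma reduced_wordE w :
  reduced_word w = sorted (fun k l => l != inv_letter k) w.
Proof.
have E : (fun k l : gT * bool => ~~ ((k.1 == l.1) && (k.2 != l.2)))
    =2 (fun k l => l != inv_letter k).
  move=> [x b] [y c]; rewrite /inv_letter /= xpair_eqE eq_sym; congr (~~ (_ && _)).
  by case: b; case: c.
by case: w => // l w; rewrite /reduced_word /=; exact: eq_path.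
Qed.

Lemma word_over_cat B w w' :
  word_over B (w ++ w') <-> word_over B w /\ word_over B w'.
Proof.
split=> [H|[H H'] l]; last by rewrite mem_cat => /orP[/H|/H'].
by split=> l lw; apply: H; rewrite mem_cat lw ?orbT.
Qed.

Lemma word_over_cons B l w :
  word_over B (l :: w) <-> B l.1 /\ word_over B w.
Proof.
split=> [H|[H H'] k]; last by rewrite inE => /orP[/eqP->//|/H'].
by split=> [|k kw]; apply: H; rewrite inE ?eqxx ?kw ?orbT.
Qed.

Lemma word_over_inv B w : word_over B w -> word_over B (inv_word w).
Proof.
by move=> H l; rewrite mem_rev => /mapP[k /H Bk ->].
Qed.

Lemma generated_wordP B x :
  Defs.generated B x <-> exists2 w, word_over B w & word_value w = x.
Proof.
split.
- move/(_ [set y | exists2 w, word_over B w & word_value w = y]); apply; split.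
    split; first by exists [::]; [|exact: word_value_nil].
    move=> _ _ [w ww <-] [w' ww' <-]; exists (w ++ inv_word w').
      by apply/word_over_cat; split=> //; exact: word_over_inv.
    by rewrite word_value_cat word_valueV.
  move=> y By; exists [:: (y, false)]; first by move=> l; rewrite inE => /eqP->.
  by rewrite word_value_cons word_value_nil mulg1.
- move=> [w + <-] A [[A1 AM] BA]; elim: w => [_|l w IH].
    by rewrite word_value_nil.
  move=> /word_over_cons[Bl /IH Aw]; rewrite word_value_cons.
  have AV y : A y -> A y^-1 by move=> Ay; rewrite -[y^-1]mul1g; exact: AM.
  rewrite -[word_value w]invgK; apply: AM; last exact: AV.
  by rewrite /letter_value; case: ifP => _; [apply: AV|]; exact: BA.
Qed.

Lemma nonreducedP w : ~~ reduced_word w ->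
  exists w1 l w2, w = w1 ++ l :: inv_letter l :: w2.
Proof.
rewrite reduced_wordE; case: w => // l w.
elim: w l => // k w IH l /=; rewrite negb_and negbK => /orP[/eqP->|/IH].
  by exists [::], l, w.
by move=> [w1 [l' [w2 ->]]]; exists (l :: w1), l', w2.
Qed.

Lemma word_value_cancel w1 l w2 :
  word_value (w1 ++ l :: inv_letter l :: w2) = word_value (w1 ++ w2).
Proof.
by rewrite !word_value_cat !word_value_cons letter_valueV mulKVg.
Qed.

Lemma reduced_wordP B w : word_over B w ->
  exists w', [/\ word_over B w', reduced_word w' & word_value w' = word_value w].
Proof.
have [n] := ubnP (size w); elim: n w => // n IH w wn Bw.
have [rw|/nonreducedP[w1 [l [w2 E]]]] := boolP (reduced_word w); first by exists w.
have [||w' [Bw' rw' E']] := IH (w1 ++ w2).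
- by move: wn; rewrite E !size_cat /=; lia.
- move: Bw; rewrite E => /word_over_cat[B1 /word_over_cons[_ /word_over_cons[_ B2]]].
  exact/word_over_cat.
by exists w'; split=> //; rewrite E' E word_value_cancel.
Qed.

Lemma reduced_inv_word w : reduced_word w -> reduced_word (inv_word w).
Proof.
rewrite !reduced_wordE /inv_word => H.
rewrite -[sorted _ _]/(sorted _ _) rev_sorted sorted_map.
apply: sub_sorted H => k l /=; rewrite (inj_eq (can_inj inv_letterK)).
by apply: contra => /eqP->; rewrite inv_letterK.
Qed.

Section FreeBasis.
Variables (F B : set gT).
Hypothesis FB : free_basis F B.

Lemma free_basisP x :
  F x <-> exists w, [/\ word_over B w, reduced_word w & word_value w = x].
Proof.
rewrite FB.1 generated_wordP; split=> [[w Bw <-]|[w [Bw _ <-]]]; last by exists w.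
by have [w' ?] := reduced_wordP Bw; exists w'.
Qed.

Lemma reduced_word_eq1 w :
  word_over B w -> reduced_word w -> word_value w = 1 -> w = [::].
Proof.
move=> Bw rw w1; have [//|/eqP wN] := eqVneq w [::].
by have := FB.2 w wN Bw rw.
Qed.

(** If the first letters differ, the inverse of one word followed by the other
    is still reduced. *)
Lemma reduced_word_inj w w' : word_over B w -> word_over B w' ->
  reduced_word w -> reduced_word w' -> word_value w = word_value w' -> w = w'.
Proof.
elim: w w' => [|l w IH] w'.
  by move=> _ Bw' _ rw'; rewrite word_value_nil => /esym/(reduced_word_eq1 Bw' rw')->.
case: w' => [|l' w'].
  by move=> Bw _ rw _; rewrite word_value_nil => /(reduced_word_eq1 Bw rw).
move=> Bw Bw' rw rw'; have [<-|ll'] := eqVneq l l'.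
  rewrite !word_value_cons => /mulgI E; congr (_ :: _); apply: IH E.
  - by move/word_over_cons: Bw => [].
  - by move/word_over_cons: Bw' => [].
  - by move: rw; rewrite !reduced_wordE => /path_sorted.
  - by move: rw'; rewrite !reduced_wordE => /path_sorted.
move=> E; exfalso.
apply: (FB.2 (inv_word (l :: w) ++ l' :: w')).
- by rewrite /inv_word /= rev_cons; case: (rev _).
- by apply/word_over_cat; split=> //; exact: word_over_inv.
- have := reduced_inv_word rw; rewrite !reduced_wordE /inv_word /= rev_cons.
  move: (rev _) => v; rewrite -cats1; case: v => [|k v] /=.
    by rewrite inv_letterK [l' == l]eq_sym ll' /=; move: rw'; rewrite reduced_wordE.
  rewrite -catA /= !cat_path /= inv_letterK [l' == l]eq_sym ll' /= => /and3P[-> -> _] /=.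
  by move: rw'; rewrite reduced_wordE.
- by rewrite word_value_cat word_valueV E mulVg.
Qed.

(** Universal property of a free basis: reducing a word to the empty one only
    uses cancellations, which survive any substitution of the letters. *)
Lemma free_basis_ext (hT : groupType) (f : gT -> hT) w : word_over B w ->
  word_value w = 1 -> word_value [seq (f l.1, l.2) | l <- w] = 1.
Proof.
have [n] := ubnP (size w); elim: n w => // n IH w wn Bw w1.
have [rw|/nonreducedP[w1' [l [w2 E]]]] := boolP (reduced_word w).
  by rewrite (reduced_word_eq1 Bw rw w1) /word_value big_nil.
have E2 : word_value [seq (f l.1, l.2) | l <- w] =
          word_value [seq (f l.1, l.2) | l <- w1' ++ w2].
  rewrite E !map_cat /= /word_value !big_cat !big_cons /= mulgA -mulgA.
  by congr (_ * _); rewrite /letter_value /=; case: (l.2) => /=; rewrite ?mulKg ?mulVKg.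
rewrite E2; apply: IH.
- by move: wn; rewrite E !size_cat /=; lia.
- move: Bw; rewrite E => /word_over_cat[B1 /word_over_cons[_ /word_over_cons[_ B2]]].
  exact/word_over_cat.
- by rewrite -w1 E word_value_cancel.
Qed.

End FreeBasis.
End Words.

(** * Bonds of a graph *)

Section Bonds.
Variable V : choiceType.
Implicit Types (E : V -> V -> Prop) (C D X : V -> bool).

Definition compl C : V -> bool := fun x => ~~ C x.
Definition meet C D : V -> bool := fun x => C x && D x.
Definition join C D : V -> bool := fun x => C x || D x.

Definition boundary E C : set (V * V) :=
  [set e | E e.1 e.2 /\ C e.1 != C e.2].

(** Connectedness of the subgraph induced on [D], phrased without paths: a set
    closed under adjacency inside [D] and meeting [D] contains [D]. *)
Definition conn E D : Prop := forall X, (exists a, D a /\ X a) ->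
  (forall u v, E u v -> D u -> D v -> X u -> X v) -> forall v, D v -> X v.

Definition crossing C D : Prop := forall b b', exists x, C x = b /\ D x = b'.

Lemma complK : involutive compl.
Proof. by move=> C; apply/funext => x; rewrite /compl negbK. Qed.

Lemma boundaryC E C : boundary E (compl C) = boundary E C.
Proof.
have E2 u v : (compl C u != compl C v) = (C u != C v).
  by rewrite /compl; case: (C u) (C v) => [] [].
by apply/seteqP; split=> -[u v] /= []; rewrite /boundary /= E2.
Qed.

Lemma crossing_sym C D : crossing C D -> crossing D C.
Proof. by move=> H b b'; have [x [? ?]] := H b' b; exists x. Qed.

Lemma crossingC C D : crossing (compl C) D <-> crossing C D.
Proof.
split=> H b b'; have [x [Hx ?]] := H (~~ b) b'; exists x; split=> //.
  by move: Hx; rewrite /compl; case: (C x) b => [] [].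
by rewrite /compl Hx negbK.
Qed.

Lemma conn_boundary E C : (forall u v, E u v -> E v u) -> conn E xpredT ->
  (exists x, C x) -> (exists x, ~~ C x) -> exists u v, [/\ E u v, C u & ~~ C v].
Proof.
move=> Es Ec [x Cx] [y /negP Cy]; apply: contrapT => H; apply: Cy.
apply: (Ec C) => //; first by exists x.
move=> u v Euv _ _ Cu; have [//|Cv] := boolP (C v).
by exfalso; apply: H; exists u, v.
Qed.

(** The boundary is bounded by the length of a list, so that the bound goes down
    by one when an edge is removed from the graph. *)
Definition bond_between E (K : nat) x y : set (V -> bool) :=
  [set D | [/\ conn E D, conn E (compl D), D x, ~~ D y
    & exists s : seq (V * V), (size s <= K)%N /\
        forall u v, E u v -> D u -> ~~ D v -> (u, v) \in s]].

(** The edges of a path from [x] to [y], obtained by the connectedness principle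
    applied to the set of vertices [y] for which such a list exists. *)
Lemma cut_edges E x y : conn E xpredT ->
  exists Q : seq (V * V), (forall e, e \in Q -> E e.1 e.2) /\
    forall D, D x -> ~~ D y -> exists u v, [/\ (u, v) \in Q, D u & ~~ D v].
Proof.
move=> Ec; pose P y := exists Q : seq (V * V), (forall e, e \in Q -> E e.1 e.2) /\
    forall D, D x -> ~~ D y -> exists u v, [/\ (u, v) \in Q, D u & ~~ D v].
suff /asboolP : `[<P y>] by [].
apply: (Ec (fun y => `[<P y>])) => //.
  exists x; split=> //; apply/asboolP; exists [::]; split=> // D Dx.
  by rewrite Dx.
move=> u v Euv _ _ /asboolP[Q [QE QD]]; apply/asboolP; exists ((u, v) :: Q); split.
  by move=> e; rewrite inE => /orP[/eqP->|/QE].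
move=> D Dx Dv; have [Du|Du] := boolP (D u); first by exists u, v; rewrite inE eqxx.
by have [a [b [ab Da Db]]] := QD D Dx Du; exists a, b; rewrite inE ab orbT.
Qed.

(** A path from [x] to [y] has finitely many edges, and a bond between [x] and
    [y] contains one of them.  Removing that edge leaves a bond with one edge
    less, unless it disconnects the graph, and then the bond is determined. *)
Lemma finite_bonds E K x y : (forall u v, E u v -> E v u) -> conn E xpredT ->
  finite_set (bond_between E K x y).
Proof.
elim: K E x y => [|K IH] E x y Es Ec.
  rewrite (_ : bond_between _ _ _ _ = set0); first exact: finite_set0.
  rewrite -subset0 => D [cD cD' Dx Dy [s [+ sD]]].
  rewrite leqn0 size_eq0 => /eqP s0.
  have [||u [v [Euv Du Dv]]] := conn_boundary (C := D) Es Ec; [by exists x|by exists y|].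
  by have := sD u v Euv Du Dv; rewrite s0.
have [Q [QE QD]] := cut_edges x y Ec.
pose S (e : V * V) := bond_between E K.+1 x y `&` [set D : V -> bool | D e.1 /\ ~~ D e.2].
apply: (@sub_finite_set _ _ (\bigcup_(e in [set` Q]) S e)).
  move=> D BD; have [_ _ Dx Dy _] := BD.
  by have [u [v [uvQ Du Dv]]] := QD D Dx Dy; exists (u, v).
apply: bigcup_finite => [|[u v] /= uvQ]; first exact: finite_seq.
have /= Euv := QE _ uvQ.
(* The graph without the edge [(u, v)]. *)
pose E' a b := [/\ E a b, (a, b) != (u, v) & (a, b) != (v, u)].
have Es' a b : E' a b -> E' b a.
  by move=> [? h1 h2]; split; [exact: Es| |]; rewrite xpair_eqE andbC -xpair_eqE.
have conn' D : D u != D v -> conn E D -> conn E' D.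
  move=> Duv cD X Xa Xc; apply: cD => // a b Eab Da Db; apply: Xc => //; split=> //.
    by apply/eqP => -[au bv]; move: Duv; rewrite -au -bv Da Db eqxx.
  by apply/eqP => -[au bv]; move: Duv; rewrite -au -bv Da Db eqxx.
have SE' D : S (u, v) D -> [/\ conn E' D, conn E' (compl D) & bond_between E' K u v D].
  move=> [[cD cD' Dx Dy [s [sK sE]]] /= [Du Dv]].
  have cD1 : conn E' D by apply: conn' => //; rewrite Du (negbTE Dv).
  have cD2 : conn E' (compl D) by apply: conn' => //; rewrite /compl Du (negbTE Dv).
  split=> //; split=> //; exists [seq e <- s | e != (u, v)]; split.
    have uvs : (u, v) \in s by exact: sE.
    rewrite size_filter -ltnS (leq_trans _ sK)// -(count_predC (pred1 (u, v)) s).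
    by rewrite -[X in (X < _)%N]add0n ltn_add2r -has_count has_pred1.
  by move=> a b [Eab ab1 ab2] Da Db; rewrite mem_filter ab1 sE.
have [cT|ncT] := pselect (conn E' xpredT).
  by apply: sub_finite_set (IH E' u v Es' cT) => D /SE'[].
(* The graph without the edge falls into two parts, closed under adjacency;
   [D], connected on both sides, can only be one of them. *)
have {ncT} [X [[a Xa] [b Xb] Xc]] : exists X, [/\ exists a, X a, exists b, ~~ X b
    & forall a b, E' a b -> X a -> X b].
  apply: contrapT => H; apply: ncT => X [a [_ Xa]] Xc b _; apply: contrapT => /negP Xb.
  apply: H; exists X; split; [by exists a|by exists b|].
  by move=> c d Ecd; apply: Xc.
apply: (@sub_finite_set _ _ [set X; compl X]); last exact: finite_set2.
move=> D /SE'[cD cD' _].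
have XD : (exists a, D a /\ X a) -> forall c, D c -> X c.
  by move=> aD; apply: cD => // c d Ecd _ _; apply: Xc.
have XD' : (exists a, ~~ D a /\ X a) -> forall c, ~~ D c -> X c.
  by move=> aD; apply: cD' => // c d Ecd _ _; apply: Xc.
have [Da|Da] := boolP (D a).
- left; apply/funext => c; have [Dc|Dc] := boolP (D c).
    by rewrite XD//; exists a.
  apply/esym/negbTE/negP => Xc'; move/negP: Xb; apply.
  have [Db|Db] := boolP (D b); first by apply: XD Db; exists a.
  by apply: XD' Db; exists c.
- right; apply/funext => c; rewrite /compl; have [Dc|Dc] := boolP (D c).
    apply/esym/negP => Xc'; move/negP: Xb; apply.
    have [Db|Db] := boolP (D b); first by apply: XD Db; exists c.
    by apply: XD' Db; exists a.
  by rewrite XD'//; exists a.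
Qed.

End Bonds.

(** * Nested optimal cuts *)

Definition ncard (T : choiceType) (A : set T) : nat := #|` fset_set A|.

Lemma ncard_sub (T : choiceType) (A B : set T) :
  finite_set B -> A `<=` B -> (ncard A <= ncard B)%N.
Proof.
move=> fB AB; have fA := sub_finite_set AB fB.
by apply: fsubset_leq_card; rewrite -fset_set_sub.
Qed.

Lemma ncard_lt (T : choiceType) (A B : set T) x :
  finite_set B -> A `<=` B -> B x -> ~ A x -> (ncard A < ncard B)%N.
Proof.
move=> fB AB Bx Ax; have fA := sub_finite_set AB fB.
apply: fproper_ltn_card; rewrite fproperEneq; apply/andP; split.
  by apply/eqP => /fset_set_inj E; apply: Ax; rewrite E.
by rewrite -fset_set_sub.
Qed.

Lemma ncard_gt0 (T : choiceType) (A : set T) x :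
  finite_set A -> A x -> (0 < ncard A)%N.
Proof.
by move=> fA Ax; rewrite cardfs_gt0; apply/fset0Pn; exists x; rewrite in_fset_set//; exact: mem_set.
Qed.

(** Elements of both sets count twice on either side; the next two lemmas compare
    such counts. *)
Lemma ncardUI (T : choiceType) (A B : set T) : finite_set A -> finite_set B ->
  (ncard (A `|` B) + ncard (A `&` B) = ncard A + ncard B)%N.
Proof. by move=> fA fB; rewrite /ncard fset_setU// fset_setI// cardfsUI. Qed.

Lemma ncard_submod (T : choiceType) (A B P Q : set T) :
  finite_set P -> finite_set Q -> A `|` B `<=` P `|` Q -> A `&` B `<=` P `&` Q ->
  (ncard A + ncard B <= ncard P + ncard Q)%N.
Proof.
move=> fP fQ U I.
have /[!finite_setU][[fA fB]] : finite_set (A `|` B).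
  by apply: sub_finite_set U _; rewrite finite_setU.
rewrite -(ncardUI fA fB) -(ncardUI fP fQ) leq_add//; apply: ncard_sub => //; last exact: finite_setIl.
by rewrite finite_setU.
Qed.

Lemma ncard_submod_lt (T : choiceType) (A B P Q : set T) x :
  finite_set P -> finite_set Q -> A `|` B `<=` P `|` Q -> A `&` B `<=` P `&` Q ->
  (P `|` Q) x -> ~ (A `|` B) x -> (ncard A + ncard B < ncard P + ncard Q)%N.
Proof.
move=> fP fQ U I PQx ABx.
have /[!finite_setU][[fA fB]] : finite_set (A `|` B).
  by apply: sub_finite_set U _; rewrite finite_setU.
rewrite -(ncardUI fA fB) -(ncardUI fP fQ) -addSn leq_add//; last by apply: ncard_sub => //; exact: finite_setIl.
by apply: (@ncard_lt _ _ _ x) => //; rewrite finite_setU.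
Qed.

Section Nested.
Variables (V : choiceType) (E : V -> V -> Prop) (K : nat).
Hypothesis Es : forall u v, E u v -> E v u.
Hypothesis Ec : conn E xpredT.
Local Notation cut := (V -> bool).
Implicit Types C D X : cut.

Local Notation bd := (boundary E).
Definition fin_bd C := finite_set (bd C).

Definition bond D :=
  [/\ conn E D, conn E (compl D), fin_bd D & (ncard (bd D) <= K)%N].

Lemma fin_bdC C : fin_bd C -> fin_bd (compl C).
Proof. by rewrite /fin_bd boundaryC. Qed.

Lemma finite_bond x y : finite_set [set D | [/\ bond D, D x & ~~ D y]].
Proof.
apply: sub_finite_set (finite_bonds K x y Es Ec) => D [[c1 c2 fD sD] Dx Dy].
split=> //; exists (fset_set (bd D)); split=> // u v Euv Du Dv.
by rewrite in_fset_set//; apply: mem_set; split=> //=; rewrite Du (negbTE Dv).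
Qed.

Lemma crossing_edge C D : conn E D -> (exists x, C x /\ D x) ->
  (exists x, ~~ C x /\ D x) -> exists u v, [/\ bd C (u, v), D u & D v].
Proof.
move=> cD [x [Cx Dx]] [y [Cy Dy]]; apply: contrapT => H; move/negP: Cy; apply.
apply: cD Dy; first by exists x.
move=> u v Euv Du Dv Cu; have [//|Cv] := boolP (C v).
exfalso; apply: H; exists u, v; split=> //; split=> //=.
by rewrite Cu (negbTE Cv).
Qed.

(** A bond crossing [C] is connected on both sides, so it separates two of the
    finitely many vertices on the boundary of [C]. *)
Lemma finite_crossing C : fin_bd C -> finite_set [set D | bond D /\ crossing C D].
Proof.
move=> fC.
pose S (e : (V * V) * (V * V)) := [set D | [/\ bond D, D e.1.1 & ~~ D e.2.1]].
apply: (@sub_finite_set _ _ (\bigcup_(e in bd C `*` bd C) S e)); last first.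
  by apply: bigcup_finite => [|e _]; [exact: finite_setX|exact: finite_bond].
move=> D [BD X]; have [c1 c2 _ _] := BD.
have [||u [v [uv Du _]]] := @crossing_edge C D c1.
- by have [x] := X true true; exists x.
- by have [x [Cx ?]] := X false true; exists x; rewrite Cx.
have [||u' [v' [uv' Du' _]]] := @crossing_edge C (compl D) c2.
- by have [x [? Dx]] := X true false; exists x; rewrite /compl Dx.
- by have [x [Cx Dx]] := X false false; exists x; rewrite /compl Cx Dx.
by exists ((u, v), (u', v')).
Qed.

Definition ncross C := ncard [set D | bond D /\ crossing C D].

Lemma ncrossC C : ncross (compl C) = ncross C.
Proof.
by congr ncard; apply/seteqP; split=> D /= -[bD cD]; split=> //; apply/crossingC.
Qed.

Lemma boundary_corners C D :
  bd (meet C D) `|` bd (join C D) `<=` bd C `|` bd D /\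
  bd (meet C D) `&` bd (join C D) `<=` bd C `&` bd D.
Proof.
split=> -[u v] /=; rewrite /boundary /meet /join /=.
  by move: (C u) (C v) (D u) (D v) => [] [] [] [] [] [] // ? _; do ?[by left|by right].
by move: (C u) (C v) (D u) (D v) => [] [] [] [] [[? ?] [? ?]].
Qed.

Lemma fin_bd_corners C D :
  fin_bd C -> fin_bd D -> fin_bd (meet C D) /\ fin_bd (join C D).
Proof.
move=> fC fD; have : finite_set (bd (meet C D) `|` bd (join C D)).
  by apply: sub_finite_set (boundary_corners C D).1 _; rewrite finite_setU.
by rewrite finite_setU.
Qed.

(** Off the corner [meet C D] the points where [X] holds and fails lie outside
    [C] or outside [D]; if they lie outside different ones, a point outside both
    [C] and [D] decides. *)
Lemma crossing_meet C D X : crossing C D -> crossing (meet C D) X ->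
  crossing C X \/ crossing D X.
Proof.
move=> CD XA.
have CX b' : exists x, [/\ C x, D x & X x = b'].
  by have [x [/andP[? ?] ?]] := XA true b'; exists x.
have half (Y : cut) x y : (forall x, C x -> D x -> Y x) -> ~~ Y x -> ~~ Y y -> X x -> ~~ X y ->
    crossing Y X.
  move=> CDY Yx Yy Xx Xy [] b'; first by have [u [? ? ?]] := CX b'; exists u; rewrite CDY.
  by case: b'; [exists x|exists y]; split=> //; exact: negbTE.
have [x [xA Xx]] := XA false true; have [y [yA /negbT Xy]] := XA false false.
have [z [/negbT zC /negbT zD]] := CD false false.
have hC u v := half C u v (fun x Cx _ => Cx); have hD u v := half D u v (fun x _ Dx => Dx).
move/negbT: xA; move/negbT: yA; rewrite /meet !negb_and.
have [Xz|Xz] := boolP (X z) => /orP[yC|yD] /orP[xC|xD].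
- by left; exact: (hC x y).
- by left; exact: (hC z y).
- by right; exact: (hD z y).
- by right; exact: (hD x y).
- by left; exact: (hC x y).
- by right; exact: (hD x z).
- by left; exact: (hC x z).
- by right; exact: (hD x y).
Qed.

Lemma joinE C D : join C D = compl (meet (compl C) (compl D)).
Proof. by apply/funext => x; rewrite /join /meet /compl negb_and !negbK. Qed.

Lemma crossing_join C D X : crossing C D -> crossing (join C D) X ->
  crossing C X \/ crossing D X.
Proof.
move=> CD; rewrite joinE => /(crossingC _ X).1 mX.
have CD' : crossing (compl C) (compl D).
  by apply/crossingC; apply/crossing_sym/crossingC/crossing_sym.
by case: (crossing_meet CD' mX) => /(crossingC _ X).1; [left|right].
Qed.

Lemma crossing_both C D X : crossing (meet C D) X -> crossing (join C D) X ->
  crossing C X /\ crossing D X.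
Proof.
move=> XA XB; split=> b b'; case: b.
- by have [x [/andP[Cx Dx] Xx]] := XA true b'; exists x.
- by have [x [/norP[/negbTE ? _] Xx]] := XB false b'; exists x.
- by have [x [/andP[Cx Dx] Xx]] := XA true b'; exists x.
- by have [x [/norP[_ /negbTE ?] Xx]] := XB false b'; exists x.
Qed.

(** The inequality is strict because [C] crosses [D] but none of the corners. *)
Lemma ncross_corners C D : bond C -> bond D -> crossing C D ->
  (ncross (meet C D) + ncross (join C D) < ncross C + ncross D)%N.
Proof.
move=> BC BD CD; have [_ _ fC _] := BC; have [_ _ fD _] := BD.
apply: (@ncard_submod_lt _ _ _ _ _ C); [exact: finite_crossing|exact: finite_crossing|..].
- move=> X [] [BX cX].
    by case: (crossing_meet CD cX) => ?; [left|right].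
  by case: (crossing_join CD cX) => ?; [left|right].
- by move=> X [[BX h1] [_ h2]]; have [] := crossing_both h1 h2; split; split.
- by right; split=> //; exact: crossing_sym.
- move=> [] [_ X].
    by have [x [/andP[-> _]]] := X true false.
  by have [x [/norP[/negP + _] Cx]] := X false true.
Qed.

(** Each line has two ends, and each end lies on one side of every cut with
    finite boundary, compatibly with the Boolean operations. *)
Variables (line : Type) (p q : line -> cut -> bool).
Hypothesis pC : forall l C, fin_bd C -> p l (compl C) = ~~ p l C.
Hypothesis qC : forall l C, fin_bd C -> q l (compl C) = ~~ q l C.
Hypothesis pI : forall l C D, fin_bd C -> fin_bd D -> p l (meet C D) = p l C && p l D.
Hypothesis qI : forall l C D, fin_bd C -> fin_bd D -> q l (meet C D) = q l C && q l D.

Definition sep l C := fin_bd C /\ p l C != q l C.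
Hypothesis sepK : forall l, exists C, sep l C /\ (ncard (bd C) <= K)%N.

(** Cuts of minimal boundary may still cross each other; those that are crossed by
    the fewest bonds among them do not. *)
Definition opt l C := sep l C /\ forall D, sep l D ->
  (ncard (bd C) < ncard (bd D))%N \/
  ncard (bd C) = ncard (bd D) /\ (ncross C <= ncross D)%N.

Lemma sepC l C : sep l C -> sep l (compl C).
Proof.
move=> [fC pq]; split; first exact: fin_bdC.
by rewrite pC// qC//; case: (p l C) (q l C) pq => [] [].
Qed.

Lemma optC l C : opt l C -> opt l (compl C).
Proof. by move=> [sC H]; split; [exact: sepC|rewrite boundaryC ncrossC]. Qed.

Lemma opt_exists l : exists C, opt l C.
Proof.
pose P n := `[< exists C, sep l C /\ ncard (bd C) = n >].
have exP : exists n, P n.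
  by have [C [sC _]] := sepK l; exists (ncard (bd C)); apply/asboolP; exists C.
case: (ex_minnP exP) => n /asboolP[C [sC Cn]] nmin.
pose Q k := `[< exists D, [/\ sep l D, ncard (bd D) = n & ncross D = k] >].
have exQ : exists k, Q k by exists (ncross C); apply/asboolP; exists C.
case: (ex_minnP exQ) => k /asboolP[D [sD Dn Dk]] kmin.
exists D; split=> // D' sD'; rewrite Dn Dk.
have := nmin (ncard (bd D')); rewrite leq_eqVlt => /(_ _)/orP[|/eqP nD'|]; last by left.
  by apply/asboolP; exists D'.
by right; split=> //; apply: kmin; apply/asboolP; exists D'.
Qed.

Lemma opt_leq l C : opt l C -> (ncard (bd C) <= K)%N.
Proof.
move=> [_ H]; have [D [sD DK]] := sepK l.
by have [] := H D sD; move: DK; lia.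
Qed.

(** If an optimal cut [D] had a part [X] with no edge to the rest of [D], one of
    [X] and [D] minus [X] would separate the same line with a smaller boundary. *)
Lemma opt_conn l D : opt l D -> conn E D.
Proof.
move=> [[fD pqD] H] X [a [Da Xa]] Xc v Dv; apply: contrapT => /negP Xv.
pose A := meet D X; pose B := meet D (compl X).
have disj u w : A u -> B w -> ~ E u w.
  move=> /andP[Du Xu] /andP[Dw Xw] /Xc/(_ Du Dw Xu); exact/negP.
have out (Y : cut) u w : (forall x, Y x -> D x) -> (forall u w, Y u -> D w -> ~~ Y w -> ~ E u w) ->
    E u w -> Y u -> ~~ Y w -> ~~ D w.
  by move=> YD Yd Euw Yu Yw; apply/negP => Dw; apply: (Yd u w).
have bdY (Y : cut) : (forall x, Y x -> D x) -> (forall u w, Y u -> D w -> ~~ Y w -> ~ E u w) ->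
    bd Y `<=` bd D.
  move=> YD Yd [u w] [/= Euw Yuw]; split=> //=.
  have [Yu|Yu] := boolP (Y u).
    have Yw : ~~ Y w by move: Yuw; rewrite Yu; case: (Y w).
    by rewrite YD// (negbTE (out Y u w YD Yd Euw Yu Yw)).
  have Yw : Y w by move: Yuw; rewrite (negbTE Yu); case: (Y w).
  by rewrite (YD w)// (negbTE (out Y w u YD Yd (Es Euw) Yw Yu)).
have sA : forall x, A x -> D x by move=> x /andP[].
have sB : forall x, B x -> D x by move=> x /andP[].
have dA u w : A u -> D w -> ~~ A w -> ~ E u w.
  by move=> Au Dw Aw; apply: disj => //; rewrite /B /meet Dw; move: Aw; rewrite /A /meet Dw.
have dB u w : B u -> D w -> ~~ B w -> ~ E u w.
  move=> Bu Dw Bw /Es; apply: disj => //; move: Bw; rewrite /A /B /meet /compl Dw /=.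
  by rewrite negbK.
have fA : fin_bd A := sub_finite_set (bdY A sA dA) fD.
have fB : fin_bd B := sub_finite_set (bdY B sB dB) fD.
have Aa : A a by rewrite /A /meet Da Xa.
have Bv : B v by rewrite /B /meet /compl Dv Xv.
have dAB : bd A `&` bd B = set0.
  rewrite -subset0 => -[u w] [[/= Euw Auw] [_ Buw]].
  have := disj u w; have := disj w u; have := Es Euw.
  move: Auw Buw Euw; rewrite /= /A /B /meet /compl.
  case: (D u) (X u) (D w) (X w) => [] [] [] [] //= _ _ h1 h2.
  - by move=> _ h3; apply: h3.
  - by move=> h3 _; apply: h3.
have sz : (ncard (bd A) + ncard (bd B) <= ncard (bd D))%N.
  rewrite -(ncardUI fA fB) dAB /ncard fset_set0 cardfs0 addn0.
  by apply: ncard_sub => // e [/bdY|/bdY]; apply.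
have pos (Y : cut) x y : fin_bd Y -> Y x -> ~~ Y y -> (0 < ncard (bd Y))%N.
  move=> fY Yx Yy; have [||u [w [Euw Yu Yw]]] := conn_boundary (C := Y) Es Ec.
  - by exists x.
  - by exists y.
  apply: (@ncard_gt0 _ _ (u, w)) => //; split=> //=.
  by rewrite Yu (negbTE Yw).
have posA := pos A a v fA Aa (_ : ~~ A v); have posB := pos B v a fB Bv (_ : ~~ B a).
have {}posA : (0 < ncard (bd A))%N by apply: posA; rewrite /A /meet (negbTE Xv) andbF.
have {}posB : (0 < ncard (bd B))%N by apply: posB; rewrite /B /meet /compl Xa andbF.
have BE : B = meet D (compl A).
  by apply/funext => x; rewrite /B /A /meet /compl; case: (D x).
have pB : p l B = p l D && ~~ p l A by rewrite BE pI ?pC//; exact: fin_bdC.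
have qB : q l B = q l D && ~~ q l A by rewrite BE qI ?qC//; exact: fin_bdC.
have AE : A = meet D A by apply/funext => x; rewrite /A /meet; case: (D x).
have pA : p l A = p l D && p l A by rewrite {1}AE pI.
have qA : q l A = q l D && q l A by rewrite {1}AE qI.
have [sepA|sepB] : sep l A \/ sep l B.
  have [|nA] := pselect (p l A != q l A); first by left.
  right; split=> //; rewrite pB qB; move: nA pqD pA qA.
  by case: (p l A) (q l A) (p l D) (q l D) => [] [] [] [].
- by move: (H A sepA) sz posB; clear; lia.
- by move: (H B sepB) sz posA; clear; lia.
Qed.

Lemma opt_bond l C : opt l C -> bond C.
Proof.
move=> oC; split; [exact: opt_conn oC|exact: opt_conn (optC oC)|exact: oC.1.1|].
exact: opt_leq oC.
Qed.

(** Submodularity: the sizes of two opposite corners add up to at most the sizes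
    of [C] and [D], and strictly fewer bonds cross them.  By optimality the corners
    cannot separate one line each.  In the last case both separate the first line,
    and [C] and [D] are equally good, as each of them competes with the other. *)
Lemma opt_corners l l' C D : opt l C -> opt l' D -> crossing C D ->
  let A := meet C D in let B := join C D in
  ~ [|| (p l A != q l A) && (p l' B != q l' B),
        (p l B != q l B) && (p l' A != q l' A) |
        [&& p l A != q l A, p l B != q l B, p l D != q l D & p l' C != q l' C]].
Proof.
move=> oC oD CD A B.
have BC := opt_bond oC; have BD := opt_bond oD.
have m := ncross_corners BC BD CD; rewrite -/A -/B in m.
case: oC => [[fC _] oC]; case: oD => [[fD _] oD].
have [fA fB] := fin_bd_corners fC fD; rewrite -/A -/B in fA fB.
have b : (ncard (bd A) + ncard (bd B) <= ncard (bd C) + ncard (bd D))%N.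
  by apply: ncard_submod => //; have [] := boundary_corners C D.
case/or3P=> [/andP[h1 h2]|/andP[h1 h2]|/and4P[h1 h2 h3 h4]].
- by have := oC A (conj fA h1); have := oD B (conj fB h2); lia.
- by have := oC B (conj fB h1); have := oD A (conj fA h2); lia.
- have := oC A (conj fA h1); have := oC B (conj fB h2).
  by have := oC D (conj fD h3); have := oD C (conj fC h4); lia.
Qed.

(** For crossing cuts each of the four corners is the meet of [C] or its
    complement with [D] or its complement, and the positions of the four ends
    always put a pair of opposite corners in a situation that the preceding lemma
    excludes. *)
Lemma opt_nested l l' C D : opt l C -> opt l' D -> ~ crossing C D.
Proof.
move=> oC oD CD; have [[fC C1] _] := oC; have [[fD D1] _] := oD.
have CD' : crossing C (compl D) by apply/crossing_sym/crossingC/crossing_sym.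
have := opt_corners oC oD CD; have := opt_corners (optC oC) oD (proj2 (crossingC _ _) CD).
have := opt_corners oC (optC oD) CD'.
have := opt_corners (optC oC) (optC oD) (proj2 (crossingC _ _) CD').
have fC' := fin_bdC fC; have fD' := fin_bdC fD.
have pU m X Y : fin_bd X -> fin_bd Y -> p m (join X Y) = p m X || p m Y.
  move=> fX fY; have fX' := fin_bdC fX; have fY' := fin_bdC fY.
  have [? _] := fin_bd_corners fX' fY'.
  by rewrite joinE pC// pI// !pC// negb_and !negbK.
have qU m X Y : fin_bd X -> fin_bd Y -> q m (join X Y) = q m X || q m Y.
  move=> fX fY; have fX' := fin_bdC fX; have fY' := fin_bdC fY.
  have [? _] := fin_bd_corners fX' fY'.
  by rewrite joinE qC// qI// !qC// negb_and !negbK.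
have qCE : q l C = ~~ p l C by case: (p l C) (q l C) C1 => [] [].
have qDE : q l' D = ~~ p l' D by case: (p l' D) (q l' D) D1 => [] [].
rewrite /= !pU// !qU// !pI// !qI// !pC// !qC// qCE qDE.
by case: (p l C) (p l D) (q l D) (p l' C) (q l' C) (p l' D) => [] [] [] [] [] [].
Qed.

End Nested.

(** * Translates and ends in a Cayley graph *)

Lemma finite_nat_bound (A : set nat) :
  finite_set A -> exists N, forall n, A n -> (n < N)%N.
Proof.
move=> fA; exists (\max_(i <- fset_set A) i).+1 => n An.
by rewrite ltnS; apply: leq_bigmax_seq => //; rewrite in_fset_set//; exact: mem_set.
Qed.

Lemma finite_preimage_inj (T U : Type) (f : T -> U) (A : set U) :
  injective f -> finite_set A -> finite_set (f @^-1` A).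
Proof. by move=> fI; apply: finite_preimage => x y _ _ /fI. Qed.

Section Translates.
Local Open Scope group_scope.
Variable gT : groupType.
Implicit Types (g x y k : gT) (C D : gT -> bool).

Definition ltr g C : gT -> bool := fun x => C (g^-1 * x).

Lemma ltr1 C : ltr 1 C = C.
Proof. by apply/funext => x; rewrite /ltr invg1 mul1g. Qed.

Lemma ltrM g h C : ltr (g * h) C = ltr g (ltr h C).
Proof. by apply/funext => x; rewrite /ltr invgM mulgA. Qed.

Lemma ltrK g : cancel (ltr g) (ltr g^-1).
Proof. by move=> C; rewrite -ltrM mulVg ltr1. Qed.

Lemma ltrKV g : cancel (ltr g^-1) (ltr g).
Proof. by move=> C; rewrite -ltrM mulgV ltr1. Qed.

Lemma ltr_compl g C : ltr g (compl C) = compl (ltr g C).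
Proof. by []. Qed.

Definition eventually_in x k C : bool :=
  `[< exists N, forall n, (N <= n)%N -> C (x * k ^+ n) >].

Lemma eventually_ltr g x k C :
  eventually_in (g * x) k (ltr g C) = eventually_in x k C.
Proof.
congr asbool; apply/propeqP; split=> -[N H]; exists N => n /H.
  by rewrite /ltr -!mulgA mulKg.
by rewrite /ltr -!mulgA mulKg.
Qed.

Lemma eventually_meet x k C D :
  eventually_in x k (meet C D) = eventually_in x k C && eventually_in x k D.
Proof.
apply/asboolP/andP => [[N H]|[/asboolP[N H] /asboolP[M H']]].
  by split; apply/asboolP; exists N => n /H/andP[].
exists (maxn N M) => n; rewrite geq_max => /andP[/H Cn /H' Dn].
exact/andP.
Qed.

Lemma eventually_eq x k C y l D N :
  (forall n, (N <= n)%N -> C (x * k ^+ n) = D (y * l ^+ n)) ->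
  eventually_in x k C = eventually_in y l D.
Proof.
move=> H; apply/asboolP/asboolP => -[M H']; exists (maxn N M) => n;
  rewrite geq_max => /andP[/H E /H']; by rewrite E.
Qed.

Lemma ncard_image (T U : choiceType) (f : T -> U) (A : set T) : finite_set A ->
  (ncard (f @` A) <= ncard A)%N.
Proof. by move=> fA; rewrite /ncard fset_set_image// leq_imfset_card. Qed.

Lemma expg_inj k : (forall n, (0 < n)%N -> k ^+ n <> 1) -> injective (fun n => k ^+ n).
Proof.
move=> kn i j; wlog ij : i j / (i <= j)%N.
  by move=> H; case/orP: (leq_total i j) => h E; [|symmetry]; apply: H.
rewrite -(subnKC ij) expgnDr -[LHS]mulg1 => /mulgI E.
have [|H] := posnP (j - i)%N; first by lia.
by case: (kn _ H).
Qed.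

End Translates.

Section Cayley.
Local Open Scope group_scope.
Variables (gT : groupType) (S : seq gT).
Hypothesis genS : [set: gT] = Defs.generated [set` S].

Definition cayley (u v : gT) : Prop := exists2 s, s \in S & v = u * s \/ u = v * s.
Local Notation E := cayley.
Local Notation bd := (boundary E).

Lemma cayley_sym u v : E u v -> E v u.
Proof. by move=> [s Ss [H|H]]; exists s => //; [right|left]. Qed.

Lemma cayley_mul g u v : E u v -> E (g * u) (g * v).
Proof. by move=> [s Ss [->|->]]; exists s => //; rewrite mulgA; [left|right]. Qed.

Lemma generators_ind (P : gT -> Prop) : P 1 ->
  (forall s k, s \in S -> P k -> P (s * k) /\ P (s^-1 * k)) -> forall k, P k.
Proof.
move=> P1 PM k; have : [set: gT] k by [].
rewrite genS => /generated_wordP[w + <-]; elim: w => [|l w IH].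
  by rewrite word_value_nil.
move=> /word_over_cons[/= Sl /IH Pw]; rewrite word_value_cons /letter_value.
by have [? ?] := PM l.1 _ Sl Pw; case: ifP.
Qed.

Lemma cayley_conn : conn E xpredT.
Proof.
move=> X [a [_ Xa]] Xc v _; rewrite -[v](mulVKg a).
have : forall k b, X b -> X (b * k).
  apply: generators_ind => [b|s k Ss IH]; first by rewrite mulg1.
  split=> b Xb; rewrite mulgA; apply: IH; apply: (Xc b) => //; exists s => //; first by left.
  by right; rewrite mulgVK.
exact.
Qed.

Lemma bd_ltr g C : bd (ltr g C) = (fun e => (g * e.1, g * e.2)) @` bd C.
Proof.
apply/seteqP; split=> [[u v] /= [Euv Cuv]|_ [[u v] [/= Euv Cuv] <-]].
  exists (g^-1 * u, g^-1 * v); last by rewrite /= !mulVKg.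
  by split=> //=; exact: cayley_mul.
by split=> /=; [exact: cayley_mul|rewrite /ltr !mulKg].
Qed.

Lemma fin_bd_ltr g C : fin_bd E C -> fin_bd E (ltr g C).
Proof. by rewrite /fin_bd bd_ltr; exact: finite_image. Qed.

Lemma ncard_ltr g C : fin_bd E C -> ncard (bd (ltr g C)) = ncard (bd C).
Proof.
have le h D : fin_bd E D -> (ncard (bd (ltr h D)) <= ncard (bd D))%N.
  by move=> fD; rewrite bd_ltr; exact: ncard_image.
move=> fC; apply/eqP; rewrite eqn_leq le//=.
by rewrite -{1}(ltrK g C) le//; exact: fin_bd_ltr.
Qed.

Lemma conn_ltr g D : conn E D -> conn E (ltr g D).
Proof.
move=> cD X [a [Da Xa]] Xc v Dv.
have -> : X v = ltr g^-1 X (g^-1 * v) by rewrite /ltr invgK mulVKg.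
apply: cD => //; first by exists (g^-1 * a); rewrite /ltr invgK mulVKg.
move=> u w Euw Du Dw; rewrite /ltr invgK; apply: Xc; [exact: cayley_mul|..].
  by rewrite /ltr mulKg.
by rewrite /ltr mulKg.
Qed.

Lemma bond_ltr K g D : bond E K D -> bond E K (ltr g D).
Proof.
case=> c1 c2 fD sD; split; [exact: conn_ltr| |exact: fin_bd_ltr|by rewrite ncard_ltr].
by rewrite -ltr_compl; exact: conn_ltr.
Qed.

Lemma crossing_ltr g (C D : gT -> bool) : crossing C D -> crossing (ltr g C) (ltr g D).
Proof.
by move=> H b b'; have [x [Cx Dx]] := H b b'; exists (g * x); rewrite /ltr mulKg.
Qed.

Lemma ncross_ltr K g C : fin_bd E C -> ncross E K (ltr g C) = ncross E K C.
Proof.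
have le h D : fin_bd E D -> (ncross E K (ltr h D) <= ncross E K D)%N.
  move=> fD.
  have fX := finite_crossing K cayley_sym cayley_conn fD.
  apply: leq_trans (ncard_image (ltr h) fX); apply: ncard_sub; first exact: finite_image.
  move=> X [BX cX]; exists (ltr h^-1 X); last exact: ltrKV.
  by split; [exact: bond_ltr|rewrite -(ltrK h D); exact: crossing_ltr].
move=> fC; apply/eqP; rewrite eqn_leq le//=.
by rewrite -{1}(ltrK g C) le//; exact: fin_bd_ltr.
Qed.

(** A set with finite boundary is almost invariant under right translations. *)
Lemma fin_bd_shift C k : fin_bd E C -> finite_set [set u | C u != C (u * k)].
Proof.
move=> fC; move: k; apply: generators_ind => [|s k Ss fk].
  by rewrite (_ : [set _ | _] = set0)// -subset0 => u; rewrite /= mulg1 eqxx.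
have step y : finite_set [set u | C u != C (u * y)] ->
    finite_set [set u | C u != C (u * (y * k))].
  move=> fy; apply: (@sub_finite_set _ _
      ([set u | C u != C (u * y)] `|` (fun u => u * y) @^-1` [set u | C u != C (u * k)])).
    move=> u /=; have [<-|] := eqVneq (C u) (C (u * y)); last by left.
    by right; rewrite /= -mulgA; have [E1|//] := eqVneq (C u) (C (u * y)).
  rewrite finite_setU; split=> //; apply: finite_preimage_inj fk; exact: mulIg.
split; apply: step; apply: sub_finite_set (finite_image fst fC) => u /= Cu.
  by exists (u, u * s) => //; split=> //; exists s => //; left.
by exists (u, u * s^-1) => //; split=> //; exists s => //; right; rewrite mulgVK.
Qed.

Section Ends.
Variables (x k : gT).
Hypothesis kn : forall n, (0 < n)%N -> k ^+ n <> 1.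

Lemma eventually_shift C y : fin_bd E C ->
  exists N, forall n, (N <= n)%N -> C (x * k ^+ n) = C (x * k ^+ n * y).
Proof.
move=> /(fin_bd_shift y) fy.
have inj : injective (fun n => x * k ^+ n) by move=> i j /mulgI/(expg_inj kn).
have [N HN] := finite_nat_bound (finite_preimage_inj inj fy).
exists N => n Nn; apply/eqP; apply: contrapT => /negP H.
by have := HN n H; rewrite ltnNge Nn.
Qed.

(** A ray crosses the boundary of [C] finitely often, so it ends on one side. *)
Lemma eventually_const C : fin_bd E C ->
  exists N, forall n, (N <= n)%N -> C (x * k ^+ n) = C (x * k ^+ N).
Proof.
move=> /(eventually_shift k)[N HN]; exists N => n Nn.
rewrite -(subnKC Nn); elim: (n - N)%N => [|m IH]; first by rewrite addn0.
by rewrite addnS expgSr mulgA -HN ?leq_addr.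
Qed.

Lemma eventually_compl C : fin_bd E C ->
  eventually_in x k (compl C) = ~~ eventually_in x k C.
Proof.
move=> /eventually_const[N HN]; have [CN|CN] := boolP (C (x * k ^+ N)).
  have -> : eventually_in x k C by apply/asboolP; exists N => n /HN->.
  apply/negbTE/asboolP => -[M HM].
  have := HM (maxn N M) (leq_maxr _ _).
  by rewrite /compl HN ?leq_maxl// CN.
have -> : eventually_in x k (compl C) by apply/asboolP; exists N => n /HN; rewrite /compl => ->.
apply/esym/asboolP => -[M HM].
have := HM (maxn N M) (leq_maxr _ _).
by rewrite HN ?leq_maxl// (negbTE CN).
Qed.

End Ends.
End Cayley.

(** * Cylinders of a free subgroup of finite index *)

Section VirtuallyFree.
Local Open Scope group_scope.
Variables (gT : groupType) (S : seq gT) (F B : set gT) (n : nat) (t : 'I_n -> gT).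
Hypothesis genS : [set: gT] = Defs.generated [set` S].
Hypothesis FB : free_basis F B.
Hypothesis tP : forall g, exists! i, F ((t i)^-1 * g).
Implicit Types (x y g f : gT) (l : gT * bool) (w v : seq (gT * bool)).

Local Notation E := (cayley S).
Local Notation bd := (boundary E).

Lemma free_subgroup : subgroup F.
Proof.
split; first by apply/(free_basisP FB); exists [::]; rewrite word_value_nil.
move=> x y; rewrite FB.1 => /generated_wordP[w Bw <-] /generated_wordP[v Bv <-].
apply/generated_wordP; exists (w ++ inv_word v).
  by apply/word_over_cat; split=> //; exact: word_over_inv.
by rewrite word_value_cat word_valueV.
Qed.

Lemma freeM x y : F x -> F y -> F (x * y).
Proof.
move=> Fx Fy; have [F1 FM] := free_subgroup; rewrite -[y]invgK; apply: (FM) => //.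
by rewrite -[y^-1]mul1g; apply: FM.
Qed.

Lemma freeV x : F x -> F x^-1.
Proof. by have [F1 FM] := free_subgroup; rewrite -[x^-1]mul1g; apply: FM. Qed.

Lemma coset_exists x : exists i, F (x * t i).
Proof.
have [i [Fi _]] := tP x^-1; exists i.
by have := freeV Fi; rewrite invgM !invgK.
Qed.

Lemma coset_uniq x i j : F (x * t i) -> F (x * t j) -> i = j.
Proof.
have F' a : F (x * t a) -> F ((t a)^-1 * x^-1) by move=> /freeV; rewrite invgM.
have [k [_ H]] := tP x^-1; move=> /F' /H <- /F' /H <- //.
Qed.

(** The letter [l] starts the reduced word of [x].  These sets are the standard
    cuts of the tree of the free group. *)
Definition starts_with l x : bool :=
  `[< exists v, [/\ word_over B (l :: v), reduced_word (l :: v)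
        & word_value (l :: v) = x] >].

Lemma starts_withE l v : word_over B v -> reduced_word v ->
  starts_with l (word_value v) = (ohead v == Some l).
Proof.
move=> Bv rv; apply/asboolP/eqP => [[v' [Bv' rv' E]]|].
  by rewrite -(reduced_word_inj FB Bv' Bv rv' rv E).
by case: v Bv rv => //= l' v Bv rv [<-]; exists v.
Qed.

Lemma starts_withF l x : starts_with l x -> F x.
Proof. by move=> /asboolP[v [Bv rv <-]]; apply/(free_basisP FB); exists (l :: v). Qed.

(** Multiplying a reduced word on the right by a letter changes its first letter
    only if the word is empty, or consists of the letter that gets cancelled. *)
Lemma starts_with_letter l l' x : B l.1 -> F x ->
  starts_with l' x != starts_with l' (x * letter_value l) ->
  l'.1 = l.1 /\ (x = 1 \/ x = letter_value l').
Proof.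
move=> Bl /(free_basisP FB)[w [Bw rw <-]]; rewrite starts_withE//.
have [rwl|] := boolP (reduced_word (rcons w l)).
  rewrite (_ : _ * _ = word_value (rcons w l)); last first.
    by rewrite -cats1 word_value_cat word_value_cons word_value_nil mulg1.
  rewrite starts_withE//; last first.
    by rewrite -cats1; apply/word_over_cat; split=> // k; rewrite inE => /eqP->.
  case: w Bw rw rwl => [_ _ _|k w _ _ _]; last by rewrite /= eqxx.
  by rewrite word_value_nil /=; have [[->]|] := eqVneq (Some l) (Some l') => // _; split=> //; left.
case/lastP: w Bw rw => [//|w k Bw rw] nr.
have kl : l = inv_letter k.
  apply/eqP; apply: contraR nr; rewrite !reduced_wordE.
  move: rw; rewrite reduced_wordE; case: w {Bw} => [|a w] /=; first by move=> _ ->.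
  by rewrite !rcons_path last_rcons => -> ->.
have Bw' : word_over B w by move: Bw; rewrite -cats1 => /word_over_cat[].
have rw' : reduced_word w.
  move: rw; rewrite !reduced_wordE; case: w {Bw Bw' nr} => // a w /=.
  by rewrite rcons_path => /andP[].
rewrite -!cats1 word_value_cat word_value_cons word_value_nil mulg1.
rewrite kl letter_valueV mulgK starts_withE//.
case: w {nr Bw Bw' rw rw'} => [|a w]; last by rewrite /= eqxx.
rewrite /= word_value_nil mul1g; have [[->]|] := eqVneq (Some k) (Some l') => // _.
by split=> //; right.
Qed.

(** One letter at a time.  The second part gives the independence of the cylinders
    of letters over [l.1] from the elements that do not involve [l.1]. *)
Lemma starts_with_word w l : word_over B w ->
  let D := [set x | F x /\ starts_with l x != starts_with l (x * word_value w)] in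
  finite_set D /\ (l.1 \notin [seq k.1 | k <- w] -> D = set0).
Proof.
elim: w => [_|k w IH /word_over_cons[Bk /IH[f0 e0]]].
  have -> : [set x | F x /\ starts_with l x != starts_with l (x * word_value [::])] = set0.
    by rewrite -subset0 => x [_]; rewrite word_value_nil mulg1 eqxx.
  by split.
have Fk : F (letter_value k).
  by rewrite FB.1; apply/generated_wordP; exists [:: k];
    [move=> ?; rewrite inE => /eqP->|rewrite word_value_cons word_value_nil mulg1].
set D1 := [set x | F x /\ starts_with l x != starts_with l (x * letter_value k)].
set D0 := [set x | F x /\ _] in f0 e0.
have sub : [set x | F x /\ starts_with l x != starts_with l (x * word_value (k :: w))] `<=`
    D1 `|` (fun x => x * letter_value k) @^-1` D0.
  move=> x [Fx]; rewrite word_value_cons mulgA => H.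
  have [E1|] := eqVneq (starts_with l x) (starts_with l (x * letter_value k)); last by left.
  by right; split; [exact: freeM|rewrite -E1].
split.
  apply: sub_finite_set sub _; rewrite finite_setU; split; last first.
    by apply: finite_preimage_inj f0; exact: mulIg.
  apply: (@sub_finite_set _ _ [set 1; letter_value l]); last exact: finite_set2.
  by move=> x [Fx /(starts_with_letter Bk Fx)[_ []]]; [left|right].
rewrite /= inE negb_or => /andP[lk lw]; rewrite -subset0 => x /sub[[Fx H]|].
  by have [E1 _] := starts_with_letter Bk Fx H; rewrite E1 eqxx in lk.
by rewrite /= (e0 lw).
Qed.

(** Extension to the whole group of a cylinder of the free group, along the right
    cosets of [F]. *)
Definition cylinder l x : bool := `[< exists i, starts_with l (x * t i) >].

Lemma cylinderE l x i : F (x * t i) -> cylinder l x = starts_with l (x * t i).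
Proof.
move=> Fx; apply/asboolP/idP => [[j H]|]; last by exists i.
by rewrite (coset_uniq Fx (starts_withF H)).
Qed.

(** An edge of the Cayley graph amounts, after moving its ends to [F], to the right
    translation by one of the finitely many elements [ff e]; only the letters of
    their words matter. *)
Lemma fin_bd_cylinder : exists A : seq gT, forall l, fin_bd E (cylinder l) /\
  (l.1 \notin A -> bd (cylinder l) = set0).
Proof.
have wP f : exists w, F f -> word_over B w /\ word_value w = f.
  have [Ff|nF] := pselect (F f); last by exists [::].
  by have /(free_basisP FB)[w [? _ ?]] := Ff; exists w.
have {wP}[wd wdP] := choice wP.
pose ff (e : gT * ('I_n * 'I_n)) := (t e.2.1)^-1 * e.1 * t e.2.2.
pose idx : seq (gT * ('I_n * 'I_n)) :=
  [seq (s, ij) | s <- S, ij <- enum {: 'I_n * 'I_n}].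
exists (flatten [seq [seq k.1 | k <- wd (ff e)] | e <- idx]) => l.
pose U e := [set u | [/\ F (u * t e.2.1), F (ff e)
  & starts_with l (u * t e.2.1) != starts_with l (u * t e.2.1 * ff e)]].
have fU e : finite_set (U e) /\
    (e \in idx -> l.1 \notin flatten [seq [seq k.1 | k <- wd (ff e)] | e <- idx] -> U e = set0).
  have [Ff|nF] := pselect (F (ff e)); last first.
    have -> : U e = set0 by rewrite -subset0 => u [].
    by split.
  have [wB wE] := wdP _ Ff; have [h1 h2] := starts_with_word l wB; rewrite wE in h1 h2.
  set D := [set x | _] in h1 h2.
  have UD : U e `<=` (fun u => u * t e.2.1) @^-1` D by move=> u [].
  split.
    by apply: sub_finite_set UD _; apply: finite_preimage_inj h1; exact: mulIg.
  move=> ee lA; rewrite -subset0 => u /UD; rewrite /preimage /= h2//.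
  by apply: contra lA => lw; apply/flattenP; exists [seq k.1 | k <- wd (ff e)] => //; exact: map_f.
have bdU : bd (cylinder l) `<=` \bigcup_(e in [set` idx])
    ((fun u => (u, u * e.1)) @` U e `|` (fun u => (u * e.1, u)) @` U e).
  have key u s : s \in S -> cylinder l u != cylinder l (u * s) ->
      exists2 e, e \in idx & U e u /\ e.1 = s.
    move=> Ss; have [i Fi] := coset_exists u; have [j Fj] := coset_exists (u * s).
    rewrite (cylinderE _ Fi) (cylinderE _ Fj) => H.
    have fE : u * t i * ff (s, (i, j)) = u * s * t j.
      by rewrite /ff /= -!mulgA mulVKg.
    exists (s, (i, j)).
      by apply: allpairs_f => //; rewrite mem_enum.
    split=> //; split=> //=; last by rewrite fE.
    have := freeM (freeV Fi) Fj; congr F.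
    by rewrite /ff /= invgM -!mulgA mulKg.
  move=> [u v] [/= [s Ss [vE|uE]]] H.
    have [|e ee [Ue es]] := key u s Ss; first by rewrite -vE.
    by exists e => //; left; exists u => //; rewrite es vE.
  have [|e ee [Ue es]] := key v s Ss; first by rewrite -uE eq_sym.
  by exists e => //; right; exists v => //; rewrite es uE.
split.
  apply: sub_finite_set bdU _; apply: bigcup_finite; first exact: finite_seq.
  move=> e ee; rewrite finite_setU.
  by split; apply: finite_image; have [] := fU e.
move=> lA; rewrite -subset0 => e /bdU[e' ee' [] [u + _]].
  by have [_ ->] := fU e'.
by have [_ ->] := fU e'.
Qed.

Lemma coset1 : exists i, F (t i).
Proof. by have [i] := coset_exists 1; rewrite mul1g; exists i. Qed.

(** As the group is finitely generated, the basis is finite: the cylinder of a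
    basis element that the generators do not involve would have an empty
    boundary, in a connected graph. *)
Lemma cylinder_bound : exists K, forall l, B l.1 ->
  fin_bd E (cylinder l) /\ (ncard (bd (cylinder l)) <= K)%N.
Proof.
have [A HA] := fin_bd_cylinder.
have inA l : B l.1 -> l.1 \in A.
  move=> Bl; apply: contrapT => /negP /(HA l).2 E0.
  have [i Fi] := coset1.
  have Bl1 : word_over B [:: l] by move=> k; rewrite inE => /eqP->.
  have Fl : F (letter_value l).
    apply/(free_basisP FB); exists [:: l].
    by rewrite word_value_cons word_value_nil mulg1.
  have [||u [v [Euv lu lv]]] :=
      conn_boundary (C := cylinder l) (@cayley_sym _ S) (cayley_conn genS).
  - exists (letter_value l * (t i)^-1); rewrite (@cylinderE _ _ i) mulgVK//.
    have <- : word_value [:: l] = letter_value l by rewrite word_value_cons word_value_nil mulg1.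
    by rewrite starts_withE//= eqxx.
  - exists (t i)^-1; rewrite (@cylinderE _ _ i) mulVg; last exact: free_subgroup.1.
    by rewrite -(@word_value_nil gT) starts_withE.
  have : bd (cylinder l) (u, v) by split=> //=; rewrite lu (negbTE lv).
  by rewrite E0.
exists (\max_(l <- [seq (a, b) | a <- A, b <- [:: true; false]]) ncard (bd (cylinder l))).
move=> [a b] Bl; split; first by have [] := HA (a, b).
apply: (@leq_bigmax_seq _ _ _ (fun l => ncard (bd (cylinder l)))) => //.
by apply: allpairs_f; [exact: (inA (a, b))|case: b {Bl}].
Qed.

Local Notation nocancel := (fun a b : gT * bool => b != inv_letter a).

(** Strip the first and the last letter as long as they are inverse. *)
Lemma cyclic_reduction w : word_over B w -> reduced_word w -> w <> [::] ->
  exists u c, [/\ word_over B c, c <> [::], path.cycle nocancel c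
    & word_value w = u * word_value c * u^-1].
Proof.
have [m] := ubnP (size w); elim: m w => // m IH [//|l w] wm Bw rw _.
have [Bl Bw'] := (word_over_cons _ _ _).1 Bw.
move: rw; rewrite reduced_wordE /= => rw.
have [lz|lz] := eqVneq l (inv_letter (last l w)); last first.
  exists 1, (l :: w); split=> //; first by rewrite /= rcons_path rw.
  by rewrite mul1g invg1 mulg1.
case/lastP: w wm Bw Bw' rw lz => [_ _ _ _|w z wm Bw Bw' rw].
  by move=> /(congr1 snd) /=; case: l.2.
rewrite last_rcons => lz.
have wN : w <> [::] by move=> w0; move: rw; rewrite w0 /= lz inv_letterK eqxx.
have Bw2 : word_over B w by move: Bw'; rewrite -cats1 => /word_over_cat[].
have rw2 : reduced_word w.
  move: rw; rewrite reduced_wordE rcons_path => /andP[+ _].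
  by case: (w) => //= a v /andP[].
have [|u [c [Bc cN cc E1]]] := IH w _ Bw2 rw2 wN.
  by move: wm; rewrite /= size_rcons; lia.
exists (letter_value l * u), c; split=> //.
rewrite word_value_cons -cats1 word_value_cat E1 word_value_cons word_value_nil mulg1.
rewrite [in letter_value z](_ : z = inv_letter l) ?letter_valueV ?invgM ?mulgA//.
by rewrite lz inv_letterK.
Qed.

Lemma cyclic_power c m : c <> [::] -> path.cycle nocancel c ->
  reduced_word (flatten (nseq m c)).
Proof.
case: c => // l c _ /=; rewrite rcons_path => /andP[pc lc].
rewrite reduced_wordE; elim: m => //= m IH.
rewrite cat_path pc /=; case: m IH => //= m; rewrite cat_path pc /= => ->.
by rewrite lc.
Qed.

Lemma word_value_power (c : seq (gT * bool)) m : word_value (flatten (nseq m c)) = word_value c ^+ m.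
Proof.
elim: m => [|m IH]; first by rewrite word_value_nil.
by rewrite /= word_value_cat IH expgS.
Qed.

Lemma word_over_power c m : word_over B c -> word_over B (flatten (nseq m c)).
Proof. by move=> Bc; elim: m => //= m IH; apply/word_over_cat. Qed.

(** For a cyclically reduced word the reduced words of the powers are its
    repetitions: the positive powers start with its first letter, and the negative
    ones with the inverse of its last letter, which differs from the first. *)
Lemma axis_cylinder k : F k -> k <> 1 -> exists u z l, [/\ B l.1, k = u * z * u^-1, F z
  & forall m, starts_with l (z ^+ m.+1) /\ ~~ starts_with l (z^-1 ^+ m.+1)].
Proof.
move=> /(free_basisP FB)[w [Bw rw <-]] k1.
have wN : w <> [::] by move=> w0; apply: k1; rewrite w0 word_value_nil.
have [u [c [Bc cN cc E1]]] := cyclic_reduction Bw rw wN.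
case: c cN Bc cc E1 => // l c cN Bc cc E1.
have Bl : B l.1 by have [] := (word_over_cons _ _ _).1 Bc.
exists u, (word_value (l :: c)), l; split=> // [|m].
  by rewrite FB.1; apply/generated_wordP; exists (l :: c).
have Bp := @word_over_power _ m.+1 Bc; have rp := cyclic_power m.+1 cN cc.
split; first by rewrite -word_value_power starts_withE//= eqxx.
rewrite expVgn -word_value_power -word_valueV starts_withE; last 2 first.
- exact: word_over_inv.
- exact: reduced_inv_word.
have -> : flatten (nseq m.+1 (l :: c)) = rcons (belast l (c ++ flatten (nseq m (l :: c))))
    (last l (c ++ flatten (nseq m (l :: c)))) by rewrite -lastI.
rewrite /inv_word map_rcons rev_rcons /=.
apply/eqP => -[E2]; move: cc; rewrite /= rcons_path => /andP[_].
rewrite (_ : last l c = last l (c ++ flatten (nseq m (l :: c)))) ?E2 ?eqxx//.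
by rewrite last_cat; elim: (m) => //= j IH; rewrite last_cat -IH.
Qed.

Lemma free_torsion_free k : F k -> k <> 1 -> forall m, (0 < m)%N -> k ^+ m <> 1.
Proof.
move=> Fk k1 [//|m] _ km; have [u [z [l [Bl kE _ H]]]] := axis_cylinder Fk k1.
have z1 : z ^+ m.+1 = 1.
  have : z = k ^ u by rewrite kE /conjg !mulgA mulVg mul1g mulgVK.
  by move=> ->; rewrite -conjXg km conj1g.
have [] := H m; rewrite expVgn z1 invg1; by case: starts_with.
Qed.

(** A line is a left translate of the axis of a nontrivial element of [F]; its
    two ends are the limits of [x k^n] and of [x k^(-n)]. *)
Definition line := {xk : gT * gT | F xk.2 /\ xk.2 <> 1}.
Definition front (L : line) C : bool := eventually_in (sval L).1 (sval L).2 C.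
Definition back (L : line) C : bool := eventually_in (sval L).1 (sval L).2^-1 C.

Lemma line_order (L : line) m : (0 < m)%N -> (sval L).2 ^+ m <> 1.
Proof. by case: L => -[x k] [/= Fk k1]; exact: free_torsion_free. Qed.

Lemma line_orderV (L : line) m : (0 < m)%N -> (sval L).2^-1 ^+ m <> 1.
Proof. by move=> m0; rewrite expVgn => /eqP; rewrite invg_eq1 => /eqP; exact: line_order. Qed.

(** Translate the cylinder that separates the ends of the axis of a cyclically
    reduced conjugate. *)
Lemma separating_cut : exists K, forall L,
  exists C, sep E front back L C /\ (ncard (bd C) <= K)%N.
Proof.
have [K HK] := cylinder_bound; exists K => L.
case: (L) => -[x k] Lk; have /= [Fk k1] := Lk.
have [u [z [l [Bl kE Fz H]]]] := axis_cylinder Fk k1.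
have [fl lK] := HK l Bl.
have [i Fi] := coset1.
exists (ltr (x * u) (cylinder l)); split; last by rewrite ncard_ltr.
have fC : fin_bd E (ltr (x * u) (cylinder l)) by exact: fin_bd_ltr.
(* The points [x k'^m] and their right translates by [u (t i)^-1], where the
   cylinder can be evaluated, are eventually on the same side. *)
have endE y k' b : F y -> F k' -> k' <> 1 -> k' = u * y * u^-1 ->
    (forall m, starts_with l (y ^+ m.+1) = b) ->
    eventually_in x k' (ltr (x * u) (cylinder l)) = b.
  move=> Fy Fk' k'1 k'E Hb.
  have [N HN] := eventually_shift genS x (free_torsion_free Fk' k'1) (u * (t i)^-1) fC.
  rewrite (@eventually_eq _ x k' _ 1 1 (fun=> b) N.+1).
    by case: b {Hb}; apply/asboolP; [exists 0%N|case=> M /(_ M (leqnn _))].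
  case=> // m Nm; rewrite HN ?(ltnW Nm)//.
  have -> : ltr (x * u) (cylinder l) (x * k' ^+ m.+1 * (u * (t i)^-1)) =
      cylinder l (y ^+ m.+1 * (t i)^-1).
    have -> : k' = y ^ u^-1 by rewrite k'E /conjg invgK mulgA.
    by rewrite -conjXg /conjg invgK /ltr invgM; congr cylinder; rewrite !mulgA !mulgVK mulVg mul1g.
  have Fm j : F (y ^+ j).
    by elim: j => [|j IH]; [exact: free_subgroup.1|rewrite expgS; exact: freeM].
  by rewrite (@cylinderE _ _ i) mulgVK.
split=> //; rewrite /front /back /=.
have kV : k^-1 = u * z^-1 * u^-1 by rewrite [in LHS]kE !invgM invgK mulgA.
rewrite (endE z k true)// => [|m]; last by have [] := H m.
rewrite (endE z^-1 k^-1 false)// => [|||m].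
- exact: freeV.
- exact: freeV.
- by move=> /eqP; rewrite invg_eq1 => /eqP.
- by have [_ /negbTE] := H m.
Qed.

End VirtuallyFree.

(** * The tree of optimal cuts *)

Section CutTree.
Local Open Scope group_scope.
Variable gT : groupType.

(** The edges, with both orientations, of a tree on which the group acts: an
    oriented edge is recorded as the set of elements of the group that it points
    to.  The last condition says that elements of [F] act as translations. *)
Record cut_tree (F : set gT) (T : set (gT -> bool)) : Prop := CutTree {
  cut_ltr : forall g C, T C -> T (ltr g C);
  cut_compl : forall C, T C -> T (compl C);
  cut_nonempty : forall C, T C -> exists x, C x;
  cut_nested : forall C D, T C -> T D -> ~ crossing C D;
  cut_finite : forall x y, finite_set [set C | T C /\ C x != C y];
  cut_orbits : exists A, [/\ finite_set A, A `<=` T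
    & forall C, T C -> exists g, exists2 D, A D & C = ltr g D];
  cut_translation : forall k, F k -> k <> 1 -> exists C N b, T C /\
    forall n, (N <= n)%N -> C (k ^+ n) = b /\ C (k^-1 ^+ n) = ~~ b }.

(** The edges are the cuts that are optimal for some line. *)
Theorem virtually_free_cut_tree (F : set gT) : finitely_generated [set: gT] ->
  free_group F -> (exists n, has_index [set: gT] F n) -> exists T, cut_tree F T.
Proof.
move=> [S genS] [B FB] [n [t [_ tP']]].
have tP g : exists! i, F ((t i)^-1 * g) by exact: tP'.
have Es := @cayley_sym _ S; have Ec := cayley_conn genS.
have [K HK] := separating_cut genS FB tP.
pose L := line F; pose p := @front _ F; pose q := @back _ F.
have pC (l : L) C : fin_bd (cayley S) C -> p l (compl C) = ~~ p l C.
  by apply: (eventually_compl genS) => m; exact: line_order FB _ _.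
have qC (l : L) C : fin_bd (cayley S) C -> q l (compl C) = ~~ q l C.
  by apply: (eventually_compl genS) => m; exact: line_orderV FB _ _.
have pI (l : L) C D : fin_bd (cayley S) C -> fin_bd (cayley S) D ->
    p l (meet C D) = p l C && p l D by move=> _ _; exact: eventually_meet.
have qI (l : L) C D : fin_bd (cayley S) C -> fin_bd (cayley S) D ->
    q l (meet C D) = q l C && q l D by move=> _ _; exact: eventually_meet.
pose T := [set C | exists l, opt (cayley S) K p q l C].
have TB C : T C -> bond (cayley S) K C.
  by move=> [l]; exact: (opt_bond Es Ec pC qC pI qI HK).
have Tne C : T C -> exists x, C x.
  move=> [l [[fC +] _]]; have [//|nC] := pselect (exists x, C x).
  have C0 x : C x = false by apply/negbTE/negP => Cx; apply: nC; exists x.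
  have e0 x k : eventually_in x k C = false.
    by apply/asboolP => -[N /(_ N (leqnn _))]; rewrite C0.
  by rewrite /p /q /front /back !e0.
have Tc C : T C -> T (compl C).
  by move=> [l oC]; exists l; exact: (optC pC qC oC).
have Tl g C : T C -> T (ltr g C).
  move=> [[[x k] Lk] [[fC sC] oC]].
  have ev h y D : eventually_in (h * y) k D = eventually_in y k (ltr h^-1 D).
    by rewrite -(eventually_ltr h y k (ltr h^-1 D)) ltrKV.
  have ev' h y D : eventually_in (h * y) k^-1 D = eventually_in y k^-1 (ltr h^-1 D).
    by rewrite -(eventually_ltr h y k^-1 (ltr h^-1 D)) ltrKV.
  exists (exist _ (g * x, k) Lk); split.
    split; first exact: fin_bd_ltr.
    by rewrite /p /q /front /back /= !eventually_ltr.
  move=> D [fD sD]; rewrite ncard_ltr// (ncross_ltr genS)//.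
  rewrite -(ncard_ltr g^-1 fD) -(ncross_ltr genS K g^-1 fD); apply: oC.
  split; first exact: fin_bd_ltr.
  by move: sD; rewrite /p /q /front /back /= ev ev'.
have Tfin x y : finite_set [set C | T C /\ C x != C y].
  have f := finite_bond K Es Ec.
  apply: (@sub_finite_set _ _ ([set D | [/\ bond (cayley S) K D, D x & ~~ D y]] `|`
                               [set D | [/\ bond (cayley S) K D, D y & ~~ D x]])).
    move=> C [/TB BC]; case Cx: (C x); case Cy: (C y) => // _; [left|right];
      by split=> //; rewrite ?Cx ?Cy.
  by rewrite finite_setU.
exists T; split=> //.
- by move=> C D [l oC] [l' oD]; exact: (opt_nested Es Ec pC qC pI qI HK oC oD).
(* A translate of an edge separates 1 from a neighbour of 1. *)
- pose S' := S ++ [seq s^-1 | s <- S].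
  exists (\bigcup_(y in [set` S']) [set C | T C /\ C 1 != C y]); split.
  + by apply: bigcup_finite => [|y _]; [exact: finite_seq|exact: Tfin].
  + by move=> C [y _ []].
  + move=> C TC; have [||u [v [Euv Cu Cv]]] := conn_boundary (C := C) Es Ec.
    * exact: Tne.
    * by have [x] := Tne _ (Tc _ TC); exists x.
    exists u, (ltr u^-1 C); last by rewrite ltrKV.
    exists (u^-1 * v).
      rewrite /= mem_cat; have [s Ss [->|->]] := Euv; first by rewrite mulKg Ss.
      by rewrite invgM mulgVK map_f ?orbT.
    by split; [exact: Tl|rewrite /ltr !invgK mulg1 mulVKg Cu (negbTE Cv)].
- move=> k Fk k1; pose l : L := exist _ (1, k) (conj Fk k1).
  have [C oC] := opt_exists HK l; have [[fC sC] _] := oC.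
  have [N HN] := eventually_const genS 1 (@line_order _ _ _ FB l) fC.
  have [M HM] := eventually_const genS 1 (@line_orderV _ _ _ FB l) fC.
  have evE y b R : (forall m, (R <= m)%N -> C (1 * y ^+ m) = b) -> eventually_in 1 y C = b.
    move=> H; rewrite (@eventually_eq _ _ _ _ 1 1 (fun=> b) R)//.
    by case: b {H}; apply/asboolP; [exists 0%N|case=> M' /(_ M' (leqnn _))].
  exists C, (maxn N M), (C (1 * k ^+ N)); split; first by exists l.
  move=> m; rewrite geq_max => /andP[/HN Hm /HM Hm'].
  move: Hm Hm'; rewrite /= !mul1g => -> ->; split=> //.
  move: sC; rewrite /p /q /front /back (evE _ _ _ HN) (evE _ _ _ HM) /= !mul1g.
  by case: (C (k ^+ N)) (C (k^-1 ^+ M)) => [] [].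
Qed.

End CutTree.

(** * Vertices of the tree *)

Section Vertices.
Local Open Scope group_scope.
Variables (gT : groupType) (F : set gT) (T : set (gT -> bool)).
Hypothesis HT : cut_tree F T.
Implicit Types (C D : gT -> bool) (v w : (gT -> bool) -> bool) (g h k : gT).

(** A vertex of the tree is recorded as the set of oriented edges that point
    to it.  These are the ultrafilters of edges that differ from the one of the
    identity element at finitely many edges. *)
Definition vertex v : Prop := [/\ (forall C, v C -> T C),
  (forall C, T C -> v (compl C) = ~~ v C),
  (forall C D, T D -> (forall x, C x -> D x) -> v C -> v D)
  & finite_set [set C | T C /\ v C != C 1]].

Lemma vertex_ext v w : vertex v -> vertex w ->
  (forall C, T C -> v C = w C) -> v = w.
Proof.
move=> [vT _ _ _] [wT _ _ _] H; apply/funext => C.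
have [TC|nTC] := pselect (T C); first exact: H.
by apply/idP/idP => [/vT|/wT] /nTC.
Qed.

Lemma T_ltr g C : T (ltr g C) <-> T C.
Proof. by split=> [/(cut_ltr HT g^-1)|]; [rewrite ltrK|exact: (cut_ltr HT)]. Qed.

Definition vact g v : (gT -> bool) -> bool := fun C => v (ltr g^-1 C).

Lemma vact1 v : vact 1 v = v.
Proof. by apply/funext => C; rewrite /vact invg1 ltr1. Qed.

Lemma vactM g h v : vact (g * h) v = vact g (vact h v).
Proof. by apply/funext => C; rewrite /vact invgM ltrM. Qed.

Lemma vactK g : cancel (vact g) (vact g^-1).
Proof. by move=> v; rewrite -vactM mulVg vact1. Qed.

Lemma vact_ltr g v C : vact g v (ltr g C) = v C.
Proof. by rewrite /vact ltrK. Qed.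

Lemma vertex_vact g v : vertex v -> vertex (vact g v).
Proof.
move=> [vT vC vU vF]; split.
- by move=> C /vT/T_ltr.
- by move=> C TC; rewrite /vact ltr_compl vC//; apply/T_ltr.
- by move=> C D TD CD; apply: vU; [apply/T_ltr|move=> x; exact: CD].
- apply: (@sub_finite_set _ _ (ltr g @` [set C | T C /\ v C != C 1] `|`
      [set C | T C /\ C 1 != C g])).
    move=> C [TC vC1]; have [Cg|] := eqVneq (C 1) (C g); last by right.
    left; exists (ltr g^-1 C); last by rewrite ltrKV.
    split; first exact/T_ltr.
    by rewrite (_ : ltr g^-1 C 1 = C 1)// Cg /ltr invgK mulg1.
  by rewrite finite_setU; split; [exact: finite_image|exact: cut_finite HT _ _].
Qed.

Definition principal g : (gT -> bool) -> bool := fun C => `[< T C >] && C g.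

Lemma principalE g C : T C -> principal g C = C g.
Proof. by rewrite /principal => /asboolT->. Qed.

Lemma vertex_principal g : vertex (principal g).
Proof.
split.
- by move=> C /andP[/asboolP].
- by move=> C TC; rewrite !principalE//; exact: cut_compl HT _ TC.
- by move=> C D TD CD /andP[_ Cg]; rewrite principalE//; exact: CD.
- apply: sub_finite_set (cut_finite HT g 1) => C [TC].
  by rewrite principalE.
Qed.

Lemma vact_principal g h : vact g (principal h) = principal (g * h).
Proof.
apply/funext => C; rewrite /vact /principal; congr andb; last by rewrite /ltr invgK.
by congr asbool; apply/propext/T_ltr.
Qed.

Lemma T_nonfull C : T C -> exists x, ~~ C x.
Proof. by move=> /(cut_compl HT)/(cut_nonempty HT)[x]; exists x. Qed.

Lemma nested_cases C D : T C -> T D ->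
  [\/ forall x, C x -> D x, forall x, D x -> C x,
      forall x, ~~ (C x && D x) | forall x, C x || D x].
Proof.
move=> TC TD; have := cut_nested HT TC TD.
move=> /existsNP[b /existsNP[b' /forallNP H]].
case: b b' H => [] [] H; [apply: Or43|apply: Or41|apply: Or42|apply: Or44] => x;
  by have := H x; case: (C x); case: (D x) => // /(_ (conj erefl erefl)).
Qed.

(** The vertex from which the oriented edge [C] leaves. *)
Definition origin C : (gT -> bool) -> bool := fun D =>
  `[< T D /\ ((forall x, C x -> D x) /\ D <> C \/ (forall x, C x || D x)) >].

Lemma originN C : T C -> origin C C = false.
Proof.
move=> TC; apply/asboolP => -[_ [[_]//|H]].
by have [x Cx] := T_nonfull TC; have := H x; rewrite orbb (negbTE Cx).
Qed.

Lemma originC C D : T C -> T D -> origin C (compl D) = ~~ origin C D.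
Proof.
move=> TC TD; have TD' := cut_compl HT TD.
have [y Cy] := T_nonfull TC; have [x Cx] := cut_nonempty HT TC.
have sup E : T E -> (forall x, C x -> E x) -> E <> C ->
    origin C E /\ ~~ origin C (compl E).
  move=> TE CE nE; split; first by apply/asboolP; split=> //; left.
  apply/asboolP => -[_ [[H _]|H]].
    by have := H x Cx; rewrite /compl CE.
  by apply: nE; apply/funext => z; have := H z; rewrite /compl; have := CE z;
    case: (C z) (E z) => [] [] //= ->.
have [[CD|DC]|[CD|DC]] : ((forall x, C x -> D x) \/ (forall x, D x -> C x)) \/
   ((forall x, C x -> compl D x) \/ (forall x, compl D x -> C x)).
- case: (nested_cases TC TD) => H; [by left; left|by left; right|right; left|right; right].
    by move=> z Cz; have := H z; rewrite Cz /compl.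
  by move=> z Dz; have := H z; rewrite (negbTE Dz) orbF.
- have [->|/eqP nD] := eqVneq D C; last by have [-> /negbTE->] := sup D TD CD nD.
  by rewrite originN//; apply/asboolP; split; [exact: (cut_compl HT)|right => z; rewrite orbN].
- have [->|/eqP nD] := eqVneq D C.
    by rewrite originN//; apply/asboolP; split; [exact: (cut_compl HT)|right => z; rewrite orbN].
  have -> : origin C (compl D).
    apply/asboolP; split=> //; right => z; rewrite /compl.
    by have := DC z; case: (D z) => [->|_]; rewrite ?orbT.
  apply/esym; apply/asboolP => -[_ [[H nE]|H]].
    by apply: nD; apply/funext => z; apply/idP/idP => [/DC|/H].
  by have := H y; rewrite (negbTE Cy) /= => /DC; rewrite (negbTE Cy).
- have [E|/eqP nD] := eqVneq (compl D) C.
    rewrite E originN//; apply/esym/negbTE; rewrite negbK; apply/asboolP; split=> //; right => z.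
    by rewrite -E /compl; case: (D z).
  by have [-> ] := sup _ TD' CD nD; rewrite complK => ->.
- have [E|/eqP nD] := eqVneq (compl D) C.
    rewrite E originN//; apply/esym/negbTE; rewrite negbK; apply/asboolP; split=> //; right => z.
    by rewrite -E /compl; case: (D z).
  have -> : origin C D.
    by apply/asboolP; split=> //; right => z; have := DC z; rewrite /compl;
      case: (D z); rewrite ?orbT//= => ->.
  apply/asboolP => -[_ [[H nE]|H]].
    by apply: nE; apply/funext => z; apply/idP/idP => [/DC|/H].
  by have := H y; rewrite (negbTE Cy) /= => /DC; rewrite (negbTE Cy).
Qed.

Lemma vertex_origin C : T C -> vertex (origin C).
Proof.
move=> TC; split.
- by move=> D /asboolP[].
- by move=> D; exact: originC.
- move=> D E TE DE /asboolP[TD [[CD nD]|H]]; apply/asboolP; split=> //.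
    left; split=> [x /CD/DE//|EC]; apply: nD; apply/funext => x.
    by apply/idP/idP => [/DE|/CD//]; rewrite EC.
  by right=> x; case/orP: (H x) => [->|/DE ->]; rewrite ?orbT.
- have [y Cy] := T_nonfull TC; have [x Cx] := cut_nonempty HT TC.
  apply: (@sub_finite_set _ _ ([set D | T D /\ D 1 != D x] `|` [set D | T D /\ D 1 != D y])).
    move=> D [TD oD]; have [Dx|] := eqVneq (D 1) (D x); last by left.
    have [Dy|] := eqVneq (D 1) (D y); last by right.
    exfalso; move/negP: oD; apply; apply/eqP.
    have key E : T E -> E x -> E y -> origin C E.
      move=> TE Ex Ey; apply/asboolP; split=> //.
      case: (nested_cases TC TE) => H.
      + by left; split=> // EC; move: Ey; rewrite EC (negbTE Cy).
      + by have := H y Ey; rewrite (negbTE Cy).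
      + by have := H x; rewrite Cx Ex.
      + by right.
    case D1: (D 1); first by apply: key => //; rewrite -?Dx -?Dy.
    have := key _ (cut_compl HT TD); rewrite /compl -/(compl D) -Dx -Dy D1 => /(_ isT isT).
    by rewrite originC// => /negbTE.
  by rewrite finite_setU; split; exact: cut_finite HT _ _.
Qed.

Lemma origin_ltr g C : origin (ltr g C) = vact g (origin C).
Proof.
apply/funext => D; rewrite /vact /origin; congr asbool; apply/propeqP.
split=> -[TD H]; (split; first by [exact/T_ltr|move/T_ltr: TD]).
- case: H => [[CD nD]|CD]; [left|right].
    split=> [x Cx|E]; first by rewrite /ltr invgK; apply: CD; rewrite /ltr mulKg.
    by apply: nD; rewrite -E ltrKV.
  by move=> x; have := CD (g * x); rewrite /ltr invgK mulKg.
- case: H => [[CD nD]|CD]; [left|right].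
    split=> [x /CD|E]; first by rewrite /ltr invgK mulVKg.
    by apply: nD; rewrite E ltrK.
  by move=> x; have := CD (g^-1 * x); rewrite /ltr invgK mulVKg.
Qed.

(** The two ends of an edge are separated by this edge only. *)
Lemma origin_other C D : T C -> T D -> D <> C -> D <> compl C ->
  origin (compl C) D = origin C D.
Proof.
move=> TC TD nC nC'; congr asbool; apply/propeqP; split=> -[_ H]; split=> //.
- case: H => [[CD _]|CD]; [right|left; split=> //] => x.
    by case Cx: (C x) => //=; apply: CD; rewrite /compl Cx.
  by move=> Cx; have := CD x; rewrite /compl Cx.
- case: H => [[CD _]|CD]; [right|left; split=> //] => x; rewrite /compl.
    by case Cx: (C x) => //=; apply: CD.
  by move=> Cx; have := CD x; rewrite (negbTE Cx).
Qed.

(** Edges that leave the same vertex point to different parts of the tree. *)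
Lemma origin_disjoint C D : T C -> T D -> origin C = origin D -> C <> D ->
  forall x, ~~ (C x && D x).
Proof.
move=> TC TD E nCD; case: (nested_cases TC TD) => H //; exfalso.
- have : origin C D by apply/asboolP; split=> //; left; split=> // DC; exact: nCD.
  by rewrite E originN.
- have : origin D C by apply/asboolP; split=> //; left.
  by rewrite -E originN.
- have : origin C D by apply/asboolP; split=> //; right.
  by rewrite E originN.
Qed.

(** Twice the distance in the tree, as each edge counts with both orientations. *)
Definition vdist v w : nat := ncard [set C | T C /\ v C != w C].

Lemma vdist_finite v w : vertex v -> vertex w -> finite_set [set C | T C /\ v C != w C].
Proof.
move=> [_ _ _ vF] [_ _ _ wF].
apply: (@sub_finite_set _ _ ([set C | T C /\ v C != C 1] `|` [set C | T C /\ w C != C 1])).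
  move=> C [TC vw]; have [vC|] := eqVneq (v C) (C 1); last by left.
  by right; split=> //; rewrite -vC eq_sym.
by rewrite finite_setU.
Qed.

(** The first edge on the way from [v] to [w]: a maximal one among the finitely
    many half trees that contain [w] and not [v]. *)
Lemma vertex_step v w : vertex v -> vertex w -> v <> w ->
  exists C, [/\ T C, origin C = v, w C & (vdist (origin (compl C)) w < vdist v w)%N].
Proof.
move=> Hv Hw vw; have [vT vC vU _] := Hv; have [wT wC wU _] := Hw.
pose A := [set C | [/\ T C, ~~ v C & w C]].
have fA : finite_set A.
  by apply: sub_finite_set (vdist_finite Hv Hw) => C [TC vC0 wC1]; split=> //; rewrite wC1; move: vC0; case: (v C).
pose N C := ncard (A `&` [set D : gT -> bool | (forall x, C x -> D x) /\ D <> C]).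
have exA : exists n, `[< exists2 C, A C & N C = n >].
  apply: contrapT => H; apply: vw; apply: vertex_ext => // C TC.
  have {}H C' : A C' -> False by move=> AC; apply: H; exists (N C'); apply/asboolP; exists C'.
  have := H C; have := H (compl C); rewrite /A /= vC// wC//.
  case: (v C) (w C) => [] [] // h1 h2; exfalso.
    by apply: h1; split=> //; exact: cut_compl HT _ TC.
  by apply: h2.
case: (ex_minnP exA) => n /asboolP[C [TC vCN wCC] NC] nmin.
(* [C] is contained in the fewest sets of this kind, hence in no other one. *)
have maxC D : T D -> ~~ v D -> w D -> (forall x, C x -> D x) -> D = C.
  move=> TD vD wD CD; apply: contrapT => nD.
  have : (n <= N D)%N by apply: nmin; apply/asboolP; exists D.
  rewrite leqNgt -NC => /negP; apply; apply: (@ncard_lt _ _ _ D).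
  - exact: finite_setIl.
  - move=> D' [AD' [DD' nD']]; split=> //; split=> [x /CD/DD'//|E].
    by apply: nD; apply/funext => x; apply/idP/idP => [|/CD//]; rewrite -E; exact: DD'.
  - by [].
  - by case=> _ [_].
have oC : origin C = v.
  apply: vertex_ext => // [|D TD]; first exact: vertex_origin.
  have sup E : T E -> (forall x, C x -> E x) -> E <> C -> v E.
    move=> TE CE nE; apply: contrapT => /negP vE; apply: nE; apply: maxC => //.
    exact: wU CE wCC.
  have TC' := cut_compl HT TC.
  apply/idP/idP => [/asboolP[_ [[CD nD]|CD]]|vD].
  - exact: sup.
  - apply: (vU (compl C)) => //; last by rewrite vC// vCN.
    by move=> x Cx; have := CD x; rewrite (negbTE Cx).
  - apply: contrapT => /negP; rewrite -originC// => /asboolP[TD' H].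
    have vD' : ~~ v (compl D) by rewrite vC// negbK.
    case: H => [[CD nD]|CD]; first by move/negP: vD'; apply; exact: sup.
    have : v C by apply: vU vD => // x Dx; have := CD x; rewrite /compl Dx orbF.
    by rewrite (negbTE vCN).
exists C; split=> //; apply: (@ncard_lt _ _ _ C).
- exact: vdist_finite.
- move=> D [TD H]; split=> //.
  have [E|/eqP nC] := eqVneq D C; first by rewrite E (negbTE vCN) wCC.
  have [E|/eqP nC'] := eqVneq D (compl C); first by rewrite E vC// wC// wCC vCN.
  by rewrite -oC -origin_other.
- by split=> //; rewrite (negbTE vCN) wCC.
- have TC' := cut_compl HT TC.
  have := originC TC' TC'; rewrite complK originN//= => ->.
  by rewrite wCC => -[_].
Qed.

(** If two translates of [C] by powers of [k] coincided, [C] would be invariant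
    under a power of [k] although it separates the two ends of the axis. *)
Lemma expg_ltr_neq k C N b : (forall n, (N <= n)%N -> C (k ^+ n) = b /\ C (k^-1 ^+ n) = ~~ b) ->
  forall i j, (i < j)%N -> ltr (k ^+ i) C <> ltr (k ^+ j) C.
Proof.
move=> H i j ij E; pose d := (j - i)%N.
have Ed : ltr (k ^+ d) C = C.
  have -> : k ^+ d = (k ^+ i)^-1 * k ^+ j by rewrite -(subnKC (ltnW ij)) expgnDr mulKg.
  by rewrite ltrM -E ltrK.
have Edm m : ltr (k ^+ (d * m)) C = C.
  elim: m => [|m IH]; first by rewrite muln0 expg0 ltr1.
  by rewrite mulnS expgnDr ltrM IH.
have d0 : (0 < d)%N by rewrite subn_gt0.
have [H1 _] := H N (leqnn _).
have [M [NM dE]] : exists M, (N <= M)%N /\ (d * (N + N) = N + M)%N.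
  by exists (d * (N + N) - N)%N; nia.
have := congr1 (fun f => f (k ^+ N)) (Edm (N + N)%N); rewrite /ltr H1 dE expgnDr invgM mulgVK.
by have [_] := H M NM; rewrite expVgn => ->; case: (b).
Qed.

(** An element translating along an axis fixes no vertex: a fixed vertex would
    lie on the same side of all translates of a cut across the axis. *)
Lemma vertex_free k v : F k -> k <> 1 -> vertex v -> vact k v <> v.
Proof.
move=> Fk k1 [_ _ _ vF] kv.
have [C [N [b [TC H]]]] := cut_translation HT Fk k1.
have H' n : (N <= n)%N -> C (k^-1 ^+ n) = ~~ b /\ C (k^-1^-1 ^+ n) = ~~ ~~ b.
  by move=> /H[? ?]; rewrite invgK negbK.
have kn n : vact (k ^+ n) v = v.
  by elim: n => [|n IH]; [exact: vact1|rewrite expgS vactM IH].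
have knV n : vact (k^-1 ^+ n) v = v.
  by elim: n => [|n IH]; [exact: vact1|rewrite expgS vactM IH -{1}kv vactK].
have inf y c : (forall n, (N <= n)%N -> C (y ^+ n) = c /\ C (y^-1 ^+ n) = ~~ c) ->
    (forall n, vact (y ^+ n) v = v) -> v C = ~~ c -> False.
  move=> Hy yv vCc.
  have inj : injective (fun n => ltr (y^-1 ^+ (N + n)) C).
    have Hy' n : (N <= n)%N -> C (y^-1 ^+ n) = ~~ c /\ C (y^-1^-1 ^+ n) = ~~ ~~ c.
      by move=> /Hy[? ?]; rewrite invgK negbK.
    move=> i j E; case: (ltngtP i j) => // ij; exfalso.
      by apply: (expg_ltr_neq Hy' (_ : N + i < N + j)%N); rewrite ?ltn_add2l.
    by apply: (expg_ltr_neq Hy' (_ : N + j < N + i)%N); rewrite ?ltn_add2l.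
  have [M HM] := finite_nat_bound (finite_preimage_inj inj vF).
  suff : (M < M)%N by rewrite ltnn.
  apply: HM; split; first exact/T_ltr.
  have -> : v (ltr (y^-1 ^+ (N + M)) C) = v C.
    by rewrite -(vact_ltr (y ^+ (N + M))) -ltrM expVgn mulgV ltr1 yv.
  rewrite /ltr mulg1 expVgn invgK vCc.
  by have [->] := Hy _ (leq_addr M N); case: (c).
case vCb: (v C) (inf k b H kn) (inf k^-1 (~~ b) H' knV) => h1 h2.
  by case: (b) h1 h2 => h1 h2; [exact: h2|exact: h1].
by case: (b) h1 h2 => h1 h2; [exact: h1|exact: h2].
Qed.

End Vertices.

(** * Groups acting freely on the tree *)

Section Subgroups.
Local Open Scope group_scope.
Variables (gT : groupType) (K : set gT).
Hypothesis sK : subgroup K.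

Lemma subgroup1 : K 1. Proof. by case: sK. Qed.

Lemma subgroupV x : K x -> K x^-1.
Proof. by move=> Kx; rewrite -[x^-1]mul1g; apply: sK.2 => //; exact: subgroup1. Qed.

Lemma subgroupM x y : K x -> K y -> K (x * y).
Proof. by move=> Kx Ky; rewrite -[y]invgK; apply: sK.2 => //; exact: subgroupV. Qed.

End Subgroups.

Lemma generated_subgroup (gT : groupType) (B : set gT) : subgroup (Defs.generated B).
Proof.
split; first by apply/generated_wordP; exists [::]; rewrite ?word_value_nil.
move=> x y /generated_wordP[w Bw <-] /generated_wordP[v Bv <-].
apply/generated_wordP; exists (w ++ inv_word v).
  by apply/word_over_cat; split=> //; exact: word_over_inv.
by rewrite word_value_cat word_valueV.
Qed.

Section FreeAction.
Local Open Scope group_scope.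
Variables (gT : groupType) (F : set gT) (T : set (gT -> bool)) (K : set gT).
Hypothesis HT : cut_tree F T.
Hypothesis sK : subgroup K.
Hypothesis K_free : forall k v, K k -> k <> 1 -> vertex T v -> vact k v <> v.
Hypothesis K_inv : forall k, K k -> k * k = 1 -> k = 1.
Implicit Types (C D : gT -> bool) (v w : (gT -> bool) -> bool) (g h k : gT).

Let K1 := subgroup1 sK.
Let KV := subgroupV sK.
Let KM := subgroupM sK.
Let vtx := vertex T.

Lemma vact_inj k h v : K k -> K h -> vtx v -> vact k v = vact h v -> k = h.
Proof.
move=> Kk Kh Hv E; apply: contrapT => kh; apply: (@K_free (h^-1 * k) v) => //.
- by apply: KM => //; exact: KV.
- by move=> /mulg1_eq; rewrite invgK => /esym.
- by rewrite vactM E vactK.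
Qed.

Lemma principal_inj k h : K k -> K h -> principal T k = principal T h -> k = h.
Proof.
move=> Kk Kh E; apply: (vact_inj Kk Kh (vertex_principal HT 1)).
by rewrite !(vact_principal HT) !mulg1.
Qed.

Lemma vdist_vact k v w : vtx v -> vtx w -> vdist T (vact k v) (vact k w) = vdist T v w.
Proof.
have le h v' w' : vtx v' -> vtx w' -> (vdist T (vact h v') (vact h w') <= vdist T v' w')%N.
  move=> Hv' Hw'; have fA := vdist_finite Hv' Hw'.
  apply: leq_trans (ncard_image (ltr h) fA); apply: ncard_sub; first exact: finite_image.
  move=> C [TC H]; exists (ltr h^-1 C); last by rewrite ltrKV.
  by split=> //; exact/(T_ltr HT).
move=> Hv Hw; apply/eqP; rewrite eqn_leq le//=.
by rewrite -{1}(vactK k v) -{1}(vactK k w) le//; exact: (vertex_vact HT _ _).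
Qed.

Lemma vdist_eq0 v w : vtx v -> vtx w -> vdist T v w = 0%N -> v = w.
Proof.
move=> Hv Hw d0; apply: (vertex_ext Hv Hw) => C TC; apply/eqP; apply: contrapT => /negP H.
by have := @ncard_gt0 _ _ C (vdist_finite Hv Hw) (conj TC H); rewrite -/(vdist T v w) d0.
Qed.

Let exK v : exists n, `[< exists2 g, K g & vdist T v (principal T g) = n >].
Proof. by exists (vdist T v (principal T 1)); apply/asboolP; exists 1. Qed.

(** Distance to the orbit of the base vertex. *)
Definition kdist v : nat := ex_minn (exK v).

Lemma kdistP v : exists2 g, K g & vdist T v (principal T g) = kdist v.
Proof. by rewrite /kdist; case: ex_minnP => n /asboolP. Qed.

Lemma kdist_le v g : K g -> (kdist v <= vdist T v (principal T g))%N.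
Proof.
move=> Kg; rewrite /kdist; case: ex_minnP => n _; apply.
by apply/asboolP; exists g.
Qed.

Lemma kdist_vact k v : K k -> vtx v -> kdist (vact k v) = kdist v.
Proof.
have le h w : K h -> vtx w -> (kdist (vact h w) <= kdist w)%N.
  move=> Kh Hw; have [g Kg <-] := kdistP w.
  rewrite -(vdist_vact h Hw (vertex_principal HT g)) (vact_principal HT).
  by apply: kdist_le; exact: KM.
move=> Kk Hv; apply/eqP; rewrite eqn_leq le//=.
by rewrite -{1}(vactK k v) le//; [exact: KV|exact: (vertex_vact HT)].
Qed.

Lemma kdist0 v : vtx v -> kdist v = 0%N -> exists2 g, K g & v = principal T g.
Proof.
move=> Hv v0; have [g Kg] := kdistP v; rewrite v0 => /vdist_eq0-> //.
  by exists g.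
exact: (vertex_principal HT).
Qed.

(** The first edge on the way to a nearest vertex of the orbit. *)
Lemma kdist_step v : exists C, vtx v -> (0 < kdist v)%N ->
  [/\ T C, origin T C = v & (kdist (origin T (compl C)) < kdist v)%N].
Proof.
have [Hv|] := pselect (vtx v); last by exists xpredT.
have [v0|] := posnP (kdist v); first by exists xpredT.
move=> vp; have [g Kg gE] := kdistP v.
have Hg := vertex_principal HT g.
have [|C [TC oC _ lt]] := vertex_step HT Hv Hg.
  move=> E; move: vp; rewrite -gE E /vdist (_ : [set _ | _] = set0).
    by rewrite /ncard fset_set0.
  by rewrite -subset0 => D [_]; rewrite eqxx.
by exists C; split=> //; rewrite -gE (leq_ltn_trans _ lt)// kdist_le.
Qed.

Let vorbit v := [set w | exists2 k, K k & w = vact k v].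

Let vrep v := xget xpredT (vorbit v).

Let vorbitE k v : K k -> vorbit (vact k v) = vorbit v.
Proof.
move=> Kk; apply/seteqP; split=> w [h Kh ->].
  by exists (h * k); [exact: KM|rewrite vactM].
by exists (h * k^-1); [apply: KM => //; exact: KV|rewrite vactM vactK].
Qed.

Let vrepP v : exists k, K k /\ v = vact k (vrep v).
Proof.
have /= [k Kk E] : vorbit v (vrep v) by apply: (@xgetPex _ xpredT); exists v, 1; rewrite ?vact1.
by exists k^-1; rewrite E vactK; split=> //; exact: KV.
Qed.

(** The parent edges form an invariant forest whose components each contain
    exactly one vertex of the orbit of the base vertex; [rho v] labels the
    component of [v]. *)
Lemma exists_root : exists rho : ((gT -> bool) -> bool) -> gT,
  [/\ forall v, vtx v -> K (rho v), forall k, K k -> rho (principal T k) = k,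
      forall k v, K k -> vtx v -> rho (vact k v) = k * rho v
    & forall v C, vtx v -> T C -> rho (origin T C) <> rho (origin T (compl C)) ->
        v C = C (rho v)].
Proof.
have [P0 HP0] := choice kdist_step.
have [kk Hkk] := choice vrepP.
have Hrep v : vtx v -> vtx (vrep v).
  move=> Hv; have [Kk E] := Hkk v.
  by rewrite -[vrep v](vactK (kk v)) -E; exact: (vertex_vact HT).
(* The edge to the parent, chosen for one vertex in each orbit and moved around by
   [K], consistently because [K] acts freely. *)
pose PE v := ltr (kk v) (P0 (vrep v)).
have PEP v : vtx v -> (0 < kdist v)%N ->
    [/\ T (PE v), origin T (PE v) = v & (kdist (origin T (compl (PE v))) < kdist v)%N].
  move=> Hv v0; have [Kk E] := Hkk v; have Hr := Hrep v Hv.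
  have dE : kdist v = kdist (vrep v) by rewrite {1}E kdist_vact.
  have [|TC oC lt] := HP0 _ Hr; first by rewrite -dE.
  rewrite /PE -ltr_compl !(origin_ltr HT) oC -E; split=> //; first exact/(T_ltr HT).
  by rewrite dE kdist_vact//; apply/(vertex_origin HT)/(cut_compl HT).
have PEk k v : K k -> vtx v -> PE (vact k v) = ltr k (PE v).
  move=> Kk Hv; have [K2 E2] := Hkk v; have [K3 E3] := Hkk (vact k v).
  have rE : vrep (vact k v) = vrep v by rewrite /vrep vorbitE.
  rewrite /PE rE -ltrM (_ : kk (vact k v) = k * kk v)//.
  apply: (vact_inj K3 _ (Hrep v Hv)); first exact: KM.
  by rewrite vactM -E2 -[in LHS]rE -E3.
pose next v := if kdist v == 0%N then v else origin T (compl (PE v)).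
have nextV v : vtx v -> vtx (next v).
  move=> Hv; rewrite /next; case: eqP => // /eqP; rewrite -lt0n => v0.
  by have [TC _ _] := PEP v Hv v0; apply/(vertex_origin HT)/(cut_compl HT).
have nextk k v : K k -> vtx v -> next (vact k v) = vact k (next v).
  move=> Kk Hv; rewrite /next kdist_vact//; case: ifP => // _.
  by rewrite PEk// -ltr_compl (origin_ltr HT).
have nextd v : vtx v -> (kdist (next v) <= (kdist v).-1)%N.
  move=> Hv; rewrite /next; case: eqP => [->//|/eqP]; rewrite -lt0n => v0.
  by have [_ _] := PEP v Hv v0; lia.
have iterV n v : vtx v -> vtx (iter n next v).
  by move=> Hv; elim: n => //= n IH; exact: nextV.
have iterd n v : vtx v -> (kdist (iter n next v) <= kdist v - n)%N.
  move=> Hv; elim: n => [|n IH]; first by rewrite subn0.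
  by apply: leq_trans (nextd _ (iterV n v Hv)) _; lia.
pose root v := iter (kdist v) next v.
have root0 v : vtx v -> kdist (root v) = 0%N.
  by move=> Hv; have := iterd (kdist v) v Hv; rewrite subnn leqn0 => /eqP.
have rootn v n : vtx v -> (kdist v <= n)%N -> iter n next v = root v.
  move=> Hv /subnKC <-; rewrite addnC iterD -/(root v).
  by elim: (n - _)%N => //= m ->; rewrite {1}/next root0.
have rootnext v : vtx v -> root (next v) = root v.
  move=> Hv; have [v0|v0] := posnP (kdist v).
    by rewrite [next v]/next v0 eqxx.
  by rewrite -(rootn (next v) (kdist v).-1) ?nextd//; [rewrite -iterSr prednK|exact: nextV].
have exg v : exists g, vtx v -> K g /\ root v = principal T g.
  have [Hv|] := pselect (vtx v); last by exists 1.
  by have [g Kg E] := kdist0 (iterV _ v Hv) (root0 v Hv); exists g.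
have [rho Hrho] := choice exg.
have rhoV v w : vtx v -> vtx w -> root v = root w -> rho v = rho w.
  move=> Hv Hw E; have [Kv Ev] := Hrho v Hv; have [Kw Ew] := Hrho w Hw.
  by apply: (principal_inj Kv Kw); rewrite -Ev -Ew.
have rho_p k : K k -> rho (principal T k) = k.
  move=> Kk; have [Kg E] := Hrho _ (vertex_principal HT k).
  apply: (principal_inj Kg Kk); rewrite -E /root.
  have -> // : kdist (principal T k) = 0%N.
  apply/eqP; rewrite -leqn0 (leq_trans (kdist_le _ Kk))//.
  rewrite /vdist (_ : [set _ | _] = set0); first by rewrite /ncard fset_set0.
  by rewrite -subset0 => D [_]; rewrite eqxx.
exists rho; split=> //.
- by move=> v /Hrho[].
- move=> k v Kk Hv; have Hkv := vertex_vact HT k Hv.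
  have [Kg E] := Hrho v Hv; have [Kg' E'] := Hrho _ Hkv.
  apply: (principal_inj Kg' (KM Kk Kg)); rewrite -E' -(vact_principal HT) -E.
  rewrite /root kdist_vact//; elim: (kdist v) => //= n ->.
  by rewrite nextk//; exact: iterV.
- move=> v C Hv TC rC; have [n] := ubnP (kdist v); elim: n v Hv => // n IH v Hv vn.
  have [v0|v0] := posnP (kdist v).
    by have [g Kg ->] := kdist0 Hv v0; rewrite rho_p// principalE.
  have [TP oP lt] := PEP v Hv v0.
  have nE : next v = origin T (compl (PE v)) by rewrite /next gtn_eqF.
  have Hn := nextV v Hv.
  have rhoE : rho (next v) = rho v by apply: rhoV => //; exact: rootnext.
  rewrite -rhoE -IH//; last by rewrite nE; lia.
  rewrite nE -{1}oP origin_other//.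
    by move=> CE; apply: rC; rewrite CE oP -nE rhoE.
  by move=> CE; apply: rC; rewrite CE complK oP -nE rhoE.
Qed.

(** Contracting the components of the invariant forest leaves a tree on which [K]
    acts simply transitively on the vertices.  Its edges that leave the component
    of 1 are the cuts in [L], and the edge [C] leads to the component of [beta C].
    The sets in [L] are pairwise disjoint and avoid 1, and [beta C] maps the
    complement of [star C] onto [C], so that these elements play ping-pong: a
    reduced word sends 1 into the set of its first letter. *)
Theorem free_action_free : free_group K.
Proof.
have [rho [rhoK rho_p rho_act rho_cut]] := exists_root.
have rho1 : rho (principal T 1) = 1 by apply: rho_p.
pose beta C := (rho (origin T C))^-1 * rho (origin T (compl C)).
have vo C : T C -> vtx (origin T C) by exact: (vertex_origin HT).
have Tc C : T C -> T (compl C) by exact: (cut_compl HT).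
have betaK C : T C -> K (beta C).
  by move=> TC; apply: KM; [apply: KV|]; apply: rhoK; apply: vo => //; exact: Tc.
have cutE v C : vtx v -> T C -> beta C <> 1 -> v C = C (rho v).
  by move=> Hv TC b1; apply: rho_cut => // E; apply: b1; rewrite /beta E mulVg.
pose L C := [/\ T C, rho (origin T C) = 1 & beta C <> 1].
pose star C := ltr (beta C)^-1 (compl C).
have L1 C : L C -> C 1 = false.
  by move=> [TC r1 b1]; rewrite -r1 -cutE ?(originN HT)//; exact: vo.
have Lb C : L C -> C (beta C).
  move=> [TC r1 b1]; rewrite /beta r1 invg1 mul1g -cutE//; last exact/vo/Tc.
  by rewrite -[C in origin _ _ C](complK C) (originC HT) ?(originN HT)//; exact: Tc.
have Ldis C D x : L C -> L D -> C <> D -> ~~ (C x && D x).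
  move=> LC LD CD; have [TC rC bC] := LC; have [TD rD bD] := LD.
  case: (nested_cases HT TC TD) => H //; exfalso.
  - have : origin T C D by apply/asboolP; split=> //; left; split=> // DC; exact: CD.
    by rewrite cutE ?rC ?L1//; exact: vo.
  - have : origin T D C by apply/asboolP; split=> //; left.
    by rewrite cutE ?rD ?L1//; exact: vo.
  - by have := H 1; rewrite !L1.
have beta_star C : L C -> beta (star C) = (beta C)^-1.
  move=> [TC r1 b1]; rewrite /beta /star -ltr_compl !(origin_ltr HT) complK.
  rewrite !rho_act ?r1//; [|apply: KV|exact: vo|apply: KV|exact/vo/Tc]; try exact: betaK.
  by rewrite -/(beta C) /beta r1 invg1 mul1g mulVg invg1 mul1g mulg1.
have Lstar C : L C -> L (star C).
  move=> LC; have [TC r1 b1] := LC; split.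
  - by apply/(T_ltr HT)/Tc.
  - rewrite /star (origin_ltr HT) rho_act//; [|by apply/KV/betaK|exact/vo/Tc].
    by rewrite /beta r1 invg1 mul1g mulVg.
  - by rewrite beta_star// => /eqP; rewrite invg_eq1 => /eqP.
have starK C : L C -> star (star C) = C.
  by move=> LC; rewrite {1}/star beta_star// invgK /star -ltr_compl complK ltrKV.
have star_neq C : L C -> star C <> C.
  move=> LC E; have [TC _ b1] := LC; apply: b1; apply: K_inv; first exact: betaK.
  by rewrite -{1}E beta_star// mulVg.
(* One cut out of each pair of opposite ones. *)
pose pick C := xget xpredT [set D : gT -> bool | D = C \/ D = star C].
have pickP C : pick C = C \/ pick C = star C.
  by apply: (@xgetPex _ xpredT [set D : gT -> bool | D = C \/ D = star C]); exists C; left.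
have pick_star C : L C -> pick (star C) = pick C.
  move=> LC; rewrite /pick; congr xget; apply/seteqP; split=> D /=; rewrite starK//; tauto.
pose B := [set b | exists C, [/\ L C, pick C = C & beta C = b]].
have clP l : exists C, B l.1 -> [/\ L C, beta C = letter_value l
    & if l.2 then pick C = star C else pick C = C].
  have [[C [LC pC bC]]|nB] := pselect (B l.1); last by exists xpredT.
  case: l bC => x [] /= bC; [exists (star C)|exists C] => _; split=> //.
  - exact: Lstar.
  - by rewrite beta_star// bC.
  - by rewrite pick_star// starK.
have [cl Hcl] := choice clP.
have sub : Defs.generated B `<=` K.
  by apply: smallest_sub => // _ [C [[TC _ _] _ <-]]; exact: betaK.
exists B; split.
- apply/seteqP; split=> // k Kk.
  have [g1 gM gV] := And3 (subgroup1 (generated_subgroup B))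
    (subgroupM (generated_subgroup B)) (subgroupV (generated_subgroup B)).
  have genL D : L D -> pick D = D -> Defs.generated B (beta D).
    by move=> LD pD; apply: sub_gen_smallest; exists D.
  (* Follow the path from [v] to [w] from one component to the next one. *)
  have gen v w : vtx v -> vtx w -> Defs.generated B ((rho v)^-1 * rho w).
    move=> + Hw; have [n] := ubnP (vdist T v w); elim: n v => // n IH v vn Hv.
    have [->|vw] := pselect (v = w); first by rewrite mulVg.
    have [C [TC oC _ lt]] := vertex_step HT Hv Hw vw.
    have Hv' := vo _ (Tc _ TC).
    have IHw : Defs.generated B ((rho (origin T (compl C)))^-1 * rho w).
      by apply: IH => //; lia.
    have bE : (rho v)^-1 * rho (origin T (compl C)) = beta C by rewrite /beta oC.
    have -> : (rho v)^-1 * rho w = beta C * ((rho (origin T (compl C)))^-1 * rho w).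
      by rewrite -bE !mulgA mulgK.
    apply: gM => //; have [->//|/eqP b1] := eqVneq (beta C) 1.
    (* Translate the edge so that it leaves the component of the identity. *)
    pose h := (rho v)^-1; pose D := ltr h C.
    have Kh : K h by apply/KV/rhoK.
    have bD : beta D = beta C.
      rewrite /beta /D -ltr_compl !(origin_ltr HT) !rho_act//; [|exact: vo].
      by rewrite invgM !mulgA mulgVK.
    have LD : L D.
      split; [exact/(T_ltr HT)| |by rewrite bD].
      by rewrite /D (origin_ltr HT) rho_act ?oC//; exact: mulVg.
    rewrite -bD; have [pD|pD] := pickP D; first exact: genL.
    rewrite -[beta D]invgK; apply: gV; rewrite -beta_star//; apply: genL; first exact: Lstar.
    by rewrite pick_star.
  by have := gen _ _ (vertex_principal HT 1) (vertex_principal HT k); rewrite !rho_p// invg1 mul1g.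
- move=> w wN Bw; rewrite reduced_wordE => rw w1.
  (* Ping-pong: the value of a reduced word lies in the set of its first letter. *)
  have pp (l : gT * bool) (v : seq (gT * bool)) : word_over B (l :: v) ->
      path (fun a b => b != inv_letter a) l v -> cl l (word_value (l :: v)).
    elim: v l => [|l' v IH] l Blv; have /Hcl[Ll bl pl] := Blv l (mem_head _ _).
      by rewrite word_value_cons word_value_nil mulg1 -bl Lb.
    have /Hcl[Ll' bl' pl'] : B l'.1 by apply: Blv; rewrite !inE eqxx orbT.
    move=> /= /andP[ll' pv]; rewrite word_value_cons -bl.
    have cl' : cl l' (word_value (l' :: v)).
      by apply: IH => // k kv; apply: Blv; rewrite inE kv orbT.
    have : star (cl l) <> cl l'.
      move=> E; move/eqP: ll'; apply.
      have H : letter_value l' = (letter_value l)^-1 by rewrite -bl' -E beta_star// bl.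
      have pE : pick (cl l') = pick (cl l) by rewrite -E pick_star.
      have ne := star_neq _ Ll.
      have lE : l.2 != l'.2 -> l' == inv_letter l.
        move: H; case: (l) (l') => [x []] [y []] //=; rewrite /letter_value /inv_letter /=.
          by rewrite invgK => ->.
        by move=> /invg_inj->.
      move: pl pl' lE; rewrite pE -E starK//.
      by case: (l.2) (l'.2) => [] [] => [-> /ne|_ _ /(_ isT)/eqP|_ _ /(_ isT)/eqP|-> /esym/ne].
    move=> ne; have := Ldis _ _ (word_value (l' :: v)) (Lstar _ Ll) Ll' ne.
    rewrite cl' andbT /star /ltr invgK /compl negbK => {}cl'.
    by rewrite cl'.
  case: w wN Bw rw w1 => // l w _ Bw rw w1.
  have := pp l w Bw rw; rewrite w1 L1//.
  by have [] := Hcl l (Bw l (mem_head _ _)).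
Qed.

End FreeAction.

(** * Lifts of circle homeomorphisms *)

Section LiftGroup.
Local Open Scope ring_scope.
Local Open Scope quotient_scope.
Variable R : realType.

(** The increasing bijections that commute with the translation by 1, which are
    the lifts of the orientation preserving homeomorphisms of the circle. *)
Record line_homeo := LineHomeo {
  lh_fun :> R -> R;
  lh_inv : R -> R;
  lh_funK : cancel lh_fun lh_inv;
  lh_invK : cancel lh_inv lh_fun;
  lh_incr : {homo lh_fun : x y / x < y};
  lh_period : forall x, lh_fun (x + 1) = lh_fun x + 1 }.

HB.instance Definition _ := gen_eqMixin line_homeo.
HB.instance Definition _ := gen_choiceMixin line_homeo.

Lemma line_homeo_ext (f g : line_homeo) : f =1 g -> f = g.
Proof.
case: f g => [f f' fK f'K fi fp] [g g' gK g'K gi gp] /= /funext fg.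
move: fK f'K fi fp; rewrite fg => fK f'K fi fp.
have E : f' = g' by apply/funext => x; rewrite -{1}(g'K x) fK.
by move: fK f'K; rewrite E => fK f'K; congr LineHomeo; exact: Prop_irrelevance.
Qed.

Lemma lh_mono (f : line_homeo) : {mono f : x y / x <= y}.
Proof. by apply: le_mono; exact: lh_incr. Qed.

Lemma lh_mono_lt (f : line_homeo) : {mono f : x y / x < y}.
Proof. exact: leW_mono (lh_mono f). Qed.

Program Definition line_homeo_one : line_homeo := @LineHomeo id id _ _ _ _.
Next Obligation. by []. Qed.
Next Obligation. by []. Qed.
Next Obligation. by []. Qed.
Next Obligation. by []. Qed.

Program Definition line_homeo_mul (f g : line_homeo) : line_homeo :=
  @LineHomeo (f \o g) (lh_inv g \o lh_inv f) _ _ _ _.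
Next Obligation. by move=> f g x /=; rewrite !lh_funK. Qed.
Next Obligation. by move=> f g x /=; rewrite !lh_invK. Qed.
Next Obligation. by move=> f g x y xy /=; do 2 apply: lh_incr. Qed.
Next Obligation. by move=> f g x /=; rewrite !lh_period. Qed.

Program Definition line_homeo_inv (f : line_homeo) : line_homeo :=
  @LineHomeo (lh_inv f) f _ _ _ _.
Next Obligation. exact: lh_invK. Qed.
Next Obligation. exact: lh_funK. Qed.
Next Obligation. by move=> f x y xy; rewrite -(lh_mono_lt f) !lh_invK. Qed.
Next Obligation. by move=> f x; apply: (can_inj (lh_funK f)); rewrite lh_period !lh_invK. Qed.

Lemma line_homeo_mulA : associative line_homeo_mul.
Proof. by move=> f g h; exact: line_homeo_ext. Qed.
Lemma line_homeo_mul1 : left_id line_homeo_one line_homeo_mul.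
Proof. by move=> f; exact: line_homeo_ext. Qed.
Lemma line_homeo_mulr1 : right_id line_homeo_one line_homeo_mul.
Proof. by move=> f; exact: line_homeo_ext. Qed.
Lemma line_homeo_mulV : left_inverse line_homeo_one line_homeo_inv line_homeo_mul.
Proof. by move=> f; apply: line_homeo_ext; exact: lh_funK. Qed.
Lemma line_homeo_mulrV : right_inverse line_homeo_one line_homeo_inv line_homeo_mul.
Proof. by move=> f; apply: line_homeo_ext; exact: lh_invK. Qed.

HB.instance Definition _ := isGroup.Build line_homeo line_homeo_mulA
  line_homeo_mul1 line_homeo_mulr1 line_homeo_mulV line_homeo_mulrV.

Implicit Types f g : line_homeo.

Lemma lhM f g x : (f * g)%g x = f (g x). Proof. by []. Qed.
Lemma lh1 x : (1%g : line_homeo) x = x. Proof. by []. Qed.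

Program Definition trans (a : R) : line_homeo :=
  @LineHomeo (fun x => x + a) (fun x => x - a) _ _ _ _.
Next Obligation. by move=> a x; rewrite addrK. Qed.
Next Obligation. by move=> a x; rewrite subrK. Qed.
Next Obligation. by move=> a x y; rewrite ltrD2r. Qed.
Next Obligation. by move=> a x; rewrite /= addrAC. Qed.

Lemma transE a x : trans a x = x + a. Proof. by []. Qed.

Lemma transD a b : trans (a + b) = (trans a * trans b)%g.
Proof. by apply: line_homeo_ext => x; rewrite lhM !transE addrA addrAC. Qed.

Lemma trans0 : trans 0 = 1%g.
Proof. by apply: line_homeo_ext => x; rewrite transE addr0. Qed.

Lemma transN a : trans (- a) = (trans a)^-1%g.
Proof. by apply: line_homeo_ext. Qed.

Lemma lh_int f x (n : int) : f (x + n%:~R) = f x + n%:~R.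
Proof.
have nat_case y (k : nat) : f (y + k%:R) = f y + k%:R.
  by elim: k => [|k IH]; rewrite ?addr0// -natr1 !addrA lh_period IH.
case: n => k; first exact: nat_case.
by rewrite NegzE mulrNz -[in RHS](subrK k.+1%:R x) nat_case addrK.
Qed.

Lemma trans_int_central (n : int) f : (trans n%:~R * f = f * trans n%:~R)%g.
Proof. by apply: line_homeo_ext => x; rewrite !lhM !transE lh_int. Qed.

Lemma lh_continuous f : continuous f.
Proof.
move=> t; apply/cvgrPdist_lt => e e0.
have t1 : lh_inv f (f t - e) < t by rewrite -(lh_mono_lt f) lh_invK ltrBlDr ltrDl.
have t2 : t < lh_inv f (f t + e) by rewrite -(lh_mono_lt f) lh_invK ltrDl.
near=> s; rewrite distrC ltr_distl.
rewrite -[X in X < f s](lh_invK f) -[X in f s < X](lh_invK f) !lh_mono_lt.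
apply/andP; split; near: s; [exact: lt_nbhsr|exact: lt_nbhsl].
Unshelve. all: by end_near. Qed.

Let proj : R -> circle R := @circle_proj R.

Lemma lh_int_diff f x y : x - y \is a Num.int -> f x - f y \is a Num.int.
Proof.
move=> /intrP[n E]; have -> : x = y + n%:~R by rewrite -E addrC subrK.
by rewrite lh_int addrAC subrr add0r intr_int.
Qed.

Definition circle_map f (z : circle R) : circle R := proj (f (generic_quotient.repr z)).

Lemma circle_map_lift f : is_lift (circle_map f) f.
Proof.
move=> t; apply/circle_projP; apply: lh_int_diff; apply/circle_projP.
by rewrite /circle_proj reprK.
Qed.

Lemma circle_map_continuous f : continuous (circle_map f).
Proof.
apply/(@quotient_continuous R {eq_quot @eqmodZ R} (circle R)).
have -> : circle_map f \o \pi_{eq_quot (@eqmodZ R)} = proj \o f.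
  by apply/funext => t; exact: circle_map_lift.
move=> t; apply: continuous_comp; first exact: lh_continuous.
exact: (@pi_continuous R {eq_quot @eqmodZ R}).
Qed.

Lemma circle_mapM f g : circle_map (f * g)%g = circle_map f \o circle_map g.
Proof.
apply/funext => z; have [t <-] := circle_proj_surj z.
by rewrite /= !circle_map_lift.
Qed.

Lemma circle_map1 : circle_map 1%g = id.
Proof.
by apply/funext => z; have [t <-] := circle_proj_surj z; rewrite circle_map_lift.
Qed.

Lemma circle_map_homeo f : homeomorphism (circle_map f).
Proof.
exists (circle_map f^-1%g); split; [| |exact: circle_map_continuous..].
  by move=> z; have := congr1 (fun h => h z) (circle_mapM f^-1%g f); rewrite mulVg circle_map1.
by move=> z; have := congr1 (fun h => h z) (circle_mapM f f^-1%g); rewrite mulgV circle_map1.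
Qed.

Lemma circle_map_orient f : orientation_preserving (circle_map f).
Proof. by exists f; split; [exact: circle_map_lift|exact: lh_continuous|exact: lh_incr]. Qed.

Definition homeo_of f : homeo_plus R := HomeoPlus (circle_map_homeo f) (circle_map_orient f).

Lemma homeo_ofM f g : homeo_of (f * g)%g = (homeo_of f * homeo_of g)%g.
Proof. by apply: homeo_plus_ext => z; rewrite /= circle_mapM. Qed.

Lemma homeo_of1 : homeo_of 1%g = 1%g.
Proof. by apply: homeo_plus_ext => z; rewrite /= circle_map1. Qed.

Lemma homeo_ofV f : homeo_of f^-1%g = (homeo_of f)^-1%g.
Proof.
by apply: (@mulgI _ (homeo_of f)); rewrite -homeo_ofM !mulgV homeo_of1.
Qed.

(** If [x] and [y] are less than 1 apart, so are their displacements; being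
    integers, they agree. *)
Lemma homeo_of_eq1 f : homeo_of f = 1%g -> exists n : int, f = trans n%:~R.
Proof.
move=> f1.
have disp x : exists n : int, f x - x = n%:~R.
  apply/intrP/circle_projP; rewrite -(circle_map_lift f).
  by have := congr1 (fun h : homeo_plus R => h (circle_proj x)) f1.
have [n0 E0] := disp 0; exists n0; apply: line_homeo_ext => x; rewrite transE.
have loc y z : y < z -> z < y + 1 -> f y - y = f z - z.
  move=> yz zy; have [a Ea] := disp y; have [b Eb] := disp z.
  have h1 := lh_incr f yz; have h2 := lh_incr f zy; rewrite lh_period in h2.
  have l1 : (a - b)%:~R < 1%:~R :> R by rewrite mulrzBr -Ea -Eb mulr1z; lra.
  have l2 : (- 1)%:~R < (a - b)%:~R :> R by rewrite mulrzBr -Ea -Eb mulrNz mulr1z; lra.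
  by rewrite Ea Eb; rewrite !ltr_int in l1 l2; congr (_%:~R); lia.
have per y (k : int) : f (y + k%:~R) - (y + k%:~R) = f y - y by rewrite lh_int; ring.
suff : f x - x = n0%:~R by lra.
pose k := Num.floor x; rewrite -(subrK k%:~R x) per -E0.
have : 0 <= x - k%:~R by rewrite subr_ge0 floor_le.
rewrite le_eqVlt => /orP[/eqP<-//|h]; apply/esym; apply: loc => //.
by rewrite add0r ltrBlDr addrC -(intrD _ k 1) floorD1_gt.
Qed.

Lemma homeo_of_trans_int (n : int) : homeo_of (trans n%:~R) = 1%g.
Proof.
apply: homeo_plus_ext => z; have [t <-] := circle_proj_surj z.
rewrite /= circle_map_lift; apply/circle_projP.
by rewrite transE addrAC subrr add0r intr_int.
Qed.

(** A continuous increasing lift satisfies [F (x + 1) = F x + k] with [k] a positive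
    integer, and [k = 1] because the homeomorphism is injective. *)
Lemma homeo_of_surj (h : homeo_plus R) : exists f, homeo_of f = h.
Proof.
have [F [hF cF iF]] := homeo_plus_orient h.
have leF : {mono F : a b / a <= b} by exact: le_mono.
have ltF : {mono F : a b / a < b} by exact: leW_mono.
have Fsurj := increasing_lift_surj hF cF iF.
have /choice[G GK] := Fsurj.
have FK : cancel F G by move=> x; apply: (inc_inj leF); rewrite GK.
have per x : F (x + 1) = F x + 1.
  have /intrP[k kE] : F (x + 1) - F x \is a Num.int.
    apply/circle_projP; rewrite -!hF; congr (h _); apply/circle_projP.
    by rewrite addrAC subrr add0r rpred1.
  have k0 : 0 < k%:~R :> R by rewrite -kE subr_gt0 iF// ltrDl.
  rewrite ltr0z in k0.
  have FE : F (x + 1) = F x + k%:~R by rewrite -kE; ring.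
  have k1 : k <= 1.
    rewrite leNgt; apply/negP => k2.
    pose y := G (F x + 1).
    have xy : x < y by rewrite -ltF GK ltrDl.
    have yx : y < x + 1.
      by rewrite -ltF GK FE ltrD2l -[1]/(1%:~R) ltr_int.
    have : y - x \is a Num.int.
      have [g [gK _ _ _]] := homeo_plus_homeo h.
      apply/circle_projP; apply: (can_inj gK); rewrite !hF; apply/circle_projP.
      by rewrite GK addrAC subrr add0r rpred1.
    move=> /intrP[j jE]; have : 0 < j%:~R :> R by rewrite -jE subr_gt0.
    have : j%:~R < 1%:~R :> R by rewrite -jE ltrBlDr addrC.
    by rewrite ltr0z ltr_int; lia.
  by rewrite FE (_ : k = 1)//; lia.
pose f := LineHomeo FK GK iF per.
exists f; apply: homeo_plus_ext => z; have [t <-] := circle_proj_surj z.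
by rewrite /= circle_map_lift hF.
Qed.

(** The iterates of a point that is moved upwards keep moving upwards. *)
Lemma line_homeo_torsion f (n : nat) : (0 < n)%N -> (f ^+ n = 1)%g -> f = 1%g.
Proof.
move=> n0 fn; apply: line_homeo_ext => x; rewrite lh1.
have [lt|gt|//] := ltgtP (f x) x.
- suff H k : (f ^+ k.+1)%g x < x by move: (H n.-1); rewrite prednK// fn lh1 ltxx.
  elim: k => [//|k IH]; rewrite expgS lhM; apply: lt_trans lt.
  exact: lh_incr.
- suff H k : x < (f ^+ k.+1)%g x by move: (H n.-1); rewrite prednK// fn lh1 ltxx.
  elim: k => [//|k IH]; rewrite expgS lhM; apply: lt_trans gt _.
  exact: lh_incr.
Qed.

End LiftGroup.

(** * The transfer of a central extension *)

Section CentralExtension.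
Local Open Scope group_scope.
Variables (E Q : groupType) (pi : E -> Q) (z : int -> E).
Hypothesis piM : forall e e', pi (e * e') = pi e * pi e'.
Hypothesis pi_surj : forall g, exists e, pi e = g.
Hypothesis zD : forall a b : int, z (a + b)%R = z a * z b.
Hypothesis z_central : forall a e, z a * e = e * z a.
Hypothesis z_inj : injective z.
Hypothesis ker_pi : forall e, pi e = 1 -> exists a, e = z a.
Hypothesis pi_z : forall a, pi (z a) = 1.

Lemma z0 : z 0%R = 1.
Proof. by apply: (@mulgI _ (z 0%R)); rewrite -zD addr0 mulg1. Qed.

Lemma pi1 : pi 1 = 1.
Proof. by apply: (@mulgI _ (pi 1)); rewrite -piM !mulg1. Qed.

Lemma piV e : pi e^-1 = (pi e)^-1.
Proof. by apply: (@mulgI _ (pi e)); rewrite -piM !mulgV pi1. Qed.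

Lemma pi_fiber e e' : pi e = pi e' -> exists a, e = e' * z a.
Proof.
move=> ee'; have [a aE] : exists a, e'^-1 * e = z a.
  by apply: ker_pi; rewrite piM piV ee' mulVg.
by exists a; rewrite -aE mulVKg.
Qed.

Variables (G F B : set Q) (n : nat) (t : 'I_n -> Q).
Hypothesis sG : subgroup G.
Hypothesis FB : free_basis F B.
Hypothesis tG : forall i, G (t i).
Hypothesis tP : forall g, G g -> exists! i, F ((t i)^-1 * g).

(** The extension splits over the free group [F], so its restriction to [F] is
    a direct product and projects onto the central subgroup. *)
Lemma exists_retraction : exists psi : E -> int,
  (forall e e', F (pi e) -> F (pi e') -> psi (e * e') = (psi e + psi e')%R) /\
  (forall a, psi (z a) = a).
Proof.
have [L HL] := choice pi_surj.
have lw w : pi (word_value [seq (L l.1, l.2) | l <- w]) = word_value w.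
  elim: w => [|l w IH]; first by rewrite !word_value_nil pi1.
  by rewrite /= !word_value_cons piM IH; congr (_ * _);
    rewrite /letter_value /=; case: ifP; rewrite ?piV HL.
have wP f : exists w, F f -> word_over B w /\ word_value w = f.
  have [Ff|nF] := pselect (F f); last by exists [::].
  by have /(free_basisP FB)[w [? _ ?]] := Ff; exists w.
have {wP}[wd wdP] := choice wP.
(* The section that lifts the letters of the basis. *)
pose s f := word_value [seq (L l.1, l.2) | l <- wd f].
have ps f : F f -> pi (s f) = f by move=> /wdP[_ wE]; rewrite lw.
have sF := free_subgroup FB.
have sM f f' : F f -> F f' -> s (f * f') = s f * s f'.
  move=> Ff Ff'; have Fff := subgroupM sF Ff Ff'.
  have [B1 E1] := wdP f Ff; have [B2 E2] := wdP f' Ff'; have [B3 E3] := wdP _ Fff.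
  have map_inv w : [seq (L l.1, l.2) | l <- inv_word w] =
      inv_word [seq (L l.1, l.2) | l <- w].
    by rewrite /inv_word map_rev -!map_comp.
  have Bw : word_over B (inv_word (wd (f * f')) ++ wd f ++ wd f').
    apply/word_over_cat; split; first exact: word_over_inv.
    exact/word_over_cat.
  have := @free_basis_ext _ _ _ FB _ L _ Bw.
  rewrite !map_cat map_inv !word_value_cat !word_valueV E1 E2 E3 mulVg => /(_ erefl).
  by move=> /mulg1_eq; rewrite invgK.
have aP e : exists a, F (pi e) -> e = s (pi e) * z a.
  have [Fe|nF] := pselect (F (pi e)); last by exists 0%R.
  by have [|a aE] := @pi_fiber e (s (pi e)); [rewrite ps|exists a].
have {aP}[psi psiP] := choice aP; exists psi; split=> [e e' Fe Fe'|a].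
  apply: z_inj; apply: (@mulgI _ (s (pi (e * e')))).
  rewrite -psiP; last by rewrite piM; exact: subgroupM.
  rewrite piM sM// zD {1}(psiP e Fe) {1}(psiP e' Fe') !mulgA; congr (_ * _).
  by rewrite -!mulgA z_central.
have F1 := subgroup1 sF.
have s1 : s 1 = 1 by apply: (@mulgI _ (s 1)); rewrite -sM// !mulg1.
by apply: z_inj; have := psiP (z a); rewrite pi_z s1 mul1g => <-.
Qed.

(** The transfer of the retraction from the preimage of [F] to the preimage of
    [G]. *)
Lemma exists_transfer : exists phi : E -> int,
  (forall e e', G (pi e) -> G (pi e') -> phi (e * e') = (phi e + phi e')%R) /\
  (forall a, phi (z a) = (a *+ n)%R).
Proof.
have [psi [psiM psiz]] := exists_retraction.
have [T HT] : exists T : 'I_n -> E, forall i, pi (T i) = t i.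
  by have [L HL] := choice pi_surj; exists (L \o t) => i /=.
have jP (gi : Q * 'I_n) : exists j, G gi.1 -> F ((t j)^-1 * (gi.1 * t gi.2)).
  case: gi => g i; have [Gg|nG] := pselect (G g); last by exists i.
  by have [j [Fj _]] := tP (subgroupM sG Gg (tG i)); exists j.
have {jP}[sig0 sigP0] := choice jP; pose sig g i := sig0 (g, i).
have sigP g i : G g -> F ((t (sig g i))^-1 * (g * t i)) by exact: (sigP0 (g, i)).
have sig_uniq g i j : G g -> F ((t j)^-1 * (g * t i)) -> j = sig g i.
  move=> Gg Fj; have [k [_ H]] := tP (subgroupM sG Gg (tG i)).
  by rewrite -(H j Fj) -(H _ (sigP g i Gg)).
have sF := free_subgroup FB.
have sigM g h i : G g -> G h -> sig (g * h) i = sig g (sig h i).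
  move=> Gg Gh; apply/esym/sig_uniq; first exact: subgroupM.
  have := subgroupM sF (sigP g (sig h i) Gg) (sigP h i Gh).
  by congr F; rewrite !mulgA mulgK.
have sig1 i : sig 1 i = i.
  by apply/esym/sig_uniq; [exact: subgroup1|rewrite mul1g mulVg; exact: subgroup1 sF].
exists (fun e => (\sum_i psi ((T (sig (pi e) i))^-1 * (e * T i))%g)%R).
split=> [e e' Ge Ge'|a].
  have FT e0 i : G (pi e0) -> F (pi ((T (sig (pi e0) i))^-1 * (e0 * T i))).
    by move=> Ge0; rewrite !piM piV !HT; exact: sigP.
  have bij : bijective (sig (pi e')).
    exists (sig (pi e')^-1) => i; rewrite -sigM ?mulVg ?mulgV ?sig1//; exact: subgroupV.
  rewrite [X in (X + _)%R](reindex (sig (pi e')))/=; last exact: onW_bij.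
  rewrite -big_split /=; apply: eq_bigr => i _.
  rewrite -psiM; [|exact: FT|exact: FT].
  by rewrite piM sigM//; congr psi; rewrite !mulgA mulgK.
rewrite (eq_bigr (fun=> a)) ?sumr_const ?card_ord// => i _.
by rewrite pi_z sig1 z_central mulKg psiz.
Qed.

Hypothesis n_gt0 : (0 < n)%N.

(** Elements of the kernel of the reduction of the transfer lift to elements of
    transfer 0, and so do their relations: the kernel embeds in [E]. *)
Lemma cyclic_quotient : exists m (p : Q -> Zmod m), [/\ (0 < m)%N, hom_on G p,
  p @` G = [set: Zmod m]
  & forall g, G g -> p g = 1 -> exists e, pi e = g /\
      forall k, g ^+ k = 1 -> e ^+ k = 1].
Proof.
have [phi [phiM phiz]] := exists_transfer.
have phi1 : phi 1 = 0%R by rewrite -z0 phiz mul0rn.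
have G1 := subgroup1 sG.
have phiV e : G (pi e) -> phi e^-1 = (- phi e)%R.
  move=> Ge; apply/eqP; rewrite -addr_eq0 -phiM ?mulVg ?phi1//.
  by rewrite piV; exact: subgroupV.
have exd : exists d, (0 < d)%N && `[< exists2 e, G (pi e) & phi e = Posz d >].
  exists n; rewrite n_gt0/=; apply/asboolP; exists (z 1%R); rewrite ?pi_z//.
  by rewrite phiz natz.
(* The image of the transfer is generated by its least positive value [d]; it
   contains the index [n], the value at a generator of the central
   subgroup. *)
case: (ex_minnP exd) => d /andP[d0 /asboolP[e0 Ge0 e0d]] dmin.
have GX e k : G (pi e) -> G (pi (e ^+ k)) /\ phi (e ^+ k) = (phi e *+ k)%R.
  move=> Ge; elim: k => [|k [IH1 IH2]]; first by rewrite expg0 pi1 mulr0n.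
  by rewrite expgS piM phiM// IH2 mulrS; split=> //; exact: subgroupM.
have mult e (q : int) : G (pi e) -> exists2 e', G (pi e') & phi e' = (phi e * q)%R.
  move=> Ge; case: q => k.
    by have [h1 h2] := GX e k Ge; exists (e ^+ k) => //; rewrite h2 -mulr_natr natz.
  have [h1 h2] := GX e k.+1 Ge; exists (e ^+ k.+1)^-1; first by rewrite piV; exact: subgroupV.
  by rewrite phiV// h2 NegzE mulrN -mulr_natr natz.
have dvd e : G (pi e) -> (Posz d %| phi e)%Z.
  move=> Ge; apply/dvdz_mod0P; have [e' Ge' E'] := mult e0 (- (phi e %/ d)%Z)%R Ge0.
  have rE : phi (e * e') = (phi e %% d)%Z by rewrite phiM// E' e0d /modz; ring.
  have r0 : (0 <= (phi e %% d)%Z)%R by apply: modz_ge0; lia.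
  have rd : ((phi e %% d)%Z < d)%R by apply: ltz_pmod; lia.
  have [//|/eqP rN] := eqVneq (phi e %% d)%Z 0%R.
  have : (d <= `|(phi e %% d)%Z|)%N; last by lia.
  apply: dmin; apply/andP; split; first by lia.
  by apply/asboolP; exists (e * e'); [rewrite piM; exact: subgroupM|rewrite rE; lia].
have [m mE] : exists m, n = (m * d)%N.
  have := dvd (z 1%R); rewrite pi_z phiz natz => /(_ G1)/dvdzP[q qE].
  by exists `|q|%N; move: qE; nia.
have m0 : (0 < m)%N by move: n_gt0; rewrite mE muln_gt0 => /andP[].
have [L HL] := choice pi_surj.
pose red (a : int) : Zmod m := inZp `|(a %% m)%Z|%N.
have absE a : (a %% m)%Z = Posz `|(a %% m)%Z|%N by rewrite gez0_abs// modz_ge0//; lia.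
have redD a b : red (a + b)%R = red a * red b.
  apply: val_inj => /=; rewrite prednK// -modzDm (absE a) (absE b) -PoszD modz_nat.
  by rewrite absz_nat modn_mod modnDm.
have red_mul (a : int) : red (a * Posz m)%R = 1.
  by rewrite /red modzMl; exact: val_inj.
have red_eq1 a : red a = 1 -> (Posz m %| a)%Z.
  move=> /(congr1 val) /=; rewrite prednK// modn_small; last first.
    have := @ltz_pmod a m; rewrite (absE a); lia.
  by move=> a0; apply/dvdz_mod0P; rewrite absE a0.
have dz : Posz d != 0%R by lia.
pose p g := red (phi (L g) %/ d)%Z.
have GL g : G g -> G (pi (L g)) by rewrite HL.
have pE e : G (pi e) -> p (pi e) = red (phi e %/ d)%Z.
  move=> Ge; have [a ->] : exists a, e = L (pi e) * z a by apply: pi_fiber; rewrite HL.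
  rewrite /p piM HL pi_z mulg1 phiM ?pi_z//; last exact: GL.
  rewrite phiz mE -mulr_natr natz PoszM mulrA divzDr ?dvdz_mull// mulzK//.
  by rewrite redD red_mul mulg1.
exists m, p; split=> //.
- move=> g h Gg Gh; have := pE (L g * L h); rewrite piM !HL => ->; last exact: subgroupM.
  by rewrite phiM ?HL// divzDl ?dvd ?HL// redD.
- apply/seteqP; split=> // j _.
  have [e' Ge' E'] := mult e0 (Posz j) Ge0.
  exists (pi e') => //; rewrite pE// E' e0d mulrC mulzK//.
  have jm : (j < m)%N by move: (nat_of_ord j) (ltn_ord j) => k; rewrite prednK.
  by apply: val_inj; rewrite /= modz_nat absz_nat (modn_small jm) modn_small.
- move=> g Gg /red_eq1 /dvdzP[c cE].
  have GLg := GL g Gg.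
  have phiL : phi (L g) = (c *+ n)%R.
    by rewrite -(divzK (dvd _ GLg)) cE mE -mulr_natr natz PoszM mulrA.
  (* The lift of [g] of transfer 0. *)
  pose e := L g * z (- c)%R.
  have pe : pi e = g by rewrite piM HL pi_z mulg1.
  have Ge : G (pi e) by rewrite pe.
  have phie : phi e = 0%R by rewrite phiM ?pi_z// phiL phiz mulNrn addrN.
  exists e; split=> // k gk.
  have [a aE] : exists a, e ^+ k = z a.
    apply: ker_pi; rewrite -gk -pe; elim: (k) => [|j IH]; first by rewrite pi1.
    by rewrite !expgS piM IH.
  have [_] := GX e k Ge; rewrite aE phiz phie mul0rn => /eqP.
  by rewrite mulrn_eq0 gtn_eqF//= => /eqP->; exact: z0.
Qed.

End CentralExtension.

(** * Virtually free groups of circle homeomorphisms *)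

Section Transport.
Local Open Scope group_scope.
Variables (hT Q : groupType) (f : hT -> Q).
Hypothesis fM : forall x y, f (x * y) = f x * f y.
Hypothesis f_inj : injective f.

Lemma inj_hom1 : f 1 = 1.
Proof. by apply: (@mulgI _ (f 1)); rewrite -fM !mulg1. Qed.

Lemma inj_homV x : f x^-1 = (f x)^-1.
Proof. by apply: (@mulgI _ (f x)); rewrite -fM !mulgV inj_hom1. Qed.

Lemma inj_homX x n : f (x ^+ n) = f x ^+ n.
Proof. by elim: n => [|n IH]; rewrite ?inj_hom1// !expgS fM IH. Qed.

Let mapw (w : seq (hT * bool)) := [seq (f l.1, l.2) | l <- w].

Lemma word_value_map w : word_value (mapw w) = f (word_value w).
Proof.
elim: w => [|l w IH]; first by rewrite !word_value_nil inj_hom1.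
rewrite /= !word_value_cons fM IH; congr (_ * _).
by rewrite /letter_value /=; case: ifP; rewrite ?inj_homV.
Qed.

Lemma word_over_image (B : set hT) w :
  word_over (f @` B) w <-> exists2 w', word_over B w' & w = mapw w'.
Proof.
split=> [|[w' Bw' ->] l /mapP[l' /Bw' Bl ->]]; last by exists l'.1.
elim: w => [_|[x b] w IH /word_over_cons[/= [y By <-] /IH[w' Bw' ->]]]; first by exists [::].
by exists ((y, b) :: w') => //; apply/word_over_cons.
Qed.

Lemma generated_image (B : set hT) :
  Defs.generated (f @` B) = f @` (Defs.generated B).
Proof.
apply/seteqP; split=> [x /generated_wordP[w /word_over_image[w' Bw' ->] <-]|_ [x + <-]].
  by exists (word_value w'); [apply/generated_wordP; exists w'|rewrite word_value_map].
move=> /generated_wordP[w Bw <-]; apply/generated_wordP; exists (mapw w).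
  by apply/word_over_image; exists w.
exact: word_value_map.
Qed.

Lemma free_basis_image (F B : set hT) : free_basis (f @` F) (f @` B) <-> free_basis F B.
Proof.
have red w : reduced_word (mapw w) = reduced_word w.
  rewrite !reduced_wordE sorted_map; case: w => //= l w; apply: eq_path => k k' /=.
  by rewrite /inv_letter !xpair_eqE (inj_eq f_inj).
rewrite /free_basis generated_image; split=> -[FB H].
- split; first by apply/funext => x; rewrite -(image_inj f_inj) FB image_inj.
  move=> w wN Bw; rewrite -red => rw w1; apply: (H (mapw w)) => //.
  + by case: w wN {Bw rw w1}.
  + by apply/word_over_image; exists w.
  + by rewrite word_value_map w1 inj_hom1.
- split; first by rewrite FB.
  move=> w wN /word_over_image[w' Bw' wE]; rewrite wE red => rw.
  rewrite word_value_map -inj_hom1 => /f_inj; apply: H => // w'0.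
  by apply: wN; rewrite wE w'0.
Qed.

End Transport.

Section SubgroupType.
Local Open Scope group_scope.
Variables (Q : groupType) (G : set Q).
Hypothesis sG : subgroup G.

(** The vacuous dependency on [sG] lets the group structure be inferred from the
    type. *)
Definition subgroup_type : Type := let _ := sG in {x : Q | G x}.

HB.instance Definition _ := gen_eqMixin subgroup_type.
HB.instance Definition _ := gen_choiceMixin subgroup_type.

Let st1 : subgroup_type := exist _ 1 (subgroup1 sG).
Let stM (x y : subgroup_type) : subgroup_type :=
  exist _ (sval x * sval y) (subgroupM sG (svalP x) (svalP y)).
Let stV (x : subgroup_type) : subgroup_type :=
  exist _ (sval x)^-1 (subgroupV sG (svalP x)).

Let st_ext (x y : subgroup_type) : sval x = sval y -> x = y.
Proof. by case: x y => x Gx [y Gy] /= xy; exact: eq_exist. Qed.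

Let stMA : associative stM. Proof. by move=> x y w; apply: st_ext; exact: mulgA. Qed.
Let stM1 : left_id st1 stM. Proof. by move=> x; apply: st_ext; exact: mul1g. Qed.
Let st1M : right_id st1 stM. Proof. by move=> x; apply: st_ext; exact: mulg1. Qed.
Let stVM : left_inverse st1 stV stM. Proof. by move=> x; apply: st_ext; exact: mulVg. Qed.
Let stMV : right_inverse st1 stV stM. Proof. by move=> x; apply: st_ext; exact: mulgV. Qed.

HB.instance Definition _ := isGroup.Build subgroup_type stMA stM1 st1M stVM stMV.

Lemma subgroup_as_group : exists (hT : groupType) (f : hT -> Q),
  [/\ forall x y, f (x * y) = f x * f y, injective f & range f = G].
Proof.
exists subgroup_type, (fun x => sval x); split=> [//|x y|]; first exact: st_ext.
by apply/seteqP; split=> [_ [[x Gx] _ <-]//|x Gx]; exists (exist _ x Gx).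
Qed.

End SubgroupType.

Section CircleGroups.
Local Open Scope group_scope.
Variable R : realType.

Lemma kernel_index (Q : groupType) (G : set Q) m (p : Q -> Zmod m) : (0 < m)%N ->
  subgroup G -> hom_on G p -> p @` G = [set: Zmod m] ->
  has_index G [set g | G g /\ p g = 1] m.
Proof.
move=> m0 sG pM pG.
have p1 : p 1 = 1 by apply: (@mulgI _ (p 1)); rewrite -pM ?mulg1//; exact: subgroup1.
have pV g : G g -> p g^-1 = (p g)^-1.
  move=> Gg; apply: (@mulgI _ (p g)); rewrite -pM ?mulgV//; exact: subgroupV.
have mE : m.-1.+1 = m by rewrite prednK.
have tE (i : 'I_m) : exists g, G g /\ p g = cast_ord (esym mE) i.
  have : [set: Zmod m] (cast_ord (esym mE) i) by [].
  by rewrite -pG => -[g Gg E]; exists g.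
have [t tP] := choice tE; exists t; split=> [i|g Gg]; first by have [] := tP i.
exists (cast_ord mE (p g)); split.
  have [Gt Et] := tP (cast_ord mE (p g)); split.
    by apply: subgroupM => //; exact: subgroupV.
  rewrite pM ?pV ?Et//; last exact: subgroupV.
  by rewrite cast_ordK mulVg.
move=> i [_]; have [Gt Et] := tP i.
rewrite pM ?pV ?Et//; last exact: subgroupV.
move=> /mulg1_eq; rewrite invgK => <-.
by rewrite cast_ordKV.
Qed.

(** Two powers of [g] lie in the same coset. *)
Lemma finite_index_power (Q : groupType) (F : set Q) n (t : 'I_n -> Q) g :
  subgroup F -> (forall k, exists i, F ((t i)^-1 * g ^+ k)) ->
  exists2 k, (0 < k)%N & F (g ^+ k).
Proof.
move=> sF H; have [c cP] := choice H.
have [a [b [ab E]]] : exists a b, (a < b)%N /\ c a = c b.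
  pose d (a : 'I_n.+1) := c a.
  have : ~~ injectiveb d.
    by apply/negP => /injectiveP /leq_card; rewrite !card_ord ltnn.
  move=> /injectivePn[a [b ab E]]; wlog lt : a b ab E / (a < b)%N.
    move=> W; have [lt|gt|eq] := ltngtP a b; [exact: (W a b)| |by rewrite (val_inj eq) eqxx in ab].
    by apply: (W b a) => //; rewrite eq_sym.
  by exists a, b.
exists (b - a)%N; first by rewrite subn_gt0.
have := subgroupM sF (subgroupV sF (cP a)) (cP b).
rewrite E invgM invgK -mulgA mulVKg -{1}(subnKC (ltnW ab)) expgnDr mulKg.
exact.
Qed.

(** The kernel of [cyclic_quotient] embeds in the group of lifts to the line, so
    it is torsion free; a nontrivial element has a nontrivial power in [F], which
    fixes no vertex of the tree of the group, so the kernel acts freely on it. *)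
Theorem virtually_free_circle_group (G : set (homeo_plus R)) :
  subgroup G -> finitely_generated G -> virtually_free G ->
  exists (m : nat) (F : set (homeo_plus R)),
    [/\ (0 < m)%N, F `<=` G, free_group F, has_index G F m
      & exists p : homeo_plus R -> Zmod m, short_exact F G id p].
Proof.
move=> sG [S GS] [F [FG [B FB] [n [t [tG tP]]]]].
have sF := free_subgroup FB.
have n0 : (0 < n)%N.
  by have [i _] := tP 1 (subgroup1 sG); exact: leq_ltn_trans (leq0n i) (ltn_ord i).
have [|||||m [p [m0 pM pG pK]]] := @cyclic_quotient _ _ (@homeo_of R)
   (fun a => trans (a%:~R)%R) (@homeo_ofM R) (@homeo_of_surj R) _ _ _ _ _ G F B n t sG FB tG tP n0.
- by move=> a b; rewrite -transD intrD.
- by move=> a e; exact: trans_int_central.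
- move=> a b /(congr1 (fun h : line_homeo R => h 0%R)).
  by rewrite !transE !add0r => /intr_inj.
- exact: homeo_of_eq1.
- exact: homeo_of_trans_int.
pose K := [set g | G g /\ p g = 1].
have p1 : p 1 = 1 by apply: (@mulgI _ (p 1)); rewrite -pM ?mulg1//; exact: subgroup1.
have pV g : G g -> p g^-1 = (p g)^-1.
  move=> Gg; apply: (@mulgI _ (p g)); rewrite -pM ?mulgV//; exact: subgroupV.
have sK : subgroup K.
  split; first by split=> //; exact: subgroup1.
  move=> x y [Gx x1] [Gy y1]; split; first by apply: subgroupM => //; exact: subgroupV.
  by rewrite pM ?pV// ?x1 ?y1 ?invg1 ?mulg1//; exact: subgroupV.
have K_tf g k : K g -> (0 < k)%N -> g ^+ k = 1 -> g = 1.
  move=> [Gg g1] k0 gk; have [e [eg H]] := pK g Gg g1.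
  by rewrite -eg (line_homeo_torsion k0 (H k gk)) homeo_of1.
suff Kfree : free_group K.
  exists m, K; split=> //; [by move=> g []|exact: kernel_index|].
  by exists p; split=> //; rewrite image_id.
have [hT [f [fM f_inj fG]]] := subgroup_as_group sG.
have fV := inj_homV fM; have f1 := inj_hom1 fM; have fX := inj_homX fM.
have imE A : A `<=` G -> f @` (f @^-1` A) = A.
  move=> AG; apply/seteqP; split=> [_ [x Ax <-]//|x Ax].
  by have : G x := AG x Ax; rewrite -fG => -[y _ yx]; exists y => //; rewrite /preimage /= yx.
have BG : B `<=` G.
  move=> b Bb; apply: FG; rewrite FB.1; exact: sub_gen_smallest.
have SG : [set` S] `<=` G by rewrite GS; exact: sub_gen_smallest.
have fgh : finitely_generated [set: hT].
  have inv x : exists y, G x -> f y = x.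
    have [Gx|] := pselect (G x); last by exists 1.
    by move: Gx; rewrite -fG => -[y _ yx]; exists y.
  have [j jP] := choice inv; exists [seq j s | s <- S].
  have -> : [set` [seq j s | s <- S]] = f @^-1` [set` S].
    apply/seteqP; split=> x /=; first by move=> /mapP[s Ss ->]; rewrite jP//; exact: SG.
    move=> Sx; apply/mapP; exists (f x) => //; apply: f_inj; rewrite jP//; exact: SG.
  apply/esym/funext => x; rewrite -(image_inj f_inj) -(generated_image fM) imE// -GS -fG.
  by apply/propext; split=> // _; exists x.
have freeh : free_group (f @^-1` F).
  by exists (f @^-1` B); apply/(free_basis_image fM f_inj); rewrite !imE.
have indh : has_index [set: hT] (f @^-1` F) n.
  have tE i : exists y, f y = t i.
    by have : G (t i) := tG i; rewrite -fG => -[y _ yx]; exists y.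
  have [t' t'P] := choice tE; exists t'; split=> // g _.
  have [|i [Fi H]] := tP (f g); first by rewrite -fG; exists g.
  exists i; split; first by rewrite /preimage /= fM fV t'P.
  by move=> j; rewrite /preimage /= fM fV t'P; exact: H.
have [T HT] := virtually_free_cut_tree fgh freeh (ex_intro _ n indh).
have sF' : subgroup (f @^-1` F).
  split; first by rewrite /preimage /= f1; exact: subgroup1.
  by move=> x y; rewrite /preimage /= fM fV; exact: sF.2.
have [B' KB'] : free_group (f @^-1` K).
  apply: (free_action_free HT).
  - split; first by rewrite /preimage /= f1; exact: subgroup1.
    by move=> x y; rewrite /preimage /= fM fV; exact: sK.2.
  - move=> k v Kk k1 Hv kv.
    have [t' [_ t'P]] := indh.
    have [j|N N0 FN] := @finite_index_power _ (f @^-1` F) n t' k sF'.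
      by have [//|i [Fi _]] := t'P (k ^+ j); exists i.
    have kN v' : vact k v' = v' -> forall j, vact (k ^+ j) v' = v'.
      move=> kv'; elim=> [|j IH]; first by rewrite expg0 vact1.
      by rewrite expgS vactM IH.
    apply: (vertex_free HT FN _ Hv (kN v kv N)) => kN1.
    apply: k1; apply: f_inj; rewrite f1; apply: (@K_tf _ N) => //.
    by rewrite -fX kN1 f1.
  - move=> k Kk kk; apply: f_inj; rewrite f1; apply: (@K_tf _ 2) => //.
    by rewrite -fX expg2 kk f1.
exists (f @` B'); have := (free_basis_image fM f_inj _ _).2 KB'.
by rewrite imE// => g [].
Qed.

End CircleGroups.

(** * Analytic functions of a real variable *)

Section Analytic.
Local Open Scope ring_scope.
Variable R : realType.
Implicit Types (F G : R -> R) (a b : nat -> R) (x y h r : R).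

Definition expansion F x a r : Prop :=
  0 < r /\ forall h, `|h| < r -> pseries a h @ \oo --> F (x + h).

Definition analytic_at F x : Prop := exists a r, expansion F x a r.

Lemma pseriesE a h n : pseries a h n = \sum_(i < n) a i * h ^+ i.
Proof. by rewrite /pseries /series /= big_mkord. Qed.

(** On a smaller disc the convergence is absolute. *)
Lemma analytic_at_bounded F x : analytic_at F x -> exists a r (A : R),
  [/\ 0 < r, forall h, `|h| <= r -> pseries a h @ \oo --> F (x + h)
    & forall n, \sum_(i < n) `|a i| * r ^+ i <= A].
Proof.
move=> [a [r [r0 H]]]; exists a, (r / 2), (limn (pseries (fun i => `|a i|) (r / 2))).
have r20 : 0 < r / 2 by rewrite divr_gt0.
split=> // [h hr|n].
  by apply: H; rewrite (le_lt_trans hr)// ltr_pdivrMr// mulr_natr mulr2n ltrDl.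
rewrite -(pseriesE (fun i => `|a i|)).
have c : cvgn (pseries (fun i => `|a i|) (r / 2)).
  apply: (@is_cvg_pseries_inside_norm _ _ (r * (3 / 4))); last first.
    by rewrite !gtr0_norm ?mulr_gt0 ?divr_gt0//; lra.
  apply/cvg_ex; exists (F (x + r * (3 / 4))); apply: H.
  by rewrite gtr0_norm ?mulr_gt0 ?divr_gt0//; lra.
apply: nondecreasing_cvgn_le => //.
apply: (@nondecreasing_series _ _ xpredT) => i _ _.
by rewrite mulr_ge0// exprn_ge0// ltW.
Qed.

Lemma expansion0 F x a : pseries a 0 @ \oo --> F x -> a 0%N = F x.
Proof.
move=> H; apply/esym/(cvg_unique _ H) => //; last first.
  apply: cvg_near_cst; exists 1%N => // n /= n1; rewrite pseriesE.
  case: n n1 => // n _; rewrite big_ord_recl expr0 mulr1 big1 ?addr0// => i _.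
  by rewrite /= expr0n mulr0.
Qed.

Lemma coef_expn_agree (p q : {poly R}) n k : (forall i, (i <= n)%N -> p`_i = q`_i) ->
  forall j, (j <= n)%N -> (p ^+ k)`_j = (q ^+ k)`_j.
Proof.
move=> pq; elim: k => [|k IH] j jn; first by rewrite !expr0.
rewrite !exprS !coefM; apply: eq_bigr => i _.
have ij : (i <= j)%N by rewrite -ltnS.
by rewrite pq ?IH//; lia.
Qed.

Lemma coef_expn_low (p : {poly R}) n k : p`_0 = 0 -> (n < k)%N -> (p ^+ k)`_n = 0.
Proof.
move=> p0; elim: k n => // k IH n nk; rewrite exprS coefM big1// => -[[|i] /= lt] _.
  by rewrite p0 mul0r.
by rewrite IH ?mulr0//; lia.
Qed.

Lemma coef_expn_norm (p q : {poly R}) k : (forall i, `|p`_i| <= q`_i) ->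
  forall n, `|(p ^+ k)`_n| <= (q ^+ k)`_n.
Proof.
move=> pq; elim: k => [|k IH] n; first by rewrite !expr0 coef1; case: eqP; rewrite ?normr1 ?normr0.
rewrite !exprS !coefM (le_trans (ler_norm_sum _ _ _))//.
by apply: ler_sum => i _; rewrite normrM ler_pM.
Qed.

Lemma powers_diff k x y r : `|x| <= r -> `|y| <= r ->
  `|x ^+ k - y ^+ k| <= k%:R * r ^+ k.-1 * `|x - y|.
Proof.
move=> xr yr; case: k => [|k]; first by rewrite !expr0 subrr normr0 !mul0r.
rewrite subrXX normrM mulrC ler_wpM2r//= (le_trans (ler_norm_sum _ _ _))//.
have -> : k.+1%:R * r ^+ k = \sum_(i < k.+1) r ^+ k.
  by rewrite sumr_const card_ord mulr_natl.
apply: ler_sum => i _; rewrite normrM !normrX.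
have -> : r ^+ k = r ^+ (k.+1.-1 - i) * r ^+ i.
  by rewrite -exprD subnK// -ltnS.
by apply: ler_pM; rewrite ?exprn_ge0// lerXn2r// ?nnegrE ?(le_trans _ xr).
Qed.

Lemma cvg_close (f g e : nat -> R) (l : R) : (forall n, `|f n - g n| <= e n) ->
  e @ \oo --> 0 -> g @ \oo --> l -> f @ \oo --> l.
Proof.
move=> fge e0 gl; have -> : f = (fun n => (f n - g n) + g n) by apply/funext => n; rewrite subrK.
rewrite -[l]add0r; apply: cvgD gl; apply/norm_cvg0P.
apply: (@squeeze_cvgr _ _ _ _ (cst 0) e) => //; last exact: cvg_cst.
by apply: nearW => n; rewrite normr_ge0 fge.
Qed.

Section Composition.
Variables (F G : R -> R) (x : R).
Variables (a b : nat -> R) (r s A B : R).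
Hypothesis r0 : 0 < r.
Hypothesis s0 : 0 < s.
Hypothesis aF : forall h, `|h| <= r -> pseries a h @ \oo --> F (G x + h).
Hypothesis bG : forall h, `|h| <= s -> pseries b h @ \oo --> G (x + h).
Hypothesis aA : forall n, \sum_(i < n) `|a i| * r ^+ i <= A.
Hypothesis bB : forall n, \sum_(i < n) `|b i| * s ^+ i <= B.

Let P N : {poly R} := \poly_(i < N) (if i == 0%N then 0 else b i).
Let Pn N : {poly R} := \poly_(i < N) (if i == 0%N then 0 else `|b i|).

(** Coefficients of the composite series: since [P N] has no constant term, the
    power [k] contributes only to the coefficients from [k] on. *)
Let c n : R := \sum_(k < n.+1) a k * (P n.+1 ^+ k)`_n.

Let cE N h : \sum_(n < N) c n * h ^+ n =
  \sum_(k < N) a k * (\sum_(n < N) (P N ^+ k)`_n * h ^+ n).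
Proof.
have E (n : 'I_N) : c n * h ^+ n = \sum_(k < N) a k * (P N ^+ k)`_n * h ^+ n.
  rewrite -mulr_suml; congr (_ * _).
  transitivity (\sum_(k < N | (k < n.+1)%N) a k * (P n.+1 ^+ k)`_n).
    exact: (big_ord_widen N (fun k => a k * (P n.+1 ^+ k)`_n) (ltn_ord n)).
  rewrite [RHS](bigID (fun k : 'I_N => (k < n.+1)%N))/= [X in _ + X]big1 ?addr0 => [|k nk].
    apply: eq_bigr => k _; congr (_ * _).
    apply: (@coef_expn_agree _ _ n) => // i lin.
    by rewrite !coef_poly ltnS lin (leq_ltn_trans lin (ltn_ord n)).
  rewrite coef_expn_low ?mulr0//; first by rewrite coef_poly if_same.
  by rewrite ltnNge -ltnS.
rewrite (eq_bigr _ (fun n _ => E n)) exchange_big/=; apply: eq_bigr => k _.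
by rewrite mulr_sumr; apply: eq_bigr => n _; rewrite mulrA.
Qed.

(** The radius [t] is chosen so that the series of absolute values of [b] without
    its constant term is at most [r / 2] at [t]; every step of the rearrangement
    is then controlled by [A].  At the radius [t / 2] the terms of degree at least
    [N] of the powers of [P N], which the partial sum of the composite series
    leaves out, carry an additional factor [2^-N]. *)
Lemma composition_expansion : exists t, 0 < t /\
  forall h, `|h| < t -> pseries c h @ \oo --> F (G (x + h)).
Proof.
have B0 : 0 <= B by have := bB 0; rewrite big_ord0.
have A0 : 0 <= A by have := aA 0; rewrite big_ord0.
pose t := s * (r / 2) / (r / 2 + B).
have r20 : 0 < r / 2 by rewrite divr_gt0.
have rB : 0 < r / 2 + B by rewrite ltr_wpDr.
have t0 : 0 < t by rewrite divr_gt0// mulr_gt0.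
have ts : t <= s by rewrite ler_pdivrMr// ler_pM2l// lerDl.
have Pnt N : (Pn N).[t] <= r / 2.
  have : (Pn N).[t] <= t / s * B.
    rewrite (horner_coef_wide _ (size_poly _ _)) (le_trans _ (ler_wpM2l _ (bB N)))//; last first.
      by rewrite divr_ge0// ltW.
    rewrite mulr_sumr; apply: ler_sum => -[i /= iN] _; rewrite coef_poly iN.
    case: i iN => [|i] iN; first by rewrite mul0r !mulr_ge0// ?invr_ge0 ltW.
    have tsi : t ^+ i <= s ^+ i by rewrite lerXn2r// nnegrE ltW.
    rewrite /= mulrCA ler_wpM2l// !exprS [leRHS]mulrA divfK ?gt_eqF//.
    by rewrite ler_wpM2l// ltW.
  move=> /le_trans; apply.
  have -> : t / s = (r / 2) / (r / 2 + B) by rewrite /t mulrC !mulrA mulVf ?gt_eqF// mul1r.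
  by rewrite mulrAC ler_pdivrMr// ler_pM2l// lerDr ltW.
exists (t / 2); split=> [|h ht]; first by rewrite divr_gt0.
have ht' : `|h| <= t / 2 by exact: ltW.
have PnN N i : `|(P N)`_i| <= (Pn N)`_i.
  by rewrite !coef_poly; case: ifP => _; [case: ifP|]; rewrite ?normr0.
have Pnk N k i : 0 <= (Pn N ^+ k)`_i by apply: le_trans (coef_expn_norm k (PnN N) i).
have hornerPn N k M : \sum_(n < M) (Pn N ^+ k)`_n * t ^+ n <= (r / 2) ^+ k.
  have le1 : \sum_(n < M) (Pn N ^+ k)`_n * t ^+ n <= (Pn N ^+ k).[t].
    pose M' := maxn M (size (Pn N ^+ k)).
    rewrite (@horner_coef_wide _ M') ?leq_maxr//.
    rewrite (big_ord_widen M' (fun n => (Pn N ^+ k)`_n * t ^+ n)) ?leq_maxl//.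
    rewrite [leRHS](bigID (fun n : 'I_M' => (n < M)%N))/= lerDl.
    by apply: sumr_ge0 => i _; rewrite mulr_ge0// exprn_ge0// ltW.
  apply: le_trans le1 _; rewrite horner_exp lerXn2r ?nnegrE//; last by rewrite ltW// divr_gt0.
  rewrite horner_coef; apply: sumr_ge0 => i _; have := Pnk N 1%N i; rewrite expr1 => p0.
  by rewrite mulr_ge0// exprn_ge0// ltW.
pose u := G (x + h) - G x.
have hs : `|h| <= s by rewrite (le_trans ht')// (le_trans _ ts)// ler_pdivrMr//; lra.
have b0 : b 0%N = G x.
  by apply: expansion0; have := @bG 0; rewrite normr0 addr0; apply; exact: ltW.
have Pu : (fun N => (P N).[h]) @ \oo --> u.
  have -> : (fun N => (P N).[h]) = (fun N => pseries b h N - (if N == 0%N then 0 else b 0%N)).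
    apply/funext => N; rewrite pseriesE (horner_coef_wide _ (size_poly _ _)).
    case: N => [|N]; first by rewrite !big_ord0 subr0.
    rewrite !big_ord_recl /= coef_poly/= mul0r add0r expr0 mulr1 addrAC subrr add0r.
    by apply: eq_bigr => i _; rewrite coef_poly /= /bump leq0n /= add1n ltnS ltn_ord.
  apply: cvgB; first exact: bG.
  by rewrite -b0; apply: cvg_near_cst; exists 1%N => // -[].
have PN N : `|(P N).[h]| <= r / 2.
  have := hornerPn N 1%N N; rewrite !expr1 => H.
  apply: le_trans H; rewrite (horner_coef_wide _ (size_poly _ _)).
  rewrite (le_trans (ler_norm_sum _ _ _))//; apply: ler_sum => i _.
  rewrite normrM normrX ler_pM ?exprn_ge0//; first exact: PnN.
  by rewrite lerXn2r// ?nnegrE ?ltW// (lt_trans ht)// ltr_pdivrMr//; lra.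
have ur : `|u| <= r / 2.
  rewrite -(cvg_lim (@Rhausdorff R) (cvg_norm Pu)); apply: limr_le.
    exact: cvgP (cvg_norm Pu).
  exact: nearW.
(* The partial sums of the composite series are compared with the partial sums
   of [a] at the truncations of the inner series, and these with the partial
   sums of [a] at its limit [u]. *)
pose S N := \sum_(k < N) a k * (P N).[h] ^+ k.
have cS N : `|pseries c h N - S N| <= (2^-1) ^+ N * A.
  rewrite pseriesE cE /S -sumrB (le_trans (ler_norm_sum _ _ _))//.
  rewrite (le_trans _ (ler_wpM2l _ (aA N))) ?exprn_ge0// mulr_sumr; apply: ler_sum => k _.
  rewrite -mulrBr normrM mulrCA ler_wpM2l// -horner_exp.
  pose M := maxn N (size (P N ^+ k)).
  rewrite (@horner_coef_wide _ M) ?leq_maxr//.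
  rewrite (big_ord_widen M (fun n => (P N ^+ k)`_n * h ^+ n)) ?leq_maxl//.
  rewrite [X in _ - X](bigID (fun n : 'I_M => (n < N)%N))/= opprD addrA subrr add0r normrN.
  rewrite (le_trans (ler_norm_sum _ _ _))//.
  have rk : (r / 2) ^+ k <= r ^+ k by rewrite lerXn2r ?nnegrE//; lra.
  rewrite (le_trans _ (ler_wpM2l _ (le_trans (hornerPn N k M) rk))) ?exprn_ge0//.
  rewrite mulr_sumr [leRHS](bigID (fun n : 'I_M => (n < N)%N))/= ler_wpDl//.
    by apply: sumr_ge0 => i _; rewrite !mulr_ge0 ?exprn_ge0// ltW.
  apply: ler_sum => i; rewrite -leqNgt => Ni.
  rewrite normrM normrX mulrCA ler_pM ?exprn_ge0//; first exact: coef_expn_norm.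
  apply: (@le_trans _ _ ((t / 2) ^+ i)); first by rewrite lerXn2r ?nnegrE//; lra.
  rewrite exprMn mulrC ler_pM2r ?exprn_gt0//.
  by rewrite ler_wiXn2l ?invr_ge0 ?invf_le1// ler1n.
have Su N : `|S N - \sum_(k < N) a k * u ^+ k| <= 2 / r * A * `|(P N).[h] - u|.
  rewrite /S -sumrB (le_trans (ler_norm_sum _ _ _))//.
  rewrite mulrAC (le_trans _ (ler_wpM2l _ (aA N)))//; last first.
    by rewrite mulr_ge0// divr_ge0// ltW.
  rewrite mulr_sumr; apply: ler_sum => k _.
  rewrite -mulrBr normrM mulrCA ler_wpM2l//.
  apply: le_trans (powers_diff k (PN N) ur) _.
  rewrite [leRHS]mulrAC ler_wpM2r//.
  case: (nat_of_ord k) => [|j]; first by rewrite mul0r mulr_ge0 ?exprn_ge0 ?divr_ge0// ltW.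
  rewrite /= expr_div_n exprS [leRHS]mulrA divfK ?gt_eqF// mulrCA [leRHS]mulrC ler_pM2l ?exprn_gt0//.
  rewrite ler_pdivrMr ?exprn_gt0// -exprS -natrX ler_nat ltnW//; exact: ltn_expl.
have Fu : (fun N => \sum_(k < N) a k * u ^+ k) @ \oo --> F (G (x + h)).
  have -> : G (x + h) = G x + u by rewrite /u; ring.
  have := @aF u; rewrite (_ : pseries a u = (fun N => \sum_(k < N) a k * u ^+ k)).
    by apply; rewrite (le_trans ur)//; lra.
  by apply/funext => N; rewrite pseriesE.
apply: (cvg_close cS).
  rewrite -(mul0r A); apply: cvgM; last exact: cvg_cst.
  by apply: cvg_expr; rewrite ger0_norm ?invr_ge0// invf_lt1 ?ltr1n.
apply: (cvg_close Su _ Fu).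
rewrite -(mulr0 (2 / r * A)); apply: cvgM; first exact: cvg_cst.
apply/norm_cvg0P; rewrite -(subrr u); apply: cvgB => //; exact: cvg_cst.
Qed.

End Composition.

Lemma analytic_at_comp F G x :
  analytic_at G x -> analytic_at F (G x) -> analytic_at (F \o G) x.
Proof.
move=> /analytic_at_bounded[b [s [B [s0 bG bB]]]].
move=> /analytic_at_bounded[a [r [A [r0 aF aA]]]].
have [t [t0 H]] := composition_expansion r0 s0 aF bG aA bB.
by eexists; exists t; split=> // h /H; exact.
Qed.

Lemma analytic_at_linear F G x (k l : R) : analytic_at F x -> analytic_at G x ->
  analytic_at (fun y => k * F y + l * G y) x.
Proof.
move=> [a [r [r0 aF]]] [b [s [s0 bG]]].
exists (fun n => k * a n + l * b n), (Num.min r s); split=> [|h].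
  by rewrite lt_min r0 s0.
rewrite lt_min => /andP[hr hs].
have -> : pseries (fun n => k * a n + l * b n) h =
    (fun n => k * pseries a h n + l * pseries b h n).
  apply/funext => n; rewrite !pseriesE !mulr_sumr -big_split /=; apply: eq_bigr => i _; ring.
by apply: cvgD; (apply: cvgM; [exact: cvg_cst|]); [exact: aF|exact: bG].
Qed.

Lemma analytic_at_poly (p : {poly R}) x : analytic_at (horner p) x.
Proof.
pose q := p \Po ('X + x%:P); exists (fun n => q`_n), 1; split=> // h _.
have -> : p.[x + h] = q.[h] by rewrite /q horner_comp !hornerE addrC.
apply: cvg_near_cst; exists (size q) => // n /= qn.
by rewrite pseriesE -horner_coef_wide.
Qed.

(** The geometric series. *)
Lemma analytic_at_inv x : x != 0 -> analytic_at GRing.inv x.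
Proof.
move=> x0; exists (fun n => x^-1 * (- x^-1) ^+ n), `|x|; split=> [|h hx].
  by rewrite normr_gt0.
have q1 : `|- (h / x)| < 1 by rewrite normrN normrM normfV ltr_pdivrMr ?normr_gt0// mul1r.
have := @cvg_geometric_series R x^-1 _ q1.
have xh : x + h != 0.
  by apply/eqP => /(congr1 (fun z => z - x)); rewrite addrC addKr sub0r => E;
    move: hx; rewrite E normrN ltxx.
have -> : x^-1 / (1 - - (h / x)) = (x + h)^-1.
  by rewrite opprK -invfM mulrDr mulr1 [x * _]mulrC divfK.
have -> // : pseries (fun n => x^-1 * (- x^-1) ^+ n) h = series (geometric x^-1 (- (h / x))).
apply/funext => n; rewrite pseriesE /series /= big_mkord; apply: eq_bigr => i _.
by rewrite -mulrA -exprMn mulNr [h / x]mulrC.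
Qed.

Lemma eq_analytic_at F G x : F =1 G -> analytic_at F x -> analytic_at G x.
Proof. by move=> /funext->. Qed.

Lemma analytic_atD F G x :
  analytic_at F x -> analytic_at G x -> analytic_at (fun y => F y + G y) x.
Proof.
move=> aF aG; apply: eq_analytic_at (analytic_at_linear 1 1 aF aG) => y.
by rewrite !mul1r.
Qed.

Lemma analytic_at_sqr F x : analytic_at F x -> analytic_at (fun y => F y ^+ 2) x.
Proof.
move=> aF; apply: eq_analytic_at (analytic_at_comp aF (analytic_at_poly 'X^2 _)) => y.
by rewrite /= hornerXn.
Qed.

(** Polarization reduces products to squares, which are compositions. *)
Lemma analytic_atM F G x :
  analytic_at F x -> analytic_at G x -> analytic_at (fun y => F y * G y) x.
Proof.
move=> aF aG; have a1 := analytic_at_sqr (analytic_at_linear 1 1 aF aG).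
have a2 := analytic_at_sqr (analytic_at_linear 1 (-1) aF aG).
apply: eq_analytic_at (analytic_at_linear (4^-1) (- 4^-1) a1 a2) => y.
by field.
Qed.

Lemma analytic_at_cst (k x : R) : analytic_at (fun=> k) x.
Proof. by apply: eq_analytic_at (analytic_at_poly k%:P x) => y; rewrite hornerC. Qed.

Lemma analytic_at_affine (k l x : R) : analytic_at (fun y => k * y + l) x.
Proof.
apply: eq_analytic_at (analytic_at_poly (k *: 'X + l%:P) x) => y.
by rewrite !hornerE.
Qed.

Lemma analytic_at_sin x : analytic_at (@sin R) x.
Proof.
pose s n : R := (odd n)%:R * (-1) ^+ n.-1./2 * (n`!%:R)^-1.
pose c n : R := (~~ odd n)%:R * (-1) ^+ n./2 * (n`!%:R)^-1.
have aS h : pseries s h @ \oo --> sin h.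
  rewrite unlock; have := @is_cvg_series_sin_coeff R h.
  by rewrite sin_coeffE.
have aC h : pseries c h @ \oo --> cos h.
  rewrite unlock; have := @is_cvg_series_cos_coeff R h.
  by rewrite cos_coeffE.
exists (fun n => sin x * c n + cos x * s n), 1; split=> // h _; rewrite sinD.
have -> : pseries (fun n => sin x * c n + cos x * s n) h =
    (fun n => sin x * pseries c h n + cos x * pseries s h n).
  apply/funext => n; rewrite !pseriesE !mulr_sumr -big_split /=; apply: eq_bigr => i _; ring.
by apply: cvgD; (apply: cvgM; [exact: cvg_cst|]).
Qed.

Lemma analytic_at_cos x : analytic_at (@cos R) x.
Proof.
have a1 := analytic_at_affine 1 (pi / 2) x.
apply: eq_analytic_at (analytic_at_comp a1 (analytic_at_sin _)) => y.
by rewrite /= mul1r sinDpihalf.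
Qed.

Lemma derive_lipschitz (f df : R -> R) (x y M : R) : x <= y ->
  (forall z, x <= z <= y -> is_derive z 1 f (df z)) ->
  (forall z, x <= z <= y -> `|df z| <= M) -> `|f y - f x| <= M * (y - x).
Proof.
move=> xy fdf dfM.
have cf : {within `[x, y], continuous f}.
  apply: derivable_within_continuous => z; rewrite in_itv /= => /fdf h.
  exact: ex_derive.
have [|c + ->] := @MVT_segment R f df x y xy _ cf.
  by move=> z; rewrite in_itv /= => /andP[/ltW xz /ltW zy]; apply: fdf; rewrite xz zy.
rewrite in_itv /= => cI; rewrite normrM [X in _ * X]ger0_norm ?subr_ge0//.
by rewrite ler_wpM2r ?subr_ge0// dfM.
Qed.

(** Integrate the series term by term: the derivative of the difference between
    the function and a partial sum is a tail of the given series. *)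
Lemma analytic_at_antiderivative (F f : R -> R) x :
  (forall y, is_derive y 1 F (f y)) -> analytic_at f x -> analytic_at F x.
Proof.
move=> Ff /analytic_at_bounded[a [r [A [r0 af aA]]]].
pose A' n := \sum_(i < n) `|a i| * r ^+ i.
have A'mono : nondecreasing_seq A'.
  by apply/nondecreasing_seqP => n; rewrite /A' big_ord_recr /= lerDl mulr_ge0// exprn_ge0// ltW.
have cA : cvgn A'.
  by apply: nondecreasing_is_cvgn => //; exists A => _ [n _ <-]; exact: aA.
pose tail n := limn A' - A' n.
have tail0 : tail @ \oo --> 0.
  by rewrite -(subrr (limn A')); apply: cvgB => //; exact: cvg_cst.
have tailP s n : `|s| <= r -> `|f (x + s) - \sum_(i < n) a i * s ^+ i| <= tail n.
  move=> sr; have afs := af s sr.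
  have cvs : (fun m => `|pseries a s m - \sum_(i < n) a i * s ^+ i|) @ \oo -->
      `|f (x + s) - \sum_(i < n) a i * s ^+ i|.
    by apply: cvg_norm; apply: cvgB => //; exact: cvg_cst.
  rewrite -(cvg_lim (@Rhausdorff R) cvs); apply: limr_le; first exact: cvgP cvs.
  exists n => // m /= nm; rewrite pseriesE.
  have split_sum (u : nat -> R) : \sum_(i < m) u i - \sum_(i < n) u i =
      \sum_(i < m | (n <= i)%N) u i.
    rewrite (big_ord_widen m u nm) (bigID (fun i : 'I_m => (i < n)%N))/= addrAC subrr add0r.
    by apply: eq_bigl => i; rewrite -leqNgt.
  rewrite (split_sum (fun i => a i * s ^+ i)) (le_trans (ler_norm_sum _ _ _))//.
  have : A' m - A' n <= tail n by rewrite lerD2r; exact: nondecreasing_cvgn_le.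
  apply: le_trans; rewrite /A' (split_sum (fun i => `|a i| * r ^+ i)).
  apply: ler_sum => i _; rewrite normrM normrX ler_wpM2l// lerXn2r// nnegrE//.
  exact: ltW.
pose b n := if n is k.+1 then a k / k.+1%:R else F x.
exists b, r; split=> // h hr.
have key n : `|pseries b h n.+1 - F (x + h)| <= tail n * `|h|.
  pose q : {poly R} := \poly_(i < n.+1) b i.
  have dq s : q^`().[s] = \sum_(i < n) a i * s ^+ i.
    have -> : q^`() = \poly_(i < n) a i.
      apply/polyP => i; rewrite coef_deriv !coef_poly ltnS; case: ifP => _; rewrite ?mul0rn//.
      by rewrite /b /= -[LHS]mulr_natr divfK// pnatr_eq0.
    by rewrite (horner_coef_wide _ (size_poly _ _)); apply: eq_bigr => i _; rewrite coef_poly ltn_ord.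
  have q0 : q.[0] = F x by rewrite horner_coef0 coef_poly.
  have qh : pseries b h n.+1 = q.[h].
    rewrite pseriesE (horner_coef_wide _ (size_poly _ _)).
    by apply: eq_bigr => i _; rewrite coef_poly ltn_ord.
  pose g s := F (s + x) - q.[s].
  pose dg s := f (s + x) - \sum_(i < n) a i * s ^+ i.
  have gdg (s : R) : is_derive s 1 g (dg s).
    rewrite /g /dg -dq; apply: is_deriveB.
    have -> : f (s + x) = f (s + x) * 1 by rewrite mulr1.
    apply: (@is_derive1_comp _ F (fun s => s + x)).
    exact: is_derive_shift.
  have bg s : `|s| <= `|h| -> `|dg s| <= tail n.
    by move=> sh; rewrite /dg [s + x]addrC; apply: tailP; rewrite (le_trans sh)// ltW.
  have -> : `|pseries b h n.+1 - F (x + h)| = `|g h - g 0|.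
    by rewrite /g qh q0 add0r subrr subr0 [h + x]addrC distrC.
  have [h0|h0] := leP 0 h.
    rewrite [X in _ * X](_ : _ = h - 0); last by rewrite ger0_norm// subr0.
    apply: derive_lipschitz => // z /andP[z0 zh]; apply: bg.
    by rewrite !ger0_norm.
  rewrite [X in _ * X](_ : _ = 0 - h); last by rewrite ltr0_norm// sub0r.
  rewrite distrC; apply: derive_lipschitz => [|z /andP[z0 zh]]; first exact: ltW.
  by apply: bg; rewrite ler0_norm// ltr0_norm// lerN2.
rewrite -cvg_shiftS; apply: (cvg_close key); last exact: cvg_cst.
by rewrite -(mul0r `|h|); apply: cvgM => //; exact: cvg_cst.
Qed.

Lemma analytic_at_atan x : analytic_at (@atan R) x.
Proof.
apply: (analytic_at_antiderivative (fun y => is_derive1_atan y)).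
have a1 := analytic_atD (analytic_at_cst 1 x) (analytic_at_poly 'X^2 x).
have : 1 + ('X^2 : {poly R}).[x] != 0 by rewrite hornerXn gt_eqF// ltr_wpDr// sqr_ge0.
move=> /analytic_at_inv /(analytic_at_comp a1); apply: eq_analytic_at => y.
by rewrite /= hornerXn.
Qed.

End Analytic.

(** * Half turns *)

Section HalfTurn.
Local Open Scope ring_scope.
Variables (R : realType) (l : R).
Hypothesis l01 : 0 < l < 1.
Implicit Types x y z : R.

Let S x : R := sin (pi * x).
Let C x : R := cos (pi * x).
Let den x := S x * S x + l * (C x * C x).
Let slope x := (1 - l) * (S x * C x) * (den x)^-1.

Let l0 : 0 < l. Proof. by case/andP: l01. Qed.
Let l1 : l < 1. Proof. by case/andP: l01. Qed.

Let SC x : S x * S x + C x * C x = 1.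
Proof. by rewrite addrC -!expr2 cos2Dsin2. Qed.

Let den_gt0 x : 0 < den x.
Proof.
have : 0 <= S x * S x by rewrite -expr2 sqr_ge0.
have := SC x; rewrite /den; set s := S x * S x; set c := C x * C x => sc s0.
have -> : s = 1 - c by rewrite -sc addrK.
have : l * (1 - c) <= 1 - c by rewrite ler_piMl ?(ltW l1)//; lra.
by have := l0; lra.
Qed.

(** A lift to the line of the circle map induced by the projective map
    [tan (pi x) -> - l / tan (pi x)], which exchanges 0 and 1/2. *)
Definition half_turn_fun x : R := x - 1 / 2 + atan (slope x) / pi.

Let pi0 : (pi : R) != 0. Proof. by rewrite gt_eqF// pi_gt0. Qed.

Lemma half_turn_period x : half_turn_fun (x + 1) = half_turn_fun x + 1.
Proof.
have SE : S (x + 1) = - S x by rewrite /S mulrDr mulr1 sinDpi.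
have CE : C (x + 1) = - C x by rewrite /C mulrDr mulr1 cosDpi.
by rewrite /half_turn_fun /slope /den SE CE !mulrNN; ring.
Qed.

Let den2 x := S x * S x + l * l * (C x * C x).

Let den2_gt0 x : 0 < den2 x.
Proof.
have : 0 <= S x * S x by rewrite -expr2 sqr_ge0.
have := SC x; rewrite /den2; set s := S x * S x; set c := C x * C x => sc s0.
have -> : s = 1 - c by rewrite -sc addrK.
have ll : l * l <= 1 by rewrite mulr_ile1 ?ltW.
have : l * l * (1 - c) <= 1 - c by rewrite ler_piMl//; lra.
have : 0 < l * l by rewrite mulr_gt0.
lra.
Qed.

Lemma half_turn_derive x : is_derive x 1 half_turn_fun (l / den2 x).
Proof.
have dpi : is_derive x 1 (fun y => pi * y) pi.
  have := is_deriveZ pi (is_derive_id x 1) ; rewrite /GRing.scale /= mulr1.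
  exact.
have dS : is_derive x 1 S (C x * pi).
  exact: (@is_derive1_comp R (@sin R) (fun y => pi * y)).
have dC : is_derive x 1 C (- S x * pi).
  exact: (@is_derive1_comp R (@cos R) (fun y => pi * y)).
have dSC : is_derive x 1 (fun y => (1 - l) * (S y * C y))
    ((1 - l) * (C x * C x - S x * S x) * pi).
  have h := is_deriveZ (1 - l) (is_deriveM dS dC).
  by apply: (is_derive_eq h); rewrite /GRing.scale /=; ring.
have dden : is_derive x 1 den (2 * (1 - l) * (S x * C x) * pi).
  have h := is_deriveD (is_deriveM dS dS) (is_deriveZ l (is_deriveM dC dC)).
  by apply: (is_derive_eq h); rewrite /GRing.scale /=; ring.
have den0 : den x != 0 by rewrite gt_eqF.
have dV : is_derive x 1 (fun y => (den y)^-1) (- (2 * (1 - l) * (S x * C x) * pi) / (den x * den x)).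
  have := @deriveV _ _ den x 1 den0; have [dd dE] := dden; rewrite dE => /(_ dd) E.
  apply: DeriveDef; first exact: derivableV.
  by rewrite E /GRing.scale /= expr2 invfM; ring.
have dslope : is_derive x 1 slope ((1 - l) * pi * (l * (C x * C x) - S x * S x) / (den x * den x)).
  have h := is_deriveM dSC dV; apply: (is_derive_eq h).
  have key : l * (C x * C x) - S x * S x =
      (C x * C x - S x * S x) * den x - 2 * (1 - l) * (S x * C x) * (S x * C x).
    by rewrite -[LHS]mulr1 -[X in _ * X = _](SC x) /den; ring.
  by rewrite key /GRing.scale /=; move: den0; rewrite /den => d0; field.
have datan : is_derive x 1 (atan \o slope)
   ((1 + slope x ^+ 2)^-1 * ((1 - l) * pi * (l * (C x * C x) - S x * S x) / (den x * den x))).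
  exact: is_derive1_comp.
have h := is_deriveD (is_deriveB (is_derive_id x 1) (is_derive_cst (1/2 : R) x 1))
  (is_deriveM datan (is_derive_cst (pi^-1 : R) x 1)).
apply: (is_derive_eq h).
have d20 : den2 x != 0 by rewrite gt_eqF.
have key : 1 + slope x ^+ 2 = den2 x / (den x * den x).
  have -> : den2 x = den x * den x + (1 - l) * (1 - l) * (S x * C x) * (S x * C x).
    rewrite -[LHS]mulr1 -[X in _ * X = _](SC x) /den2 /den; ring.
  by rewrite /slope; field.
have key2 : l = den2 x + (1 - l) * (l * (C x * C x) - S x * S x).
  by rewrite -[LHS]mulr1 -[X in _ * X = _](SC x) /den2; ring.
rewrite key /GRing.scale /=; move: (den2 x) d20 key2 => D d20 key2.
transitivity ((D + (1 - l) * (l * (C x * C x) - S x * S x)) / D); last by rewrite -key2.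
clearbody den; move: (pi : R) pi0 => q q0; field.
by rewrite den0 d20.
Qed.

Lemma half_turn_gt0 x : 0 < l / den2 x. Proof. by rewrite divr_gt0. Qed.

Lemma half_turn_incr : {homo half_turn_fun : x y / x < y}.
Proof.
move=> x y xy.
have cf : {within `[x, y], continuous half_turn_fun}.
  by apply: derivable_within_continuous => z _; have := half_turn_derive z => h; exact: ex_derive.
have [c _ E] := MVT xy (fun z _ => half_turn_derive z) cf.
by rewrite -subr_gt0 E mulr_gt0 ?subr_gt0// half_turn_gt0.
Qed.

(** The matrix of the projective map has trace 0, so its square is scalar. *)
Lemma half_turn_twice x : half_turn_fun (half_turn_fun x) = x - 1.
Proof.
set y := half_turn_fun x; pose al := atan (slope x).
have ca : 0 < cos al by apply: cos_gt0_pihalf; rewrite atan_gtNpi2 atan_ltpi2.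
have sa : sin al = slope x * cos al.
  by have := atanK (slope x); rewrite /tan -/al => <-; rewrite divfK// gt_eqF.
have yE : pi * y = pi * x + al - pi / 2.
  by rewrite /y /half_turn_fun -/al; move: (pi : R) pi0 => q q0; field.
have den0 : den x != 0 by rewrite gt_eqF.
have SyE : S y = - (cos al / den x) * (l * C x).
  rewrite {1}/S yE sinBpihalf cosD sa -/(S x) -/(C x) /slope.
  have key : l = den x - (1 - l) * (S x * S x).
    by rewrite -[LHS]mulr1 -[X in _ * X = _](SC x) /den; ring.
  rewrite [in RHS]key; move: (den x) den0 => D D0; clear key; by field.
have CyE : C y = (cos al / den x) * S x.
  rewrite {1}/C yE cosBpihalf sinD sa -/(S x) -/(C x) /slope.
  have key : S x = S x * (den x + (1 - l) * (C x * C x)).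
    by rewrite -[LHS]mulr1 -[X in _ * X = _](SC x) /den; ring.
  rewrite [X in _ = _ * X]key; clear key; move: (den x) den0 => D D0; by field.
have slE : slope y = - slope x.
  have k0 : cos al / den x != 0 by rewrite mulf_neq0 ?invr_eq0// gt_eqF.
  have l0' : l != 0 by rewrite gt_eqF.
  rewrite /slope /den SyE CyE; set k := cos al / den x.
  have -> : - k * (l * C x) * (- k * (l * C x)) + l * (k * S x * (k * S x)) =
      k * k * l * den x by rewrite /den; ring.
  move: k0; rewrite -/k -/(den x); clearbody k => k0; clearbody den; field.
  by rewrite den0 l0' k0.
by rewrite {1}/half_turn_fun slE atanN {1}/y /half_turn_fun; move: (pi : R) pi0 => q q0; field.
Qed.

Lemma half_turn_analytic x : analytic_at half_turn_fun x.
Proof.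
have aP : analytic_at (fun y => pi * y + 0) x by exact: analytic_at_affine.
have aS : analytic_at S x.
  by apply: eq_analytic_at (analytic_at_comp aP (analytic_at_sin _)) => y; rewrite /= addr0.
have aC : analytic_at C x.
  by apply: eq_analytic_at (analytic_at_comp aP (analytic_at_cos _)) => y; rewrite /= addr0.
have aD : analytic_at den x.
  by apply: eq_analytic_at (analytic_at_linear 1 l (analytic_atM aS aS) (analytic_atM aC aC)) => y;
    rewrite mul1r.
have d0 : den x != 0 by rewrite gt_eqF.
have aV := analytic_at_comp aD (analytic_at_inv d0).
have asl : analytic_at slope x.
  by apply: eq_analytic_at (analytic_atM (analytic_atM (analytic_at_cst (1 - l) x)
    (analytic_atM aS aC)) aV).
have aA := analytic_at_comp asl (analytic_at_atan _).
apply: eq_analytic_at (analytic_at_linear 1 (pi^-1) (analytic_at_affine 1 (- (1 / 2)) x) aA) => y.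
by rewrite /half_turn_fun /=; ring.
Qed.

Lemma half_turn_lipschitz x y : x <= y ->
  half_turn_fun y - half_turn_fun x <= l^-1 * (y - x).
Proof.
move=> xy; apply: le_trans (ler_norm _) _.
apply: (@derive_lipschitz _ half_turn_fun (fun z => l / den2 z) x y) xy _ _ => z _.
  exact: half_turn_derive.
rewrite ger0_norm; last by rewrite ltW// half_turn_gt0.
rewrite ler_pdivrMr// ler_pdivlMl//.
have : 0 <= S z * S z by rewrite -expr2 sqr_ge0.
have := SC z; rewrite /den2; set s := S z * S z; set c := C z * C z => sc s0.
have -> : c = 1 - s by rewrite -sc addrC addKr.
have : l * l * s <= s by rewrite ler_piMl// mulr_ile1 ?ltW.
lra.
Qed.

(** Away from the integers the derivative is at most [l / sin (pi e) ^ 2]. *)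
Lemma half_turn_contract (e x y : R) : 0 < e -> e < 1 / 2 ->
  e <= x -> x <= y -> y <= 1 - e ->
  half_turn_fun y - half_turn_fun x <= l / sin (pi * e) ^+ 2 * (y - x).
Proof.
move=> e0 e12 ex xy ye; apply: le_trans (ler_norm _) _.
apply: (@derive_lipschitz _ half_turn_fun (fun z => l / den2 z) x y) xy _ _ => z /andP[xz zy].
  exact: half_turn_derive.
have se : 0 < sin (pi * e).
  apply: sin_gt0_pi; rewrite mulr_gt0 ?pi_gt0//= gtr_pMr ?pi_gt0//; lra.
rewrite ger0_norm; last by rewrite ltW// half_turn_gt0.
rewrite ler_pM2l// lef_pV2 ?posrE ?exprn_gt0//.
have pos := pi_gt0 R.
have lecos (a b : R) : 0 <= a -> a <= b -> b <= 1 -> cos (pi * b) <= cos (pi * a).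
  move=> a0 ab b1.
  have rng t : 0 <= t -> t <= 1 -> pi * t \in `[0, (pi : R)].
    move=> t0 t1; rewrite in_itv /= mulr_ge0//= ?(ltW pos)//.
    by rewrite -[X in _ <= X]mulr1 ler_pM2l.
  rewrite leNgt ltr_cos ?rng//; [|lra..].
  by rewrite -leNgt ler_pM2l.
have c1 : C z <= cos (pi * e) by apply: lecos; lra.
have c2 : - cos (pi * e) <= C z.
  have -> : - cos (pi * e) = cos (pi * (1 - e)).
    by rewrite mulrBr mulr1 cosB cospi sinpi; ring.
  apply: lecos; lra.
have p1 : 0 <= cos (pi * e) - C z by rewrite subr_ge0.
have p2 : 0 <= cos (pi * e) + C z by rewrite -lerBlDl sub0r.
have := mulr_ge0 p1 p2; rewrite sin2cos2 /den2 expr2.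
have := SC z; have : 0 <= l * l * (C z * C z) by rewrite -mulrACA -expr2 sqr_ge0.
by rewrite mulrDr !mulrDl; nra.
Qed.

End HalfTurn.

Section ScaledHalfTurn.
Local Open Scope ring_scope.
Variables (R : realType) (l : R) (k : nat).
Hypothesis (l01 : 0 < l < 1) (k0 : (0 < k)%N).
Implicit Types x y z : R.

Let sg := half_turn_fun l.
Let kR : R := k%:R.
Let kR0 : 0 < kR. Proof. by rewrite ltr0n. Qed.
Let kRn : kR != 0. Proof. by rewrite gt_eqF. Qed.

Lemma half_turn_int x (n : int) : sg (x + n%:~R) = sg x + n%:~R.
Proof.
have nat_case y (j : nat) : sg (y + j%:R) = sg y + j%:R.
  by elim: j => [|j IH]; rewrite ?addr0// -natr1 !addrA /sg half_turn_period -/sg IH.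
case: n => j; first exact: nat_case.
by rewrite NegzE mulrNz -[in RHS](subrK j.+1%:R x) nat_case addrK.
Qed.

Lemma half_turn_half : sg (1 / 2) = 0.
Proof.
have E : pi * (1 / 2) = pi / 2 :> R by ring.
by rewrite /sg /half_turn_fun E cos_pihalf !(mulr0, mul0r) atan0 mul0r subrr addr0.
Qed.

Let sgsg x : sg (sg x) = x - 1. Proof. exact: (half_turn_twice l01). Qed.

(** The inverse is the map itself followed by a translation, as its square is one. *)
Program Definition scaled_half_turn : line_homeo R :=
  @LineHomeo R (fun x => sg (kR * x) / kR) (fun x => (sg (kR * x) + 1) / kR) _ _ _ _.
Next Obligation. by move=> x; rewrite (mulrC kR) divfK// sgsg subrK mulrC mulKf. Qed.
Next Obligation.
by move=> x; rewrite (mulrC kR) divfK// /sg half_turn_period -/sg sgsg subrK mulrC mulKf.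
Qed.
Next Obligation.
by move=> x y xy; rewrite ltr_pM2r ?invr_gt0//; apply: (half_turn_incr l01); rewrite ltr_pM2l.
Qed.
Next Obligation.
by move=> x; rewrite /= mulrDr mulr1 /kR (half_turn_int _ k) mulrDl divff.
Qed.

Lemma scaled_half_turn_trans x (n : int) :
  scaled_half_turn (x + n%:~R / kR) = scaled_half_turn x + n%:~R / kR.
Proof. by rewrite /= mulrDr (mulrC kR (_ / _)) divfK// half_turn_int mulrDl. Qed.

Lemma scaled_half_turn_twice : (scaled_half_turn * scaled_half_turn = trans (- kR^-1))%g.
Proof.
by apply: line_homeo_ext => x; rewrite lhM transE /= (mulrC kR (_ / _)) divfK// sgsg; field.
Qed.

End ScaledHalfTurn.

Section HalfTurnExists.
Local Open Scope ring_scope.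
Variable (R : realType).

(** For [l] small the scaled half turn contracts strongly away from the multiples
    of [1 / k], and maps what avoids their neighbourhoods close to them. *)
Lemma exists_half_turn (k : nat) (eps c : R) : (0 < k)%N -> 0 < eps ->
  eps < (2 * k%:R)^-1 -> 0 < c ->
  exists h : line_homeo R,
   [/\ forall (n : int), (h * trans (n%:~R / k%:R) = trans (n%:~R / k%:R) * h)%g,
       (h * h = trans (- k%:R^-1))%g,
       forall x, analytic_at h x,
       exists2 K, 0 < K & forall x y, x <= y -> h y - h x <= K * (y - x)
     & forall (i : int) x y, x <= y -> i%:~R / k%:R + eps <= x ->
         y <= (i + 1)%:~R / k%:R - eps ->
         h y - h x <= c * (y - x) /\
         exists j : int, j%:~R / k%:R - eps <= h x /\ h y <= j%:~R / k%:R + eps].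
Proof.
move=> k0 e0 ek c0.
have kR0 : 0 < k%:R :> R by rewrite ltr0n.
have kRn : k%:R != 0 :> R by rewrite gt_eqF.
pose e := k%:R * eps.
have ee0 : 0 < e by rewrite mulr_gt0.
have e12 : e < 1 / 2.
  move: ek; rewrite -(ltr_pM2l kR0) -/e => /lt_le_trans; apply.
  by rewrite invfM mulrCA divff// mulr1 mul1r.
have se : 0 < sin (pi * e).
  apply: sin_gt0_pi; rewrite mulr_gt0 ?pi_gt0//= gtr_pMr ?pi_gt0//; lra.
(* Half a period is at most 1/2, so a contraction factor at most [eps] keeps the
   image within [eps] of the image of the middle of the gap, a grid point. *)
pose c' := Num.min c eps.
have c'0 : 0 < c' by rewrite lt_min c0.
pose l := Num.min (1 / 2) (c' * sin (pi * e) ^+ 2).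
have l0 : 0 < l by rewrite lt_min; apply/andP; split; [lra|rewrite mulr_gt0 ?exprn_gt0].
have l1 : l < 1 by rewrite gt_min; apply/orP; left; lra.
have l01 : 0 < l < 1 by rewrite l0.
have lc : l / sin (pi * e) ^+ 2 <= c'.
  by rewrite ler_pdivrMr ?exprn_gt0// ge_min lexx orbT.
pose h := scaled_half_turn l01 k0.
have hn x (n : int) : h (x + n%:~R / k%:R) = h x + n%:~R / k%:R.
  exact: scaled_half_turn_trans.
have contr (i : int) x y : x <= y -> i%:~R / k%:R + eps <= x ->
    y <= (i + 1)%:~R / k%:R - eps -> h y - h x <= c' * (y - x).
  move=> xy ix yi.
  pose x' := x - i%:~R / k%:R; pose y' := y - i%:~R / k%:R.
  have -> : h x = h x' + i%:~R / k%:R by rewrite -hn /x' subrK.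
  have -> : h y = h y' + i%:~R / k%:R by rewrite -hn /y' subrK.
  have -> : y - x = y' - x' by rewrite /x' /y'; ring.
  rewrite opprD addrACA subrr addr0.
  have a1 : e <= k%:R * x' by rewrite ler_pM2l// /x'; lra.
  have a2 : k%:R * x' <= k%:R * y' by rewrite ler_pM2l// /x' /y'; lra.
  have a3 : k%:R * y' <= 1 - e.
    have -> : 1 - e = k%:R * (k%:R^-1 - eps) by rewrite mulrBr divff.
    by rewrite ler_pM2l// /y'; move: yi; rewrite intrD mulrDl mul1r; lra.
  have := half_turn_contract l01 ee0 e12 a1 a2 a3.
  rewrite /h /= -mulrBl ler_pdivrMr// => /le_trans; apply.
  rewrite -mulrBr (mulrC k%:R) mulrA.
  rewrite ler_wpM2r ?(ltW kR0)// ler_wpM2r//.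
  by rewrite subr_ge0 /x' /y'; lra.
exists h; split.
- move=> n; apply: line_homeo_ext => x; rewrite !lhM !transE; exact: hn.
- exact: scaled_half_turn_twice.
- move=> x.
  have a1 := analytic_at_affine k%:R 0 x.
  have a2 := analytic_at_comp a1 (half_turn_analytic l01 _).
  have a3 := analytic_at_comp a2 (analytic_at_affine k%:R^-1 0 _).
  by apply: eq_analytic_at a3 => y; rewrite /= !addr0 mulrC.
- exists l^-1; first by rewrite invr_gt0.
  move=> x y xy; rewrite /h /= -mulrBl ler_pdivrMr//.
  have xy' : k%:R * x <= k%:R * y by rewrite ler_pM2l.
  by rewrite (le_trans (half_turn_lipschitz l01 xy'))// -mulrBr mulrA (mulrAC _ (y - x)).
move=> i x y xy ix yi; split.
  apply: le_trans (contr i x y xy ix yi) _.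
  by rewrite ler_wpM2r ?subr_ge0// ge_min lexx.
have k12 : k%:R^-1 <= 1 :> R by rewrite invf_le1// ler1n.
have kp : 0 < k%:R^-1 :> R by rewrite invr_gt0.
pose mid : R := (2 * k%:R)^-1 + i%:~R / k%:R.
have hmid : h mid = i%:~R / k%:R.
  rewrite /mid hn /= invfM (mulrC 2^-1) mulrA divff// mul1r.
  by have := half_turn_half l; rewrite mul1r => ->; rewrite mul0r add0r.
have twok : (2 * k%:R)^-1 + (2 * k%:R)^-1 = k%:R^-1 :> R by field.
have i1 : (i + 1)%:~R / k%:R = i%:~R / k%:R + k%:R^-1 :> R by rewrite intrD mulrDl mul1r.
rewrite i1 in yi.
have c'e : c' <= eps by rewrite ge_min lexx orbT.
have small z w : z <= w -> i%:~R / k%:R + eps <= z -> w <= i%:~R / k%:R + k%:R^-1 - eps ->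
    h w - h z <= eps.
  move=> zw iz wi; have := contr i z w zw iz; rewrite i1 => /(_ wi) /le_trans; apply.
  apply: le_trans (_ : c' * 1 <= _); last by rewrite mulr1.
  by rewrite ler_wpM2l ?(ltW c'0)//; lra.
exists i; rewrite -hmid; split.
- have [xm|mx] := leP x mid.
    have := small x mid xm ix; rewrite {1}/mid => /(_ _)/wrap[|]; first by lra.
    by lra.
  have : h mid < h x by apply: lh_incr.
  lra.
- have [ym|my] := leP y mid.
    have : h y <= h mid by rewrite lh_mono.
    lra.
  have := small mid y (ltW my); rewrite {1}/mid => /(_ _ yi)/wrap[|]; first by lra.
  by lra.
Qed.

End HalfTurnExists.

(** * Transport along paths of the tree *)

Section Paths.
Local Open Scope group_scope.
Variables (gT : groupType) (F : set gT) (T : set (gT -> bool)).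
Hypothesis HT : cut_tree F T.
Implicit Types (C D : gT -> bool) (u v w : (gT -> bool) -> bool) (g h k : gT).
Implicit Types s : seq (gT -> bool).

(** The edges of the path; each one leaves the vertex where the preceding one
    arrives. *)
Fixpoint edge_path v s w : Prop :=
  if s is C :: s' then [/\ T C, origin T C = v & edge_path (origin T (compl C)) s' w]
  else v = w.

Lemma edge_path_cat v s1 s2 w :
  edge_path v (s1 ++ s2) w <-> exists u, edge_path v s1 u /\ edge_path u s2 w.
Proof.
elim: s1 v => [|C s1 IH] v /=; first by split=> [|[u [->]]]; [exists v|].
split=> [[TC vC /IH[u [H1 H2]]]|[u [[TC vC H1] H2]]]; first by exists u.
by split=> //; apply/IH; exists u.
Qed.

Lemma edge_path_vertex v s w : vertex T v -> edge_path v s w -> vertex T w.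
Proof.
elim: s v => [|C s IH] v Hv /=; first by move=> <-.
by move=> [TC _]; apply: IH; exact: (vertex_origin HT (cut_compl HT TC)).
Qed.

Lemma edge_path_end v s w w' : edge_path v s w -> edge_path v s w' -> w = w'.
Proof.
elim: s v => [|C s IH] v /=; first by move=> <-.
by move=> [_ _ H] [_ _ /(IH _ H)].
Qed.

Lemma edge_path_rev v s w : edge_path v s w -> edge_path w (rev (map (@compl gT) s)) v.
Proof.
elim: s v => [|C s IH] v /=; first by move=> ->.
move=> [TC vC /IH H]; rewrite rev_cons -cats1; apply/edge_path_cat.
exists (origin T (compl C)); split=> //=; split=> //; first exact: (cut_compl HT).
by rewrite complK.
Qed.

Lemma edge_path_ltr g v s w :
  edge_path v s w -> edge_path (vact g v) (map (ltr g) s) (vact g w).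
Proof.
elim: s v => [|C s IH] v /=; first by move=> ->.
move=> [TC <- /IH H]; split; [exact: (cut_ltr HT)|exact: (origin_ltr HT)|].
by rewrite -ltr_compl (origin_ltr HT).
Qed.

Lemma exists_edge_path v w : vertex T v -> vertex T w -> exists s, edge_path v s w.
Proof.
move=> Hv Hw; have [n] := ubnP (vdist T v w); elim: n v Hv => // n IH v Hv lt.
have [->|/eqP vw] := eqVneq v w; first by exists [::].
have [C [TC oC _ lt']] := vertex_step HT Hv Hw vw.
have [|s Hs] := IH _ (vertex_origin HT (cut_compl HT TC)); last by exists (C :: s).
by rewrite (leq_trans lt').
Qed.

Definition backtracking s := exists s1 C s2, s = s1 ++ C :: compl C :: s2.

(** Along a path without backtracking the edges, as sets, decrease: the far
    end remains on the far side of the first edge. *)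
Lemma edge_path_far v C s w : edge_path v (C :: s) w -> ~ backtracking (C :: s) -> w C.
Proof.
elim: s v C => [|D s IH] v C /=.
  move=> [TC _ <-] _; have TC' := cut_compl HT TC.
  by have := originC HT TC' TC'; rewrite complK (originN HT).
move=> [TC _ Ds'] nb; have Ds : edge_path (origin T (compl C)) (D :: s) w := Ds'.
have wD : w D.
  apply: (IH _ _ Ds) => -[s1 [E [s2 H]]]; apply: nb.
  by exists (C :: s1), E, s2; rewrite H.
have [TD oD _] := Ds.
have [_ _ wU _] : vertex T w.
  by apply: edge_path_vertex Ds; exact: (vertex_origin HT (cut_compl HT TC)).
have CD : compl C <> D by move=> E; apply: nb; exists [::], C, s; rewrite E.
have H := origin_disjoint HT (cut_compl HT TC) TD (esym oD) CD.
apply: (wU D) => // x Dx; have := H x; rewrite Dx andbT /compl negbK; exact.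
Qed.

Lemma closed_backtracking v s : edge_path v s v -> s <> [::] -> backtracking s.
Proof.
case: s => // C s Hs _; apply: contrapT => nb.
have := edge_path_far Hs nb; have [TC <- _] := Hs.
by rewrite (originN HT).
Qed.

Lemma remove_backtrack v s1 C s2 w : edge_path v (s1 ++ C :: compl C :: s2) w ->
  edge_path v (s1 ++ s2) w.
Proof.
move=> /edge_path_cat[u [H1 /=[TC uC [TC' _ H2]]]]; apply/edge_path_cat; exists u; split=> //.
by move: H2; rewrite complK uC.
Qed.

Lemma exists_reduced_path v w : vertex T v -> vertex T w ->
  exists2 s, edge_path v s w & ~ backtracking s.
Proof.
move=> Hv Hw; have [s] := exists_edge_path Hv Hw.
have [n] := ubnP (size s); elim: n s => // n IH s lt Hs.
have [[s1 [C [s2 E]]]|nb] := pselect (backtracking s); last by exists s.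
move: Hs lt; rewrite E => /remove_backtrack Hs lt; apply: (IH _ _ Hs).
by move: lt; rewrite !size_cat /=; clear; lia.
Qed.

Section Transport.
Variables (Q : groupType) (tau : (gT -> bool) -> Q).
Hypothesis tauC : forall C, T C -> tau (compl C) = (tau C)^-1.

Definition path_value s : Q := \prod_(C <- s) tau C.

Lemma path_value_cons C s : path_value (C :: s) = tau C * path_value s.
Proof. by rewrite /path_value big_cons. Qed.

Lemma path_value_cat s1 s2 : path_value (s1 ++ s2) = path_value s1 * path_value s2.
Proof. by rewrite /path_value big_cat. Qed.

(** Remove backtrackings, whose contributions cancel, until nothing is left. *)
Lemma path_value_closed v s : edge_path v s v -> path_value s = 1.
Proof.
have [n] := ubnP (size s); elim: n s => // n IH s lt Hs.
have [->|s0] := pselect (s = [::]); first by rewrite /path_value big_nil.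
have [s1 [C [s2 E]]] := closed_backtracking Hs s0.
have TC : T C by move: Hs; rewrite E => /edge_path_cat[u [_ []]].
have <- : path_value (s1 ++ s2) = path_value s.
  by rewrite E !path_value_cat !path_value_cons tauC// mulKVg.
apply: IH; last by apply: (@remove_backtrack _ _ C); rewrite -E.
by move: lt; rewrite E !size_cat /=; clear; lia.
Qed.

Lemma path_value_rev v s w : edge_path v s w ->
  path_value (rev (map (@compl gT) s)) = (path_value s)^-1.
Proof.
elim: s v => [|C s IH] v /=; first by rewrite /path_value big_nil invg1.
move=> [TC _ /IH H]; rewrite rev_cons -cats1 path_value_cat H [in RHS]path_value_cons invgM.
by rewrite path_value_cons /path_value big_nil mulg1 tauC.
Qed.

(** Well defined because the graph is a tree. *)
Definition transport v w : Q :=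
  if pselect (exists s, edge_path v s w) is left e then path_value (projT1 (cid e)) else 1.

Lemma transportE v s w : edge_path v s w -> transport v w = path_value s.
Proof.
move=> Hs; rewrite /transport; case: pselect => [e|[]]; last by exists s.
case: cid => /= s' Hs'; apply: (@mulIg _ (path_value s)^-1); rewrite mulgV.
rewrite -(path_value_rev Hs) -path_value_cat; apply: (@path_value_closed v).
by apply/edge_path_cat; exists w; split=> //; exact: edge_path_rev.
Qed.

Lemma transport1 v : transport v v = 1.
Proof. by rewrite (@transportE v [::])// /path_value big_nil. Qed.

Lemma transportM u v w : vertex T u -> vertex T v -> vertex T w ->
  transport u v * transport v w = transport u w.
Proof.
move=> Hu Hv Hw; have [s1 H1] := exists_edge_path Hu Hv.
have [s2 H2] := exists_edge_path Hv Hw.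
rewrite (transportE H1) (transportE H2) -path_value_cat.
by apply/esym/transportE/edge_path_cat; exists v.
Qed.

Lemma transport_edge C : T C -> transport (origin T C) (origin T (compl C)) = tau C.
Proof.
by move=> TC; rewrite (@transportE _ [:: C])// path_value_cons /path_value big_nil mulg1.
Qed.

Variable t : gT -> Q.
Hypothesis tau_ltr : forall g C, T C -> tau (ltr g C) = t g * tau C * (t g)^-1.

Lemma transport_vact g v w : vertex T v -> vertex T w ->
  transport (vact g v) (vact g w) = t g * transport v w * (t g)^-1.
Proof.
move=> Hv Hw; have [s Hs] := exists_edge_path Hv Hw.
rewrite (transportE (edge_path_ltr g Hs)) (transportE Hs).
elim: s v {Hv Hs} (Hs) => [|C s IH] v /=; first by rewrite /path_value !big_nil mulg1 mulgV.
by move=> [TC _ /IH H]; rewrite !path_value_cons H tau_ltr// -!mulgA mulKg.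
Qed.

End Transport.

Section LocallyFinite.
Variables (aT : finType) (p : gT -> aT).
(** Up to a finite ambiguity an element is determined by the image of a single
    vertex, which makes the tree locally finite. *)
Hypothesis p_free : forall g h v, p g = p h -> vertex T v -> vact g v = vact h v -> g = h.

(** Edges of one orbit that leave [v] are told apart by the values of [p] at the
    elements that carry a representative to them. *)
Lemma finite_origin v : finite_set [set C | T C /\ origin T C = v].
Proof.
have [A [fA AT orb]] := cut_orbits HT.
pose P (D : (gT -> bool)) (a : aT) (C : gT -> bool) :=
  [/\ A D, origin T C = v & exists g, p g = a /\ C = ltr g D].
pose f (Da : (gT -> bool) * aT) : gT -> bool := xget Da.1 (P Da.1 Da.2).
apply: (@sub_finite_set _ _ (f @` (A `*` [set: aT]))).
  move=> C [TC oC]; have [g [D AD E]] := orb C TC.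
  exists (D, p g); first by split.
  rewrite /f /=; case: xgetP => [C' _ [_ oC' [h [ph E']]]|/(_ C)]; last first.
    by case; split=> //; exists g.
  suff gh : g = h by rewrite E' E gh.
  apply: (@p_free _ _ (origin T D)); [by []|exact: (vertex_origin HT (AT _ AD))|].
  by rewrite -!(origin_ltr HT) -E -E' oC oC'.
by apply: finite_image; apply: finite_setX => //; exact: finite_finset.
Qed.

Lemma finite_paths n v : finite_set [set s | (size s <= n)%N /\ exists w, edge_path v s w].
Proof.
elim: n v => [|n IH] v.
  apply: (@sub_finite_set _ _ [set [::]]) => // s [/=].
  by rewrite leqn0 size_eq0 => /eqP.
apply: (@sub_finite_set _ _ ([set [::]] `|` \bigcup_(C in [set C | T C /\ origin T C = v])
   (cons C @` [set s | (size s <= n)%N /\ exists w, edge_path (origin T (compl C)) s w]))).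
  case=> [|C s] [/= sn [w Hw]]; first by left.
  have [TC oC Hs] := Hw; right; exists C => //; exists s => //; split=> //.
  by exists w.
rewrite finite_setU; split=> //; apply: bigcup_finite; first exact: finite_origin.
by move=> C _; apply: finite_image.
Qed.

Lemma finite_displacement n v : vertex T v ->
  finite_set [set g | exists s, (size s <= n)%N /\ edge_path v s (vact g v)].
Proof.
move=> Hv.
pose P (sa : seq (gT -> bool) * aT) (g : gT) := edge_path v sa.1 (vact g v) /\ p g = sa.2.
pose f sa : gT := xget 1 (P sa).
apply: (@sub_finite_set _ _ (f @` ([set s | (size s <= n)%N /\ exists w, edge_path v s w]
   `*` [set: aT]))).
  move=> g [s [sn Hs]]; exists (s, p g); first by split=> //; split=> //; exists (vact g v).
  rewrite /f; case: xgetP => [h _ [/= Hh ph]|/(_ g)]; last by case; split.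
  by apply: (@p_free _ _ v) => //; exact: edge_path_end Hs.
by apply: finite_image; apply: finite_setX; [exact: finite_paths|exact: finite_finset].
Qed.

End LocallyFinite.
End Paths.

(** * Ping-pong along paths *)

Section PingPong.
Local Open Scope ring_scope.
Variables (R : realType) (gT : groupType) (F : set gT) (T : set (gT -> bool)).
Hypothesis HT : cut_tree F T.
Variables (aT : finType) (p : gT -> aT).
Hypothesis p_free : forall g h v, p g = p h -> vertex T v -> vact g v = vact h v -> g = h.
Implicit Types (C D E : gT -> bool) (u v w : (gT -> bool) -> bool) (g h k : gT).
Implicit Types (s : seq (gT -> bool)) (a b x y : R).

Variables (flip : (gT -> bool) -> line_homeo R) (t : gT -> line_homeo R).
(** Each edge [C] has an attracting region on the line, a union of disjoint
    intervals: [near C a b] says that one of these contains the interval from [a]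
    to [b], and [off C a b] that this interval avoids them all.  The half turn
    [flip C] and its inverse contract into the region what avoids it, and [t g] is
    the rotation by which [g] permutes the regions. *)
Variables (near off : (gT -> bool) -> R -> R -> Prop) (c K L : R).
Hypothesis c0 : 0 < c.
Hypothesis c12 : c <= 1 / 2.
Hypothesis K0 : 0 < K.
Hypothesis t_isometry : forall g a b, t g b - t g a = b - a.
Hypothesis flip_ltr : forall g C, T C -> flip (ltr g C) = (t g * flip C * (t g)^-1)%g.
Hypothesis flip_off : forall C a b, T C -> a <= b -> off C a b ->
  near C (flip C a) (flip C b) /\ flip C b - flip C a <= c * (b - a).
Hypothesis flipV_off : forall C a b, T C -> a <= b -> off C a b ->
  near C ((flip C)^-1%g a) ((flip C)^-1%g b) /\
  (flip C)^-1%g b - (flip C)^-1%g a <= c * (b - a).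
Hypothesis flip_lip : forall C a b, T C -> a <= b ->
  flip C b - flip C a <= K * (b - a) /\ (flip C)^-1%g b - (flip C)^-1%g a <= K * (b - a).
Hypothesis near_off : forall C D a b, T C -> T D -> a <= b ->
  origin T C = origin T D /\ C <> D \/ D = compl C -> near D a b -> off C a b.
Hypothesis off_ltr : forall g C a b, T C -> off C a b -> off (ltr g C) (t g a) (t g b).
Hypothesis near_size : forall C a b, near C a b -> b - a <= L.
(** The regions consist of neighbourhoods of points of a common grid: an interval
    reaches into the gaps of the grid or stays close to one of its points. *)
Hypothesis grid_gap : forall a b, a < b ->
  (exists a' b', [/\ a <= a', a' < b', b' <= b & forall D, T D -> off D a' b']) \/
  forall v, (forall D, T D -> origin T D = v -> off D a b) \/
            exists D, [/\ T D, origin T D = v & near D a b].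

Let c1 : c <= 1. Proof. by apply: le_trans c12 _; rewrite ler_pdivrMr// mul1r ler1n. Qed.

(** The effect of crossing the edge, as seen from its origin. *)
Definition crossing_map C : line_homeo R := (flip C * (flip (compl C))^-1)%g.
Local Notation tau := crossing_map.

Lemma crossing_mapC C : tau (compl C) = (tau C)^-1%g.
Proof. by rewrite /tau complK invgM invgK. Qed.

Let tauC C : T C -> tau (compl C) = (tau C)^-1%g. Proof. by move=> _; exact: crossing_mapC. Qed.

Lemma crossing_map_ltr g C : T C -> tau (ltr g C) = (t g * tau C * (t g)^-1)%g.
Proof.
move=> TC; rewrite /tau -ltr_compl !flip_ltr//; last exact: (cut_compl HT).
by rewrite !invgM invgK !mulgA mulgKV.
Qed.

Lemma crossing_map_contract C a b : T C -> a <= b -> off (compl C) a b ->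
  near C (tau C a) (tau C b) /\ tau C b - tau C a <= c * (b - a).
Proof.
move=> TC ab oab; have TC' := cut_compl HT TC.
have [n1 l1] := flipV_off TC' ab oab.
have ab1 : (flip (compl C))^-1%g a <= (flip (compl C))^-1%g b by rewrite lh_mono.
have [|n2 l2] := flip_off TC ab1; first by apply: near_off n1 => //; right.
split; first exact: n2.
apply: le_trans l2 _; rewrite ler_wpM2l ?(ltW c0)//.
apply: le_trans l1 _; rewrite ler_piMl ?subr_ge0//.
Qed.

Lemma crossing_map_lip C a b : T C -> a <= b -> tau C b - tau C a <= K * K * (b - a).
Proof.
move=> TC ab; have TC' := cut_compl HT TC.
have [_ l1] := flip_lip TC' ab.
have ab1 : (flip (compl C))^-1%g a <= (flip (compl C))^-1%g b by rewrite lh_mono.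
have [l2 _] := flip_lip TC ab1.
apply: le_trans l2 _; rewrite -mulrA ler_wpM2l// ltW//.
Qed.

Local Notation pv := (path_value tau).
Local Notation W := (transport T tau).

(** Ping-pong: at every step the image lies in the region of an edge that leaves
    the same vertex as the opposite of the next edge to be crossed, and differs
    from it. *)
Lemma path_contract v C s w a b : edge_path T v (C :: s) w -> ~ backtracking (C :: s) ->
  a <= b -> off (compl (last C s)) a b ->
  near C (pv (C :: s) a) (pv (C :: s) b) /\
  pv (C :: s) b - pv (C :: s) a <= c ^+ size (C :: s) * (b - a).
Proof.
move=> + + ab; elim: s v C => [|D s IH] v C Hs nb oab.
  have [TC _ _] := Hs; rewrite path_value_cons /path_value big_nil mulg1 expr1.
  exact: crossing_map_contract.
have [TC _ Ds] := Hs.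
have [|n1 l1] := IH _ _ Ds _ oab.
  by move=> [s1 [E [s2 H]]]; apply: nb; exists (C :: s1), E, s2; rewrite H.
have [TD oD _] := Ds.
have ab1 : pv (D :: s) a <= pv (D :: s) b by rewrite lh_mono.
have [|n2 l2] := crossing_map_contract TC ab1.
  apply: near_off n1 => //; first exact: (cut_compl HT).
  by left; split=> [//|E]; apply: nb; exists [::], C, s; rewrite E.
rewrite path_value_cons; split; first exact: n2.
apply: le_trans l2 _; rewrite exprS -mulrA ler_wpM2l// ltW//.
Qed.

(** The maps of the action, seen from [v], shrink the interval to a point as
    the group element goes to infinity. *)
Definition shrinking v a b := forall d, 0 < d ->
  finite_set [set g | d <= (W v (vact g v) * t g)%g b - (W v (vact g v) * t g)%g a].

Lemma geometric_small x d : 0 < d -> 0 <= x -> exists n, forall i, (n < i)%N -> c ^+ i.-1 * x < d.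
Proof.
move=> d0 x0.
have two (n : nat) : n%:R <= 2 ^+ n :> R.
  elim: n => [|n IH]; first by rewrite expr0.
  rewrite exprS -natr1; have : 1 <= 2 ^+ n :> R by rewrite exprn_ege1// ler1n.
  lra.
have [n Hn] : exists n : nat, x / d < n%:R.
  by exists (Num.bound (x / d)); apply: archi_boundP; rewrite divr_ge0// ltW.
exists n => -[//|i]; rewrite ltnS /= => ni.
have : c ^+ i <= 2^-1 ^+ i.
  by apply: lerXn2r; rewrite ?nnegrE ?invr_ge0 ?(ltW c0)// -div1r.
have p2 : 0 < 2 ^+ i :> R by rewrite exprn_gt0.
rewrite exprVn -(ler_pM2r p2) mulVf ?gt_eqF// => h.
have hx : x < d * 2 ^+ i.
  rewrite mulrC -ltr_pdivrMr//; apply: lt_le_trans Hn (le_trans _ (two i)).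
  by rewrite ler_nat.
rewrite -(ltr_pM2r p2); apply: le_lt_trans hx.
rewrite mulrAC; apply: ler_piMl => //.
Qed.

(** The path to [vact g v] ends with an edge whose opposite leaves [vact g v], so
    it is the image under [g] of an edge at [v], whose region the interval avoids. *)
Lemma shrinking_off v a b : vertex T v -> a <= b ->
  (forall D, T D -> origin T D = v -> off D a b) -> shrinking v a b.
Proof.
move=> Hv ab H d d0.
have ba : 0 <= b - a by rewrite subr_ge0.
have [n Hn] := geometric_small d0 ba.
apply: sub_finite_set (finite_displacement HT p_free n.+1 Hv) => g /= dg.
have [s Hs nb] := exists_reduced_path HT Hv (vertex_vact HT g Hv).
exists s; split=> //; rewrite leqNgt; apply/negP => ns.
case: s Hs nb ns => // C s Hs nb ns; move: dg; apply/negP; rewrite -ltNge.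
have /edge_path_cat[u [_ [TE oE Eg]]] : edge_path T v (belast C s ++ [:: last C s]) (vact g v).
  by rewrite cats1 -lastI.
have TE' := cut_compl HT TE.
have oab : off (compl (last C s)) (t g a) (t g b).
  rewrite -[compl _](ltrKV g); apply: off_ltr; first exact: (cut_ltr HT).
  apply: H; first exact: (cut_ltr HT).
  by rewrite (origin_ltr HT) Eg vactK.
rewrite (transportE HT tauC Hs) ?lhM.
have tab : t g a <= t g b by rewrite lh_mono.
have [_ le1] := path_contract Hs nb tab oab.
apply: le_lt_trans le1 _; rewrite t_isometry.
apply: (Hn (size (C :: s)).+1); move: ns; clear; rewrite /=; lia.
Qed.

(** An interval in the attracting region of [C] that the crossing map pulls
    back into the attracting region of the opposite edge: only paths ending
    with the edge opposite to [C] fail to contract it directly, and these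
    contract its pull-back. *)
Lemma shrinking_edge C a b : T C -> a <= b -> near C a b ->
  near (compl C) (tau (compl C) a) (tau (compl C) b) -> shrinking (origin T C) a b.
Proof.
move=> TC ab nC nC' d d0; have TC' := cut_compl HT TC.
pose a' := tau (compl C) a; pose b' := tau (compl C) b.
have ab' : a' <= b' by rewrite lh_mono.
have ba : 0 <= (b - a) + (b' - a') by rewrite addr_ge0 ?subr_ge0.
have [n Hn] := geometric_small d0 ba.
have Hv := vertex_origin HT TC.
apply: sub_finite_set (finite_displacement HT p_free n.+2 Hv) => g /= dg.
have [s Hs nb] := exists_reduced_path HT Hv (vertex_vact HT g Hv).
exists s; split=> //; rewrite leqNgt; apply/negP => ns.
case/lastP: s Hs nb ns => // s E Hs nb ns; move: dg; apply/negP; rewrite -ltNge.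
rewrite (transportE HT tauC Hs).
have /edge_path_cat[u [Hsu [TE oE Eg]]] :
    edge_path T (origin T C) (s ++ [:: E]) (vact g (origin T C)) by rewrite cats1.
have TE' := cut_compl HT TE.
have [EC|nEC] := pselect (E = ltr g (compl C)); last first.
  have oab : off (compl E) (t g a) (t g b).
    rewrite -[compl E](ltrKV g); apply: off_ltr; first exact: (cut_ltr HT).
    apply: near_off nC => //; first exact: (cut_ltr HT).
    left; split; first by rewrite (origin_ltr HT) Eg vactK.
    by move=> EC; apply: nEC; rewrite ltr_compl -EC ltrKV complK.
  have tab : t g a <= t g b by rewrite lh_mono.
  case: s Hs {Hsu} nb ns => [|B s] Hs nb ns; first by move: ns; rewrite ltnS.
  have [|_ le1] := path_contract Hs nb tab; first by rewrite last_rcons.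
  apply: le_lt_trans le1 _; rewrite t_isometry.
  have ns' : (n < size (rcons (B :: s) E))%N by move: ns; clear; lia.
  apply: le_lt_trans (Hn _ ns').
  have ci (i : nat) : 0 < c ^+ i by rewrite exprn_gt0.
  rewrite size_rcons /= exprS -mulrA; apply: le_trans (_ : c ^+ (size s).+1 * (b - a) <= _).
    by rewrite ler_piMl ?mulr_ge0 ?(ltW (ci _)) ?subr_ge0.
  by rewrite ler_wpM2l ?(ltW (ci _))// lerDl subr_ge0.
case/lastP: s Hs Hsu nb ns => [|s B] Hs Hsu nb ns; first by [].
have tab' : t g a' <= t g b' by rewrite lh_mono.
have /edge_path_cat[u' [_ [TB oB EB]]] : edge_path T (origin T C) (s ++ [:: B]) u.
  by rewrite cats1.
have oab : off (compl B) (t g a') (t g b').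
  rewrite -[compl B](ltrKV g); apply: off_ltr; first by apply: (cut_ltr HT); exact: (cut_compl HT).
  apply: near_off nC' => //; first by apply: (cut_ltr HT); exact: (cut_compl HT).
  left; split; first by rewrite (origin_ltr HT) EB -oE EC (origin_ltr HT) vactK.
  move=> BC; apply: nb; exists s, B, [::].
  by rewrite EC -BC ltrKV -cats1 -cats1 -catA.
have nb' : ~ backtracking (rcons s B).
  move=> [s1 [E' [s2 H]]]; apply: nb; exists s1, E', (rcons s2 E).
  by rewrite H -!cats1 -catA.
have key x : pv (rcons (rcons s B) E) (t g x) = pv (rcons s B) (t g (tau (compl C) x)).
  rewrite -[LHS]lhM -cats1 path_value_cat path_value_cons /path_value big_nil mulg1 EC.
  by rewrite crossing_map_ltr// -!mulgA mulVg mulg1 !lhM.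
rewrite !key -/a' -/b'.
case: s Hs {nb} Hsu nb' ns {key} => [|B' s] Hs Hsu nb' ns; first by [].
have [|_ le1] := path_contract Hsu nb' tab'; first by rewrite last_rcons.
apply: le_lt_trans le1 _; rewrite t_isometry.
have ns' : (n < size (rcons (rcons (B' :: s) B) E))%N by move: ns; clear; lia.
apply: le_lt_trans (Hn _ ns').
rewrite !size_rcons /=; apply: ler_wpM2l; first by rewrite exprn_ge0// ltW.
by rewrite lerDr subr_ge0.
Qed.

Lemma shrinking_transport C a b : T C -> a <= b -> shrinking (origin T (compl C)) a b ->
  shrinking (origin T C) (tau C a) (tau C b).
Proof.
move=> TC ab H d d0; have TC' := cut_compl HT TC.
have KK : 0 < K * K by rewrite mulr_gt0.
have Hv := vertex_origin HT TC; have Hv' := vertex_origin HT TC'.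
have dK : 0 < d / (K * K) by rewrite divr_gt0.
apply: sub_finite_set (H _ dK) => g /=.
set M := W _ _; set M' := W _ _.
have key x : M (t g (tau C x)) = tau C (M' (t g x)).
  rewrite -!lhM; congr (lh_fun _ x); rewrite /M /M'.
  have Wt := transport_edge HT tauC TC.
  rewrite -{2}Wt -{1}(transportM HT tauC Hv Hv' (vertex_vact HT g Hv)).
  rewrite -(transportM HT tauC Hv' (vertex_vact HT g Hv') (vertex_vact HT g Hv)).
  have -> : W (vact g (origin T (compl C))) (vact g (origin T C)) = (t g * (tau C)^-1 * (t g)^-1)%g.
    rewrite (transport_vact HT tauC crossing_map_ltr)//; congr (_ * _ * _)%g.
    by have := transport_edge HT tauC TC'; rewrite complK crossing_mapC.
  by rewrite -!mulgA mulKg mulVg mulg1.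
rewrite !key => dg; rewrite ler_pdivrMr//; apply: le_trans dg _; rewrite mulrC.
by apply: crossing_map_lip => //; rewrite !lh_mono.
Qed.

(** Unless one of the situations settled above occurs, crossing backwards the edge
    whose region contains the interval at least doubles it; since the regions
    are bounded, this stops. *)
Lemma exists_shrinking_near n C a b : T C -> a < b -> near C a b -> L < 2 ^+ n * (b - a) ->
  exists a' b', [/\ a <= a', a' < b', b' <= b & shrinking (origin T C) a' b'].
Proof.
elim: n C a b => [|n IH] C a b TC ab nC.
  by rewrite expr0 mul1r ltNge (near_size nC).
move=> Ln; have TC' := cut_compl HT TC.
pose a1 := tau (compl C) a; pose b1 := tau (compl C) b.
have ab1 : a1 < b1 by rewrite lh_mono_lt.
have tK x : tau C (tau (compl C) x) = x by rewrite -lhM crossing_mapC mulgV.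
have back a' b' : a1 <= a' -> a' < b' -> b' <= b1 -> shrinking (origin T (compl C)) a' b' ->
    exists a'' b'', [/\ a <= a'', a'' < b'', b'' <= b & shrinking (origin T C) a'' b''].
  move=> h1 h2 h3 S; exists (tau C a'), (tau C b'); split.
  - by rewrite -(tK a) lh_mono.
  - by rewrite lh_mono_lt.
  - by rewrite -(tK b) lh_mono.
  - by apply: shrinking_transport => //; exact: ltW.
have Hv' := vertex_origin HT TC'.
have [[a' [b' [h1 h2 h3 H]]]|] := grid_gap ab1.
  by apply: (back a' b') => //; apply: shrinking_off => //; [exact: ltW|move=> D TD _; exact: H].
move=> /(_ (origin T (compl C)))[H|[D [TD oD nD]]].
  by apply: (back a1 b1) => //; apply: shrinking_off => //; exact: ltW.
have [DC|DC] := pselect (D = compl C).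
  exists a, b; split=> //; apply: shrinking_edge => //; first exact: ltW.
  by rewrite DC in nD.
have oab : off (compl C) a1 b1.
  apply: near_off nD => //; first exact: ltW.
  by left; split=> // /esym.
have [_ le1] := crossing_map_contract TC (ltW ab1) oab.
have [|a' [b' [h1 h2 h3 S]]] := IH D a1 b1 TD ab1 nD.
  move: Ln; rewrite exprS -mulrA mulrCA => /lt_le_trans; apply.
  rewrite ler_wpM2l ?exprn_ge0//.
  move: le1; rewrite !tK => le1.
  have : c * (b1 - a1) <= 1 / 2 * (b1 - a1) by rewrite ler_wpM2r// subr_ge0 ltW.
  lra.
by apply: (back a' b') => //; rewrite -oD.
Qed.

Lemma exists_shrinking v a b : vertex T v -> a < b ->
  exists a' b', [/\ a <= a', a' < b', b' <= b & shrinking v a' b'].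
Proof.
move=> Hv ab; have [[a' [b' [h1 h2 h3 H]]]|] := grid_gap ab.
  exists a', b'; split=> //; apply: shrinking_off => //; first exact: ltW.
  by move=> D TD _; exact: H.
move=> /(_ v)[H|[D [TD oD nD]]].
  by exists a, b; split=> //; apply: shrinking_off => //; exact: ltW.
have ba : 0 < b - a by rewrite subr_gt0.
have [n Hn] : exists n : nat, L / (b - a) < n%:R.
  exists (Num.bound `|L / (b - a)|); apply: le_lt_trans (ler_norm _) _.
  exact: archi_boundP.
rewrite -oD; apply: (@exists_shrinking_near n) => //.
rewrite -ltr_pdivrMr//; apply: lt_le_trans Hn _.
elim: n => [|n IH]; first by rewrite expr0.
rewrite exprS -natr1; have : 1 <= 2 ^+ n :> R by rewrite exprn_ege1// ler1n.
lra.
Qed.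

(** For faithfulness: the path from [v] to its image is not empty. *)
Lemma transport_nontrivial v g a b : vertex T v -> vact g v <> v -> a < b ->
  (forall D, T D -> off D a b) ->
  (W v (vact g v) * t g)%g b - (W v (vact g v) * t g)%g a < b - a.
Proof.
move=> Hv gv ab H.
have [s Hs nb] := exists_reduced_path HT Hv (vertex_vact HT g Hv).
case: s Hs nb => [/esym//|C s] Hs nb.
have /edge_path_cat[u [_ [TE oE Eg]]] : edge_path T v (belast C s ++ [:: last C s]) (vact g v).
  by rewrite cats1 -lastI.
have TE' := cut_compl HT TE.
have oab : off (compl (last C s)) (t g a) (t g b).
  rewrite -[compl _](ltrKV g); apply: off_ltr; first exact: (cut_ltr HT).
  by apply: H; exact: (cut_ltr HT).
rewrite (transportE HT tauC Hs) ?lhM.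
have tab : t g a <= t g b by rewrite lh_mono ltW.
have [_ le1] := path_contract Hs nb tab oab.
apply: le_lt_trans le1 _; rewrite t_isometry.
rewrite gtr_pMl ?subr_gt0//; apply: exprn_ilt1 => //; first exact: ltW.
by apply: le_lt_trans c12 _; rewrite ltr_pdivrMr// mul1r ltr1n.
Qed.

End PingPong.

(** * Half turns about the edges *)

Lemma dvdzD (d x y : int) : (d %| x)%Z -> (d %| y)%Z -> (d %| (x + y)%R)%Z.
Proof. exact: rpredD. Qed.

Lemma dvdzN (d x : int) : (d %| (- x)%R)%Z = (d %| x)%Z.
Proof. exact: rpredN. Qed.

Lemma dvdzB (d x y : int) : (d %| x)%Z -> (d %| y)%Z -> (d %| (x - y)%R)%Z.
Proof. exact: rpredB. Qed.

(** A coset of a subgroup of the integers containing [N]. *)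
Lemma arithmetic_progression (c : int -> Prop) (N : nat) x0 : (0 < N)%N -> c x0 ->
  (forall x y z, c x -> c y -> c z -> c (x - y + z)%R) ->
  (forall x, c x -> c (x + N%:Z)%R) ->
  exists n : nat, [/\ (0 < n)%N, (n %| N)%N &
    forall x y, c x -> (c y <-> (n %| (y - x)%R)%Z)].
Proof.
move=> N0 cx0 cc cN.
have per (d : int) x : c (x0 + d)%R -> c x -> c (x + d)%R.
  by move=> H cx; rewrite (_ : (x + d = (x0 + d) - x0 + x)%R); [exact: cc|ring].
have perN (d : int) : c (x0 + d)%R -> c (x0 - d)%R.
  by move=> H; rewrite (_ : (x0 - d = x0 - (x0 + d) + x0)%R); [exact: cc|ring].
have ex : exists n : nat, (0 < n)%N && `[< c (x0 + n%:Z)%R >].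
  by exists N; rewrite N0; apply/asboolP; exact: cN.
case: (ex_minnP ex) => n /andP[n0 /asboolP cn] nmin.
have mult (k : int) x : c x -> c (x + k * n%:Z)%R.
  have nat_case (j : nat) y : c y -> c (y + j%:Z * n%:Z)%R /\ c (y - j%:Z * n%:Z)%R.
    move=> cy; elim: j => [|j [H1 H2]]; first by rewrite mul0r ?subr0 ?addr0; split.
    split.
      rewrite (_ : (y + j.+1%:Z * n%:Z = y + j%:Z * n%:Z + n%:Z)%R); first exact: per.
      by rewrite intS; ring.
    rewrite (_ : (y - j.+1%:Z * n%:Z = y - j%:Z * n%:Z - n%:Z)%R).
      by apply: per => //; exact: perN.
    by rewrite intS; ring.
  case: k => j cx; first by case: (nat_case j x cx).
  by rewrite NegzE mulNr; case: (nat_case j.+1 x cx).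
have dvd (d : int) : c (x0 + d)%R -> (n %| d)%Z.
  move=> cd; apply/dvdz_mod0P.
  have r0 : (0 <= (d %% n)%Z)%R by rewrite modz_ge0// -lt0n.
  have rn : ((d %% n)%Z < n%:Z)%R by rewrite ltz_pmod.
  have cr : c (x0 + (d %% n)%Z)%R.
    rewrite (_ : (x0 + (d %% n)%Z = x0 + d + - (d %/ n)%Z * n%:Z)%R); first exact: mult.
    by rewrite {2}(divz_eq d n); ring.
  case: ((d %% n)%Z) r0 rn cr => // r _ rn cr; case: r rn cr => // r rn cr.
  have := nmin r.+1; rewrite /= => /(_ (asboolT cr)).
  by move: rn; rewrite ltz_nat; clear; lia.
exists n; split=> //; first by have := dvd (Posz N) (cN _ cx0).
move=> x y cx; split=> [cy|/dvdzP[k E]].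
  by apply: dvd; rewrite (_ : (x0 + (y - x) = y - x + x0)%R); [exact: cc|ring].
by rewrite (_ : (y = x + k * n%:Z)%R); [exact: mult|rewrite -E; ring].
Qed.

Section Decoration.
Local Open Scope ring_scope.
Variables (R : realType) (gT : groupType) (F : set gT) (T : set (gT -> bool)).
Hypothesis HT : cut_tree F T.
(** Integers that represent the images of the elements in the cyclic group of order
    [m], with kernel in [F]. *)
Variables (m : nat) (r : gT -> int).
Hypothesis m0 : (0 < m)%N.
Hypothesis rM : forall g h, (m %| r (g * h)%g - (r g + r h))%Z.
Hypothesis r_ker : forall k, (m %| r k)%Z -> F k.
Hypothesis F_inv : forall k, F k -> (k * k = 1)%g -> k = 1%g.
Implicit Types (C D E : gT -> bool) (u v w : (gT -> bool) -> bool) (g h k : gT).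

Lemma residue1 : (m %| r 1%g)%Z.
Proof. by have := rM 1%g 1%g; rewrite mulg1 opprD addrA subrr sub0r dvdzN. Qed.

Lemma residueV g : (m %| r g^-1%g + r g)%Z.
Proof.
have := rM g^-1%g g; rewrite mulVg => H.
have := dvdzB residue1 H; congr (_ %| _)%Z; ring.
Qed.

Lemma residue_div g h : (m %| r g - r h)%Z -> (m %| r (g * h^-1)%g)%Z.
Proof.
move=> H; have := dvdzD (dvdzD (rM g h^-1%g) (residueV h)) H.
congr (_ %| _)%Z; ring.
Qed.

(** The quotient of two such elements lies in [F] and fixes a vertex. *)
Lemma residue_free g h v : (m %| r g - r h)%Z -> vertex T v -> vact g v = vact h v -> g = h.
Proof.
move=> /residue_div/r_ker Fk Hv E; apply: contrapT => gh.
apply: (vertex_free HT Fk _ (vertex_vact HT h Hv)).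
  by move=> /mulg1_eq/invg_inj.
by rewrite -vactM mulgKV E.
Qed.

Variable A : set (gT -> bool).
Hypothesis fA : finite_set A.
Hypothesis A_orbits : forall C, T C -> exists g, exists2 D, A D & C = ltr g D.

Let P C D := A D /\ exists g, C = ltr g D.
(** The representative of the orbit, the same for all its members. *)
Let rep C := xget xpredT (P C).

Let repP C : T C -> P C (rep C).
Proof.
move=> /A_orbits[h [D AD E]].
by apply: (xgetPex xpredT); exists D; split=> //; exists h.
Qed.

Let rep_ltr g C : rep (ltr g C) = rep C.
Proof.
suff PE : P (ltr g C) = P C by rewrite /rep PE.
apply/funext => D; apply/propext; split=> -[AD [h E]]; split=> //.
  by exists (g^-1 * h)%g; rewrite ltrM -E ltrK.
by exists (g * h)%g; rewrite ltrM -E.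
Qed.

Let idx C : nat := index (rep C) (fset_set A).
Let q : nat := (size (fset_set A)).+1.
Let N : nat := (m * q)%N.

Let idx_lt C : (idx C < q)%N.
Proof. by rewrite ltnS index_size. Qed.

Let idx_inj C D : T C -> T D -> idx C = idx D -> rep C = rep D.
Proof.
move=> /repP[AC _] /repP[AD _].
have mem E : A E -> E \in fset_set A by move=> AE; rewrite in_fset_set// mem_set.
by rewrite /idx => /(@index_inj _ xpredT); apply; exact: mem.
Qed.

Let N0 : (0 < N)%N. Proof. by rewrite muln_gt0 m0. Qed.

(** The numerators, over the denominator [N], of the centres of the attracting
    region of [C]: the class of the numerator modulo [q] records the orbit of
    [C], and its quotient by [q] the residues of the elements that carry the
    representative of the orbit to [C]. *)
Definition center C (x : int) : Prop := exists j : int, x = (idx C)%:Z + q%:Z * j /\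
  exists g, C = ltr g (rep C) /\ (m %| j - r g)%Z.

Lemma center_ltr g C x : center C x -> center (ltr g C) (x + q%:Z * r g).
Proof.
move=> [j [-> [h [E mj]]]]; exists (j + r g); split.
  by rewrite /idx rep_ltr; ring.
exists (g * h)%g; split; first by rewrite rep_ltr ltrM -E.
have := dvdzB mj (rM g h); congr (_ %| _)%Z; ring.
Qed.

Lemma center_nonempty C : T C -> exists x, center C x.
Proof.
move=> /repP[_ [g E]]; exists ((idx C)%:Z + q%:Z * r g), (r g); split=> //.
by exists g; rewrite subrr dvdz0.
Qed.

Lemma center_period C x (k : int) : center C x -> center C (x + N%:Z * k).
Proof.
move=> [j [-> [g [E mj]]]]; exists (j + m%:Z * k); split; first by rewrite /N PoszM; ring.
exists g; split=> //; rewrite (_ : _ - _ = m%:Z * k + (j - r g)); last by ring.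
by rewrite rpredD// dvdz_mulr.
Qed.

Lemma center_coset C x y z : center C x -> center C y -> center C z -> center C (x - y + z).
Proof.
move=> [j1 [-> [g1 [E1 H1]]]] [j2 [-> [g2 [E2 H2]]]] [j3 [-> [g3 [E3 H3]]]].
exists (j1 - j2 + j3); split; first by ring.
exists (g1 * (g2^-1 * g3))%g; split.
  by rewrite !ltrM -E3 {2}E2 ltrK -E1.
have := dvdzB (dvdzB (dvdzD H1 H3) H2) (dvdzD (rM g1 (g2^-1 * g3)) (rM g2^-1 g3)).
move=> /dvdzB/(_ (residueV g2)).
congr (_ %| _)%Z; ring.
Qed.

Lemma center_ltrV g C x : center (ltr g C) (x + q%:Z * r g) -> center C x.
Proof.
move=> /(center_ltr g^-1); rewrite ltrK.
have /dvdzP[k E] := residueV g => /(center_period (- k)).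
congr center; rewrite /N PoszM; move: E => /(canRL (addrK _)) ->; ring.
Qed.

(** Two regions with a common centre are equal up to an element of [F], which
    would fix a vertex or reverse an edge. *)
Lemma center_disjoint C D x : T C -> T D ->
  origin T C = origin T D /\ C <> D \/ D = compl C -> center C x -> center D x -> False.
Proof.
move=> TC TD CD [j1 [-> [g1 [E1 H1]]]] [j2 [E [g2 [E2 H2]]]].
have mod_q (i : nat) (j : int) : (i < q)%N -> ((i%:Z + q%:Z * j) %% q)%Z = i%:Z.
  by move=> iq; rewrite addrC mulrC modzMDl modz_small// ltz_nat iq.
have iE : idx C = idx D.
  have := mod_q (idx C) j1 (idx_lt C); rewrite E mod_q//; first by case.
have jE : j1 = j2.
  by move: E; rewrite iE => /addrI/mulfI; apply.
have rE := idx_inj TC TD iE.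
have m12 : (m %| r g1 - r g2)%Z.
  by have := dvdzB H2 H1; rewrite jE; congr (_ %| _)%Z; ring.
have DE : D = ltr (g2 * g1^-1)%g C by rewrite ltrM E1 ltrK rE -E2.
have mk : (m %| r (g2 * g1^-1)%g)%Z by apply: residue_div; rewrite -opprB dvdzN.
have Fk := r_ker mk.
have fixed k : F k -> ltr k C = C -> k = 1%g.
  move=> Fk' kC; apply: contrapT => k1; apply: (vertex_free HT Fk' k1 (vertex_origin HT TC)).
  by rewrite -(origin_ltr HT) kC.
case: CD => [[oCD nCD]|DC].
  have gE : g2 = g1.
    apply: (residue_free (v := origin T (rep C))).
    - by rewrite -opprB dvdzN.
    - apply: (vertex_origin HT); apply/(T_ltr HT g1); rewrite -E1//.
    - by rewrite -!(origin_ltr HT) -E1 rE -E2 oCD.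
  by apply: nCD; rewrite E1 rE -gE -E2.
have k1 : (g2 * g1^-1 = 1)%g.
  apply: (F_inv Fk); apply: fixed; last by rewrite ltrM -DE DC ltr_compl -DE DC complK.
  apply: r_ker; have := dvdzD (rM (g2 * g1^-1) (g2 * g1^-1)) (dvdzD mk mk).
  by congr (_ %| _)%Z; ring.
have [y Cy] := cut_nonempty HT TC.
by have := congr1 (fun f => f y) DC; rewrite DE k1 ltr1 /compl Cy.
Qed.

(** The centres lie on the grid of mesh [1 / N], and the regions of radius a
    quarter of the mesh leave gaps between them. *)
Let eps : R := (4 * N%:R)^-1.
Let NR0 : 0 < N%:R :> R. Proof. by rewrite ltr0n. Qed.
Let NRn : N%:R != 0 :> R. Proof. by rewrite gt_eqF. Qed.
Let eps0 : 0 < eps. Proof. by rewrite invr_gt0 mulr_gt0. Qed.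
Let eps4 : N%:R^-1 = 4 * eps. Proof. by rewrite /eps; field. Qed.

Definition half_turn_spec (K : R) (n : nat) (h : line_homeo R) : Prop :=
  [/\ forall (i : int), (h * trans (i%:~R / n%:R) = trans (i%:~R / n%:R) * h)%g,
      (h * h = trans (- n%:R^-1))%g,
      forall x, analytic_at h x,
      forall x y, x <= y -> h y - h x <= K * (y - x)
    & forall (i : int) x y, x <= y -> i%:~R / n%:R + eps <= x ->
         y <= (i + 1)%:~R / n%:R - eps ->
         h y - h x <= 1 / 2 * (y - x) /\
         exists j : int, j%:~R / n%:R - eps <= h x /\ h y <= j%:~R / n%:R + eps].

Lemma exists_half_turns : exists (K : R) (hs : nat -> line_homeo R), 0 < K /\
  forall n, (0 < n <= N)%N -> half_turn_spec K n (hs n).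
Proof.
have ex n : exists Kh : R * line_homeo R, 0 < Kh.1 /\ ((0 < n <= N)%N -> half_turn_spec Kh.1 n Kh.2).
  have [nN|nN] := boolP (0 < n <= N)%N; last by exists (1, 1%g).
  have [n0 nN'] := andP nN.
  have lt : eps < (2 * n%:R)^-1.
    rewrite /eps ltf_pV2 ?posrE ?mulr_gt0 ?ltr0n// -!natrM ltr_nat.
    by move: nN' n0; clear; lia.
  have [h [h1 h2 h3 [K K0 h4] h5]] := @exists_half_turn R n eps (1 / 2) n0 eps0 lt ltac:(lra).
  by exists (K, h).
have [f Hf] := choice ex.
pose K := 1 + \sum_(n < N.+1) (f n).1.
have K0 : 0 < K.
  by apply: ltr_wpDr => //; apply: sumr_ge0 => i _; case: (Hf i) => /ltW.
exists K, (fun n => (f n).2); split=> // n nN.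
have [fn0 /(_ nN)[h1 h2 h3 h4 h5]] := Hf n; split=> // x y xy.
apply: le_trans (h4 x y xy) _; rewrite ler_wpM2r ?subr_ge0//.
have nN' : (n < N.+1)%N by rewrite ltnS; case/andP: nN.
rewrite /K (bigD1 (Ordinal nN'))//= addrCA lerDl.
by apply: addr_ge0 => //; apply: sumr_ge0 => i _; case: (Hf i) => /ltW.
Qed.

Variables (K : R) (hs : nat -> line_homeo R).
Hypothesis K0 : 0 < K.
Hypothesis hsP : forall n, (0 < n <= N)%N -> half_turn_spec K n (hs n).

Let pos (x : int) : R := x%:~R / N%:R.

Let posD x y : pos (x + y) = pos x + pos y.
Proof. by rewrite /pos intrD mulrDl. Qed.

(** A half turn that attracts to the points [(x + j n) / N] what avoids them. *)
Definition turn_conj (x : int) (n : nat) : line_homeo R :=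
  (trans (pos x) * hs (N %/ n) * trans (- pos x))%g.

Let progressionP C : T C -> exists n : nat, [/\ (0 < n)%N, (n %| N)%N &
  forall x y, center C x -> (center C y <-> (n %| (y - x)%R)%Z)].
Proof.
move=> TC; have [x0 cx0] := center_nonempty TC.
apply: (arithmetic_progression N0 cx0); first exact: center_coset.
by move=> x /(center_period 1); rewrite mulr1.
Qed.

(** Chosen by its description, since [x] and [n] are not determined. *)
Definition flip C : line_homeo R := xget 1%g [set h | exists x n,
  [/\ center C x, (0 < n)%N, (n %| N)%N,
      forall y, center C y <-> (n %| (y - x)%R)%Z & h = turn_conj x n]].

Let spec_of n : (0 < n)%N -> (n %| N)%N -> half_turn_spec K (N %/ n) (hs (N %/ n)).
Proof.
by move=> n0 nN; apply: hsP; rewrite divn_gt0// (dvdn_leq N0 nN) leq_div.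
Qed.

Let pos_mul n (i : int) : (0 < n)%N -> (n %| N)%N -> pos (i * n%:Z) = i%:~R / (N %/ n)%:R.
Proof.
move=> n0 nN; rewrite /pos intrM -{1}(divnK nN) natrM.
have d0 : (N %/ n)%:R != 0 :> R by rewrite pnatr_eq0 -lt0n divn_gt0// (dvdn_leq N0 nN).
have n0' : n%:R != 0 :> R by rewrite pnatr_eq0 -lt0n.
rewrite -[n%:Z%:~R]/(n%:R : R); field.
by rewrite d0 n0'.
Qed.

(** The centres of [C] determine [n], and they determine [x] up to a multiple of
    [n], which disappears because half turns commute with their period. *)
Lemma flipE C x n : T C -> center C x -> (0 < n)%N -> (n %| N)%N ->
  (forall y, center C y <-> (n %| (y - x)%R)%Z) -> flip C = turn_conj x n.
Proof.
move=> TC cx n0 nN cn; rewrite /flip; case: xgetP; last first.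
  by move=> /(_ (turn_conj x n)); case; exists x, n.
move=> _ _ [x' [n' [cx' n'0 n'N cn' ->]]].
have nn : n = n'.
  apply/eqP; rewrite eqn_dvd; apply/andP; split.
    have /cn H : center C (x' + n'%:Z) by apply/cn'; rewrite addrAC subrr add0r.
    have /cn H' := cx'; suff : (n%:Z %| n'%:Z)%Z by [].
    have := dvdzB H H'; congr (_ %| _)%Z; ring.
  have /cn' H : center C (x + n%:Z) by apply/cn; rewrite addrAC subrr add0r.
  have /cn' H' := cx; suff : (n'%:Z %| n%:Z)%Z by [].
  have := dvdzB H H'; congr (_ %| _)%Z; ring.
have /cn /dvdzP[i E] := cx'; rewrite -nn.
have [comm _ _ _ _] := spec_of n0 nN.
have -> : x' = x + i * n%:Z by rewrite -E; ring.
rewrite /turn_conj posD pos_mul//; set a := pos x; set b := _ / _.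
rewrite (_ : - (a + b) = - b - a); last by ring.
rewrite !transD -!mulgA; congr (_ * _)%g; rewrite !mulgA -comm.
by rewrite -(mulgA (hs _)) -transD subrr trans0 mulg1.
Qed.

Definition residue_trans g : line_homeo R := trans ((r g)%:~R / m%:R).

Let pos_residue g : pos (q%:Z * r g) = (r g)%:~R / m%:R.
Proof.
have mn : m%:R != 0 :> R by rewrite pnatr_eq0 -lt0n.
have qn : q%:R != 0 :> R by rewrite pnatr_eq0.
rewrite /pos intrM /N natrM -[q%:Z%:~R]/(q%:R : R); field.
by rewrite mn qn.
Qed.

Lemma flip_ltr g C : T C ->
  flip (ltr g C) = (residue_trans g * flip C * (residue_trans g)^-1)%g.
Proof.
move=> TC; have [n [n0 nN cn]] := progressionP TC.
have [x cx] := center_nonempty TC.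
rewrite (flipE TC cx n0 nN (fun y => cn x y cx)).
rewrite (@flipE _ (x + q%:Z * r g) n)//; first last.
- move=> y; rewrite (_ : y - _ = y - q%:Z * r g - x); last by ring.
  rewrite -(cn x)//; split.
    by move=> cy; apply: (@center_ltrV g); rewrite subrK.
  by move=> /(center_ltr g); rewrite subrK.
- exact: center_ltr.
- exact: (cut_ltr HT).
rewrite /turn_conj posD pos_residue /residue_trans -transN; set a := pos x; set b := _ / _.
rewrite !mulgA -transD -!mulgA -transD; congr (trans _ * (_ * trans _))%g; ring.
Qed.

Definition in_region C a b := exists x : int, [/\ center C x, pos x - eps <= a & b <= pos x + eps].

Definition off_region C a b := forall x : int, center C x -> b <= pos x - eps \/ pos x + eps <= a.

Let pos_lt x y : x < y -> pos x + 4 * eps <= pos y.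
Proof.
move=> xy; rewrite -eps4 -[N%:R^-1]mul1r -mulrDl ler_pM2r ?invr_gt0//.
by rewrite -[1 : R]/(1%:~R) -intrD ler_int; move: xy; clear; lia.
Qed.

Let near_other x y a b : x <> y -> pos y - eps <= a -> b <= pos y + eps ->
  b <= pos x - eps \/ pos x + eps <= a.
Proof.
move=> /eqP; rewrite neq_lt => /orP[] /pos_lt; have := eps0; [right|left]; lra.
Qed.

Lemma region_off C D a b : T C -> T D ->
  origin T C = origin T D /\ C <> D \/ D = compl C -> in_region D a b -> off_region C a b.
Proof.
move=> TC TD CD [y [cy h1 h2]] x cx; apply: near_other h1 h2 => E.
by apply: center_disjoint CD cx _ => //; rewrite E.
Qed.

Lemma region_size C a b : in_region C a b -> b - a <= 2 * eps.
Proof. by move=> [x [_ h1 h2]]; lra. Qed.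

Lemma off_region_ltr g C a b : off_region C a b -> off_region (ltr g C) (residue_trans g a) (residue_trans g b).
Proof.
move=> H x cx; have cx' : center C (x - q%:Z * r g).
  by apply: (@center_ltrV g); rewrite subrK.
have := posD (x - q%:Z * r g) (q%:Z * r g); rewrite subrK pos_residue !transE => E.
by case: (H _ cx') => h; [left|right]; rewrite E; lra.
Qed.

(** An interval that avoids the centres lies between two consecutive ones. *)
Lemma flip_off_inside C a b : T C -> a <= b -> off_region C a b ->
  in_region C (flip C a) (flip C b) /\ flip C b - flip C a <= 1 / 2 * (b - a).
Proof.
move=> TC ab oab; have [n [n0 nN cn]] := progressionP TC.
have [x cx] := center_nonempty TC.
have kn : (0 < N %/ n)%N by rewrite divn_gt0// (dvdn_leq N0 nN).
have [_ _ _ _ contr] := spec_of n0 nN.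
rewrite (flipE TC cx n0 nN (fun y => cn x y cx)) /turn_conj.
rewrite -[X in in_region _ X]/(hs (N %/ n) (a - pos x) + pos x).
rewrite -[X in in_region _ _ X]/(hs (N %/ n) (b - pos x) + pos x).
set h := hs _ in contr *; pose k : R := (N %/ n)%:R.
have k0 : 0 < k by rewrite ltr0n.
pose i := Num.floor ((a - pos x) * k).
have i1 : i%:~R / k <= a - pos x by rewrite ler_pdivrMr// floor_le.
have i2 : a - pos x < (i + 1)%:~R / k by rewrite ltr_pdivlMr// floorD1_gt.
have cnt j : center C (x + j * n%:Z) by apply/(cn x) => //; rewrite addrAC subrr add0r dvdz_mull.
have h1 := oab _ (cnt i); have h2 := oab _ (cnt (i + 1)).
rewrite !posD !pos_mul// -/k in h1 h2; have e0 := eps0.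
have g1 : i%:~R / k + eps <= a - pos x by lra.
have g2 : b - pos x <= (i + 1)%:~R / k - eps by lra.
have ab' : a - pos x <= b - pos x by rewrite lerD2r.
have [c1 [j [c2 c3]]] := contr i _ _ ab' g1 g2; split.
  by exists (x + j * n%:Z); rewrite posD pos_mul// -/k; split; [exact: cnt|lra|lra].
rewrite -[X in X - _ <= _]/(h (b - pos x) + pos x) -[X in _ - X <= _]/(h (a - pos x) + pos x).
lra.
Qed.

(** The inverse differs from the half turn by a translation that permutes the
    centres. *)
Lemma flipV_shift C : T C -> exists i : int, (forall x, (flip C)^-1%g x = flip C x + pos i) /\
  forall x, center C x -> center C (x + i).
Proof.
move=> TC; have [n [n0 nN cn]] := progressionP TC.
have [x cx] := center_nonempty TC.
have [_ hh _ _ _] := spec_of n0 nN; exists n%:Z; split; last first.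
  by move=> y cy; apply/(cn y) => //; rewrite addrAC subrr add0r.
move=> y; rewrite (flipE TC cx n0 nN (fun y => cn x y cx)) /turn_conj.
have -> : pos n%:Z = (N %/ n)%:R^-1 by rewrite -[n%:Z]mul1r pos_mul// mul1r.
have hV : ((hs (N %/ n))^-1 = trans (N %/ n)%:R^-1 * hs (N %/ n))%g.
  by apply: (@mulIg _ (hs (N %/ n))); rewrite mulVg -mulgA hh -transD subrr trans0.
rewrite !invgM -!transN opprK hV -[LHS]/((hs (N %/ n) (y - pos x) + (N %/ n)%:R^-1) + pos x).
by rewrite -[X in _ = X + _]/(hs (N %/ n) (y - pos x) + pos x) addrAC.
Qed.

Lemma flipV_off_inside C a b : T C -> a <= b -> off_region C a b ->
  in_region C ((flip C)^-1%g a) ((flip C)^-1%g b) /\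
  (flip C)^-1%g b - (flip C)^-1%g a <= 1 / 2 * (b - a).
Proof.
move=> TC ab oab; have [i [E ci]] := flipV_shift TC.
have [[x [cx h1 h2]] h3] := flip_off_inside TC ab oab; rewrite !E; split; last by lra.
by exists (x + i); rewrite posD; split; [exact: ci|lra|lra].
Qed.

Lemma flip_lip C a b : T C -> a <= b ->
  flip C b - flip C a <= K * (b - a) /\ (flip C)^-1%g b - (flip C)^-1%g a <= K * (b - a).
Proof.
move=> TC ab; have [i [E _]] := flipV_shift TC.
suff H : flip C b - flip C a <= K * (b - a) by rewrite !E; split=> //; lra.
have [n [n0 nN cn]] := progressionP TC; have [x cx] := center_nonempty TC.
rewrite (flipE TC cx n0 nN (fun y => cn x y cx)) /turn_conj.
have [_ _ _ lip _] := spec_of n0 nN.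
have ab' : a - pos x <= b - pos x by rewrite lerD2r.
have := lip _ _ ab'; set h := hs _.
rewrite -[X in _ -> X - _ <= _]/(h (b - pos x) + pos x).
rewrite -[X in _ -> _ - X <= _]/(h (a - pos x) + pos x).
by rewrite (_ : b - pos x - (a - pos x) = b - a); [lra|ring].
Qed.

Lemma flip_analytic C : T C ->
  (forall x, analytic_at (flip C) x) /\ forall x, analytic_at (flip C)^-1%g x.
Proof.
move=> TC; have [i [E _]] := flipV_shift TC.
have an : forall x, analytic_at (flip C) x.
  move=> y; have [n [n0 nN cn]] := progressionP TC; have [x cx] := center_nonempty TC.
  rewrite (flipE TC cx n0 nN (fun y => cn x y cx)) /turn_conj.
  have [_ _ ha _ _] := spec_of n0 nN.
  have a1 := analytic_at_comp (analytic_at_affine 1 (- pos x) y) (ha _).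
  have a2 := analytic_at_comp a1 (analytic_at_affine 1 (pos x) _).
  by apply: eq_analytic_at a2 => z; rewrite /= !mul1r.
split=> // x; have a2 := analytic_at_comp (an x) (analytic_at_affine 1 (pos i) _).
by apply: eq_analytic_at a2 => z; rewrite E /= mul1r.
Qed.

(** An interval in the gap after the grid point 0. *)
Lemma exists_off_region : exists a b, a < b /\ forall D, T D -> off_region D a b.
Proof.
have e0 := eps0; exists eps, (2 * eps); split; first by lra.
move=> D TD x _.
have [x0|x0] := leP x 0.
  right; have : pos x <= 0 by rewrite mulr_le0_ge0 ?invr_ge0 ?ler0n// lerz0.
  lra.
left; have := pos_lt x0; rewrite {1}/pos mul0r; lra.
Qed.

(** Let [x] be the grid point nearest to [a].  Either the interval reaches out of
    the neighbourhood of [x], and contains part of a gap, or it is contained in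
    this neighbourhood, which is a component of the region of some edge at [v] or
    meets none of these regions. *)
Lemma grid_gap a b : a < b ->
  (exists a' b', [/\ a <= a', a' < b', b' <= b & forall D, T D -> off_region D a' b']) \/
  forall v, (forall D, T D -> origin T D = v -> off_region D a b) \/
            exists D, [/\ T D, origin T D = v & in_region D a b].
Proof.
move=> ab; have e0 := eps0; pose x := Num.floor (a * N%:R + 1 / 2).
have posE z : (pos x <= z) = (x%:~R <= z * N%:R) by rewrite ler_pdivrMr.
have x1 : pos x - 2 * eps <= a.
  have : x%:~R <= a * N%:R + 1 / 2 by exact: floor_le.
  rewrite -(ler_pM2r (_ : 0 < N%:R^-1)) ?invr_gt0// -/(pos x) mulrDl mulfK//.
  by rewrite eps4; lra.
have x2 : a < pos x + 2 * eps.
  have : a * N%:R + 1 / 2 < (x + 1)%:~R by exact: floorD1_gt.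
  rewrite -(ltr_pM2r (_ : 0 < N%:R^-1)) ?invr_gt0// -/(pos (x + 1)) mulrDl mulfK//.
  by rewrite posD {2}/pos mul1r eps4; lra.
have away a' b' : pos x + eps <= a' \/ b' <= pos x - eps ->
    pos x - 3 * eps <= a' -> b' <= pos x + 3 * eps -> forall D, T D -> off_region D a' b'.
  move=> H l1 l2 D _ y _.
  have [yx|xy|->] := ltgtP y x; [|
    |by case: H; [right|left]].
    by right; have := pos_lt yx; lra.
  by left; have := pos_lt xy; lra.
have [ax|xa] := ltP a (pos x - eps).
  left; exists a, (Num.min b (pos x - eps)); split=> //.
  - by rewrite lt_min ab.
  - by rewrite ge_min lexx.
  - by apply: away; [right; rewrite ge_min lexx orbT|lra|rewrite ge_min; apply/orP; right; lra].
have [xb|bx] := ltP (pos x + eps) b.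
  left; exists (Num.max a (pos x + eps)), (Num.min b (pos x + 3 * eps)); split.
  - by rewrite le_max lexx.
  - by rewrite gt_max !lt_min ab xb /=; apply/andP; split; lra.
  - by rewrite ge_min lexx.
  - by apply: away; [left; rewrite le_max lexx orbT|rewrite le_max; apply/orP; left; lra|rewrite ge_min lexx orbT].
right=> v; have [[D [TD oD cx]]|nD] := pselect (exists D, [/\ T D, origin T D = v & center D x]).
  by right; exists D; split=> //; exists x.
left=> D TD oD y cy; apply: near_other xa bx => E; apply: nD; exists D.
by rewrite -E.
Qed.

End Decoration.

(** * The lifted action *)

Section Bianalytic.
Local Open Scope ring_scope.
Variable R : realType.
Implicit Types f : line_homeo R.

Definition bianalytic f : Prop :=
  (forall x, analytic_at f x) /\ forall x, analytic_at f^-1%g x.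

Lemma bianalyticM f1 f2 : bianalytic f1 -> bianalytic f2 -> bianalytic (f1 * f2)%g.
Proof.
move=> [a1 b1] [a2 b2]; split=> x.
  exact: (analytic_at_comp (a2 x) (a1 _)).
by rewrite invgM; exact: (analytic_at_comp (b1 x) (b2 _)).
Qed.

Lemma bianalyticV f : bianalytic f -> bianalytic f^-1%g.
Proof. by move=> [a b]; split=> // x; rewrite invgK. Qed.

Lemma bianalytic_trans a : bianalytic (trans a).
Proof.
have H b x : analytic_at (trans b) x.
  by apply: eq_analytic_at (analytic_at_affine 1 b x) => y; rewrite mul1r.
by split=> x; rewrite -?transN.
Qed.

End Bianalytic.

Section LiftedAction.
Local Open Scope ring_scope.
Variables (R : realType) (gT : groupType) (F : set gT) (T : set (gT -> bool)).
Hypothesis HT : cut_tree F T.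
Variables (m : nat) (r : gT -> int).
Hypothesis m0 : (0 < m)%N.
Hypothesis rM : forall g h, (m %| r (g * h)%g - (r g + r h))%Z.
Hypothesis r_ker : forall k, (m %| r k)%Z -> F k.
Hypothesis F_inv : forall k, F k -> (k * k = 1)%g -> k = 1%g.
Variables (aT : finType) (p : gT -> aT).
Hypothesis pr : forall g h, p g = p h -> r g = r h.

(** Transport from the base vertex to its image, preceded by the rotation.  The
    rotations are additive up to integers only, whence the integer translations
    in the first and the third condition. *)
Lemma exists_lifted_action : exists M : gT -> line_homeo R,
  [/\ forall g h, exists n : int, M (g * h)%g = (M g * M h * trans n%:~R)%g,
      forall g, bianalytic (M g),
      forall g (n : int), M g = trans n%:~R -> g = 1%g
    & forall a b, a < b -> exists a' b', [/\ a <= a', a' < b', b' <= b &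
        forall d, 0 < d -> finite_set [set g | d <= M g b' - M g a']]].
Proof.
have [A [fA _ A_orb]] := cut_orbits HT.
have [K [hs [K0 hsP]]] := @exists_half_turns R gT m m0 A.
pose fl := flip m r A hs; pose t := residue_trans R m r.
pose tau := crossing_map fl; pose W := transport T tau.
pose v0 := principal T 1%g.
have Hv0 : vertex T v0 := vertex_principal HT 1%g.
have Hv g : vertex T (vact g v0) := vertex_vact HT g Hv0.
have t_iso g a b : t g b - t g a = b - a by rewrite /t /residue_trans !transE; ring.
have fl_ltr g C : T C -> fl (ltr g C) = (t g * fl C * (t g)^-1)%g.
  by move=> TC; exact: (flip_ltr HT m0 rM A_orb hsP).
have tauC C : T C -> tau (compl C) = (tau C)^-1%g by move=> _; exact: crossing_mapC.
have tau_ltr g C : T C -> tau (ltr g C) = (t g * tau C * (t g)^-1)%g.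
  by move=> TC; exact: (crossing_map_ltr HT fl_ltr).
have free g h v : p g = p h -> vertex T v -> vact g v = vact h v -> g = h.
  by move=> /pr E; apply: (residue_free HT rM r_ker); rewrite E subrr dvdz0.
have fl_off C a b (TC : T C) := flip_off_inside m0 rM A_orb hsP (a := a) (b := b) TC.
have flV_off C a b (TC : T C) := flipV_off_inside m0 rM A_orb hsP (a := a) (b := b) TC.
have fl_lip C a b (TC : T C) := flip_lip m0 rM A_orb hsP (a := a) (b := b) TC.
have reg_off C D (a b : R) : T C -> T D -> a <= b -> origin T C = origin T D /\ C <> D \/ D = compl C ->
    in_region m r A D a b -> off_region m r A C a b.
  by move=> TC TD _; exact: (region_off HT m0 rM r_ker F_inv fA A_orb).
have c0 : 0 < 1 / 2 :> R by lra.
exists (fun g => W v0 (vact g v0) * t g)%g; split.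
- move=> g h; have /dvdzP[n E] := rM g h; exists n.
  have tM : t (g * h)%g = (t g * t h * trans n%:~R)%g.
    rewrite /t /residue_trans -!transD; congr trans.
    have mn : m%:R != 0 :> R by rewrite pnatr_eq0 -lt0n.
    have -> : r (g * h)%g = r g + r h + n * m%:Z by rewrite -E; ring.
    rewrite !intrD intrM -[m%:Z%:~R]/(m%:R : R); field.
    exact: mn.
  rewrite tM -[W v0 (vact (g * h) v0)](transportM HT tauC Hv0 (Hv g) (Hv _)).
  rewrite vactM (transport_vact HT tauC tau_ltr g Hv0 (Hv h)) -!mulgA; congr (_ * (_ * (_ * _)))%g.
  by rewrite mulKg.
- move=> g; apply: bianalyticM; last exact: bianalytic_trans.
  have [s Hs] := exists_edge_path HT Hv0 (Hv g).
  rewrite /W (transportE HT tauC Hs); move: Hs.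
  move: (v0) (vact g v0) => v w; elim: s v => [|C s IH] v.
    by rewrite /path_value big_nil -trans0 => _; exact: bianalytic_trans.
  move=> [TC _ Hs']; rewrite path_value_cons; apply: bianalyticM; last exact: IH Hs'.
  have flb D : T D -> bianalytic (fl D) by exact: (flip_analytic m0 rM A_orb hsP).
  apply: bianalyticM; first exact: flb.
  by apply: bianalyticV; apply: flb; exact: (cut_compl HT).
- move=> g n E; have [a [b [ab oab]]] := exists_off_region R T r m0 A.
  have [gv|gv] := pselect (vact g v0 = v0).
    have : t g 0 = n%:~R.
      by rewrite -[t g 0]/((1%g * t g)%g 0) -(transport1 HT tauC v0) -{2}gv E transE add0r.
    rewrite /t /residue_trans transE add0r => tE.
    apply: (residue_free HT rM r_ker _ Hv0); last by rewrite gv vact1.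
    have mn : m%:R != 0 :> R by rewrite pnatr_eq0 -lt0n.
    apply: dvdzB (residue1 rM); apply/dvdzP; exists n; apply: (@intr_inj R).
    by rewrite intrM -tE divfK.
  have := transport_nontrivial HT c0 (lexx _) t_iso fl_off flV_off reg_off _ Hv0 gv ab oab.
  move=> /(_ _)/wrap[|].
    by move=> g' C a' b' _; exact: (off_region_ltr m0 rM).
  by rewrite -/tau -/W E !transE => h; exfalso; lra.
move=> a b ab.
have o_ltr g C a' b' : T C -> off_region m r A C a' b' ->
    off_region m r A (ltr g C) (t g a') (t g b').
  by move=> _; exact: (off_region_ltr m0 rM).
exact: (exists_shrinking HT free c0 (lexx _) K0 t_iso fl_ltr fl_off flV_off fl_lip reg_off
  o_ltr (@region_size R gT m r A) (grid_gap T r m0 A) Hv0 ab).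
Qed.

End LiftedAction.

(** * Local discreteness *)

Section LocalDiscreteness.
Local Open Scope ring_scope.
Local Open Scope quotient_scope.
Variable R : realType.

Lemma half_not_int (n k : int) : n%:~R <> k%:~R + 1 / 2 :> R.
Proof.
move=> E; have : (n * 2)%:~R = (k * 2 + 1)%:~R :> R by rewrite intrD !intrM E; field.
by move=> /intr_inj; clear; lia.
Qed.

(** The difference of two lifts is continuous with integer values. *)
Lemma lift_unique (f : line_homeo R) (F : R -> R) : is_lift (homeo_of f) F -> continuous F ->
  exists n : int, forall t, F t = f t + n%:~R.
Proof.
move=> fF cF.
have disp t : exists n : int, F t - f t = n%:~R.
  by apply/intrP/circle_projP; rewrite -fF /= circle_map_lift.
have [n n0] := disp 0; exists n => t.
suff : F t - f t = F 0 - f 0 by rewrite n0; lra.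
have const x y : x <= y -> F x - f x = F y - f y.
  move=> xy; have [a Ea] := disp x; have [b Eb] := disp y.
  apply: contrapT; rewrite Ea Eb => ab.
  have ab' : a <> b by move=> E; apply: ab; rewrite E.
  have cD : {within `[x, y], continuous (F \- f)}.
    apply: continuous_subspaceT => z; apply: cvgB; [exact: cF|exact: lh_continuous].
  pose c := Num.min a b.
  have [|z _ Ez] := @IVT R (F \- f) x y (c%:~R + 1 / 2) xy cD.
    rewrite /= Ea Eb; apply/andP; split.
      have -> : Num.min a%:~R b%:~R = c%:~R :> R.
        by rewrite /c; case: (leP a b) => h; [rewrite min_l|rewrite min_r]; rewrite ?ler_int// ltW.
      lra.
    have : (c + 1)%:~R <= Num.max a%:~R b%:~R :> R.
      rewrite le_max !ler_int /c; case: (leP a b) => h; apply/orP; [right|left].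
        by move: ab' h; clear; lia.
      by move: h; clear; lia.
    by rewrite intrD; lra.
  by have [d Ed] := disp z; move: Ez; rewrite /= Ed; exact: half_not_int.
by have [t0|t0] := leP t 0; [|apply/esym]; apply: const => //; exact: ltW.
Qed.

Lemma nonint_away (x : R) : x \isn't a Num.int ->
  exists2 e, 0 < e & forall n : int, e <= `|x + n%:~R|.
Proof.
move=> xi; pose k := Num.floor x.
have kx : k%:~R <= x by exact: floor_le.
have kx' : k%:~R < x.
  by rewrite lt_neqAle kx andbT; apply/eqP => E; move: xi; rewrite -E intr_int.
have xk : x < (k + 1)%:~R by exact: floorD1_gt.
exists (Num.min (x - k%:~R) ((k + 1)%:~R - x)).
  by rewrite lt_min !subr_gt0 kx'.
move=> n; rewrite ge_min; apply/orP; have [kn|nk] := leP (- n) k.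
  left; apply: le_trans (ler_norm _).
  have : (- n)%:~R <= k%:~R :> R by rewrite ler_int.
  by rewrite mulrNz; lra.
right; rewrite -normrN; apply: le_trans (ler_norm _).
have : (k + 1)%:~R <= (- n)%:~R :> R by rewrite ler_int; move: nk; clear; lia.
by rewrite mulrNz; lra.
Qed.

Lemma finite_min (I : choiceType) (E : set I) (f : I -> R) : finite_set E ->
  (forall i, 0 < f i) -> exists2 e, 0 < e & forall i, E i -> e <= f i.
Proof.
move=> fE f0; suff [e e0 H] : exists2 e, 0 < e & forall i, i \in fset_set E -> e <= f i.
  by exists e => // i Ei; apply: H; rewrite in_fset_set// mem_set.
suff H (s : seq I) : exists2 e, 0 < e & forall i, i \in s -> e <= f i by exact: H.
elim: s => [|j s [e e0 IH]]; first by exists 1.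
exists (Num.min (f j) e); first by rewrite lt_min f0.
move=> i; rewrite inE => /orP[/eqP->|/IH h]; first by rewrite ge_min lexx.
by rewrite ge_min h orbT.
Qed.

(** By convention the derivative is zero where the function is not differentiable. *)
Lemma derive1_neq0 (F : R -> R) t : derive1 F t != 0 -> is_derive t 1 F (derive1 F t).
Proof.
rewrite derive1E => F0; apply/derivableP; apply: contrapT => nd.
by move: F0; rewrite /derive dvgP ?eqxx.
Qed.

Variables (gT : groupType) (M : gT -> line_homeo R).
Hypothesis MM : forall g h, exists n : int, M (g * h)%g = (M g * M h * trans n%:~R)%g.
Hypothesis M_analytic : forall g, bianalytic (M g).
Hypothesis M_faithful : forall g (n : int), M g = trans n%:~R -> g = 1%g.
Hypothesis M_shrink : forall a b, a < b -> exists a' b', [/\ a <= a', a' < b', b' <= b &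
  forall d, 0 < d -> finite_set [set g | d <= M g b' - M g a']].

Let phi g : homeo_plus R := homeo_of (M g).

Let phiM g h : phi (g * h)%g = (phi g * phi h)%g.
Proof.
by have [n E] := MM g h; rewrite /phi E !homeo_ofM homeo_of_trans_int mulg1.
Qed.

Let phi_inj : injective phi.
Proof.
move=> g h E; have : phi (g^-1 * h)%g = 1%g.
  by rewrite phiM -E -phiM mulVg (inj_hom1 phiM).
by move=> /homeo_of_eq1[n /M_faithful/mulg1_eq]; rewrite invgK.
Qed.

(** Given an interval, take a subinterval that only finitely many elements fail
    to shrink by half.  An element that shrinks it has a derivative at most 1/2
    somewhere, so it is not close to the identity; of the finitely many others,
    those that move a point of the interval move it by a definite amount. *)
Lemma lifted_action_realization : exists H : set (homeo_plus R),
  [/\ subgroup H, H `<=` @analytic_diffeo R, locally_discrete H & isomorphic [set: gT] H].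
Proof.
exists (range phi); split.
- split; first by exists 1%g => //; exact: (inj_hom1 phiM).
  move=> _ _ [g _ <-] [h _ <-]; exists (g * h^-1)%g => //.
  by rewrite phiM (inj_homV phiM).
- move=> _ [g _ <-]; have [a1 a2] := M_analytic g; split.
    by exists (M g); split; [exact: circle_map_lift|exact: a1].
  by rewrite -homeo_ofV; exists (M g)^-1%g; split; [exact: circle_map_lift|exact: a2].
- move=> L _ J iJ [a [b [Ja Jb ab]]] _.
  have [a' [b' [aa' ab' b'b fin]]] := M_shrink ab.
  have J' t : a' <= t <= b' -> J t.
    move=> /andP[h1 h2]; apply: (iJ a b Ja Jb); apply/andP; split; lra.
  pose moved g t := J t /\ M g t - t \isn't a Num.int.
  have ex g : exists e, 0 < e /\ ((exists t, moved g t) ->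
      exists t, J t /\ forall n : int, e <= `|M g t - t + n%:~R|).
    have [[t [Jt nt]]|no] := pselect (exists t, moved g t); last by exists 1.
    by have [e e0 He] := nonint_away nt; exists e; split=> // _; exists t.
  have [ee Hee] := choice ex.
  have d0 : 0 < (b' - a') / 2 by lra.
  have [e e0 He] := finite_min (fin _ d0) (fun g => (Hee g).1).
  exists (Num.min e (1 / 2)); split; first by rewrite lt_min e0; lra.
  move=> _ [g _ <-] [F [lF cF close]].
  have [n Fn] := lift_unique lF cF.
  have [big|small] := leP ((b' - a') / 2) (M g b' - M g a'); last first.
    have dF t : a' <= t <= b' -> is_derive t 1 F (derive1 F t).
      move=> /J'/close[_]; rewrite lt_min => /andP[_ lt]; apply: derive1_neq0.
      by apply/eqP => E; move: lt; rewrite E sub0r normrN normr1; lra.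
    have := @MVT_segment R F (derive1 F) a' b' (ltW ab').
    move=> /(_ _ (continuous_subspaceT cF))/wrap[|].
      by move=> x; rewrite in_itv /= => /andP[/ltW h1 /ltW h2]; apply: dF; rewrite h1 h2.
    move=> [c]; rewrite in_itv /= => cI E.
    have [_] := close c (J' c cI); rewrite lt_min => /andP[_].
    rewrite ltr_distl => /andP[lt _]; move: E; rewrite !Fn => E.
    have : 1 / 2 * (b' - a') < derive1 F c * (b' - a').
      by rewrite ltr_pM2r ?subr_gt0//; lra.
    by rewrite -E; lra.
  have [mv|fixed] := pselect (exists t, moved g t).
    have [e_gt0 /(_ mv)[t [Jt far]]] := Hee g.
    have [+ _] := close t Jt; rewrite lt_min => /andP[lt _].
    have := far n; have := He g big; rewrite (_ : M g t - t + n%:~R = F t - t); last by rewrite Fn; ring.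
    lra.
  move=> t Jt; rewrite /phi /= circle_map_lift; apply/circle_projP.
  by apply: contrapT => /negP nt; apply: fixed; exists t.
- exists phi; split; first by move=> g h _ _; exact: phiM.
  split; [by move=> g _; exists g|by move=> g h _ _; exact: phi_inj|].
  by move=> _ [g _ <-]; exists g.
Qed.

End LocalDiscreteness.

Section Extensions.
Local Open Scope ring_scope.

(** The kernel is free of finite index, so the group acts on a tree; being torsion
    free, the kernel inverts no edge. *)
Lemma cyclic_extension_realization (R : realType) (m : nat) (fT gT : groupType)
    (i : fT -> gT) (p : gT -> Zmod m) : (0 < m)%N -> free_group [set: fT] ->
  finitely_generated [set: gT] -> short_exact [set: fT] [set: gT] i p ->
  exists H : set (homeo_plus R),
    [/\ subgroup H, H `<=` @analytic_diffeo R, locally_discrete H & isomorphic [set: gT] H].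
Proof.
move=> m0 [B fB] fg [iM i_inj pM pG iF].
have iM' x y : i (x * y)%g = (i x * i y)%g by exact: iM.
have i_inj' : injective i by move=> x y; apply: i_inj; apply: mem_set.
pose F := [set g : gT | [set: gT] g /\ p g = 1%g].
have sG : subgroup [set: gT] by split.
have FB : free_basis F (i @` B) by rewrite /F -iF; apply/(free_basis_image iM' i_inj').
have [T HT] := virtually_free_cut_tree fg (ex_intro _ _ FB)
  (ex_intro _ m (kernel_index m0 sG pM pG)).
pose r g : int := (p g : nat)%:Z.
have mE : m.-1.+1 = m by rewrite prednK.
have rM g h : (m %| r (g * h)%g - (r g + r h))%Z.
  have -> : r (g * h)%g = ((p g + p h) %% m)%N%:Z.
    have E : nat_of_ord (p g * p h)%g = ((p g + p h) %% m.-1.+1)%N by [].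
    by rewrite /r pM// E; congr (Posz (_ %% _)).
  by rewrite -PoszD -eqz_mod_dvd !modz_nat modn_mod.
have r_ker k : (m %| r k)%Z -> F k.
  move=> mk; split=> //; apply: val_inj => /=.
  have : (p k < m)%N by have := ltn_ord (p k); rewrite [X in (_ < X)%N -> _]mE.
  move: mk; rewrite /r => mk lt.
  have : (m %| p k)%N by [].
  by rewrite /dvdn modn_small// => /eqP.
have F_inv k : F k -> (k * k = 1)%g -> k = 1%g.
  move=> Fk kk; apply: contrapT => k1; apply: (free_torsion_free FB Fk k1 (m := 2)) => //; exact: kk.
have pr g h : p g = p h -> r g = r h by rewrite /r => ->.
have [M [MM Ma Mf Ms]] := exists_lifted_action R HT m0 rM r_ker F_inv pr.
exact: lifted_action_realization MM Ma Mf Ms.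
Qed.

End Extensions.

Theorem theorem3 (R : realType) :
  (forall G : set (homeo_plus R),
     subgroup G -> finitely_generated G -> virtually_free G ->
     exists (m : nat) (F : set (homeo_plus R)),
       [/\ (0 < m)%N, F `<=` G, free_group F, has_index G F m
         & exists p : homeo_plus R -> Zmod m, short_exact F G id p])
  /\
  (forall (m : nat) (fT gT : groupType) (i : fT -> gT) (p : gT -> Zmod m),
     (0 < m)%N -> free_group [set: fT] -> finitely_generated [set: gT] ->
     short_exact [set: fT] [set: gT] i p ->
     exists H : set (homeo_plus R),
       [/\ subgroup H, H `<=` @analytic_diffeo R, locally_discrete H
         & isomorphic [set: gT] H]).
Proof.
split; first exact: virtually_free_circle_group.
move=> m fT gT i p; exact: cyclic_extension_realization.
Qed.
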